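(* Let $n\geqslant 1$ and let $G$ be a simple graph on $n$ vertices. Write $n-1=9q+r$ with integers $q\geqslant 0$ and $0\leqslant r\leqslant 8$. If \[ e(G)>15q+\left\lfloor\frac{3r}{2}\right\rfloor, \] then $G$ contains a cycle whose length is congruent to $1$ modulo $3$.
   Context: All graphs are finite and simple (no loops, no multiple edges). $e(G)$ denotes the number of edges of $G$. *)

(* Defs.v *)
(* A simple graph on a finite vertex type T is a symmetric,
   irreflexive boolean relation e : rel T. *)
From mathcomp Require Import all_boot.
Set Implicit Arguments. Unset Strict Implicit. Unset Printing Implicit Defensive.

Definition edges (T : finType) (e : rel T) : {set {set T}} :=
  [set [set x; y] | x in T, y in T & e x y].

Definition num_edges (T : finType) (e : rel T) : nat := #|edges e|.

Definition has_cycle_of_length (T : finType) (e : rel T) (k : nat) : Prop :=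
  exists s : seq T, [/\ uniq s, size s = k, 3 <= k & cycle e s].

(* Main.v *)
Require Import Defs.
From mathcomp Require Import all_boot.
From mathcomp Require Import zify.
Set Implicit Arguments. Unset Strict Implicit. Unset Printing Implicit Defensive.

(** Take a counterexample supported on a set [S] of vertices that is as small as possible.
Deleting or identifying a few vertices shows that it is critical: it has no cut vertex, minimum
degree 2, no two adjacent vertices of degree 2, no vertex of degree 3 all of whose neighbours have
degree 2, and a path [b - v - a - z] with [deg v = 2] and [deg a = 3] forces [b] and [z] to have a
further common neighbour (otherwise delete [v], [a] and identify [z] with [b]: cycles of length
1 mod 3 lift).

The main tool is that, under mild conditions, a connected set that is attached to the rest of the
graph through [X] and [Y], and all of whose paths from [X] to [Y] have the same length mod 3, is a
single vertex. If all cycles had length 2 mod 3, it would apply to the components of [S] minus a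
vertex, so there is a cycle of length 0 mod 3; let [C] be a shortest one, with its vertices coloured
by index mod 3. A path off [C] that joins two colours has length 2 mod 3 (not counting the two edges
to [C]), and one that joins distinct vertices of the same colour does not. So a component off [C]
that sees several colours is a path with 3 vertices or a star with 3 leaves, and then [C] has length
6. If every component sees a single colour, two that cross on [C] are single vertices, and a
shortest arc spanned by a component again yields length 6. Around a 6-cycle there is room for at
most 10 vertices in total, and adding up the degrees gives too few edges. *)

(* These tactics decide equality and membership of vertices from the facts [x != y], [x \in A] and
   [x \notin A] in the context, which is why such facts are often asserted just before them. *)
Ltac neq_simpl := repeat match goal with
  | H : is_true (?x != ?y) |- context [?x == ?y] => rewrite (negbTE H)
  | H : is_true (?x != ?y) |- context [?y == ?x] => rewrite (eq_sym y x) (negbTE H)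
  | H : is_true (?x \in ?A) |- context [?x \in ?A] => rewrite H
  | H : is_true (?x \notin ?A) |- context [?x \in ?A] => rewrite (negbTE H)
  | |- context [?x == ?x] => rewrite eqxx
  end.
Ltac mem_simpl := rewrite ?inE; neq_simpl; rewrite /= ?(andbT, andbF, orbT, orbF) //=.
Ltac mem_split := repeat match goal with
  | H : is_true (_ || _) |- _ => case/orP: H => H
  | H : is_true (_ && _) |- _ => let H' := fresh H in case/andP: H => H H'
  | H : is_true (~~ (_ || _)) |- _ => rewrite negb_or in H
  | H : is_true (~~ ~~ _) |- _ => rewrite negbK in H
  | H : is_true (?x == ?y) |- _ => move/eqP: H => H; try first [subst x | subst y]
  | H : ?x \in ?A = true |- _ => change (is_true (x \in A)) in H
  | H : is_true (?w \in ?Z), s : {subset ?Z <= ?K} |- _ =>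
      lazymatch goal with
      | _ : is_true (w \in K) |- _ => fail
      | _ => let H' := fresh "m" in have H' : w \in K := s _ H
      end
  end.
Ltac subset_by_mem := let w := fresh "w" in let H := fresh "H" in
  intros w H; rewrite ?inE in H; mem_split; mem_simpl.

(** * Simple paths and connected sets *)

Section Single.
Variable T : finType.
Implicit Types K L : {set T}.

Definition single K := forall x y, x \in K -> y \in K -> x = y.

Lemma single_set1 K x : single K -> x \in K -> K = [set x].
Proof.
move=> sK xK; apply/setP => y; rewrite inE.
by apply/idP/eqP => [yK|->//]; apply: sK.
Qed.

Lemma card_lt_notin K L w : {subset L <= K} -> w \in K -> w \notin L -> #|L| < #|K|.
Proof.
move=> LK wK wL; apply: proper_card; apply/properP.
by split; [apply/subsetP|exists w].
Qed.

Lemma card_set_ind (P : {set T} -> Prop) :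
  (forall K, (forall L, #|L| < #|K| -> P L) -> P K) -> forall K, P K.
Proof.
move=> step K; have [m] := ubnP #|K|; elim: m K => // m IH K Km.
by apply: step => L LK; apply: IH; apply: leq_trans LK _.
Qed.

End Single.

Section Paths.
Variables (T : finType) (e : rel T).
Implicit Types (K L M A Z : {set T}).

Definition upath K x y n : Prop :=
  exists p, [/\ path e x p, last x p = y, uniq (x :: p), size p = n
              & {subset x :: p <= K}].

Lemma upath0 K x : x \in K -> upath K x x 0.
Proof. by move=> xK; exists [::]; split=> // z; rewrite inE => /eqP->. Qed.

Lemma upath_sub K L x y n : upath K x y n -> {subset K <= L} -> upath L x y n.
Proof. by case=> p [? ? ? ? sK] sKL; exists p; split=> // z /sK /sKL. Qed.

Lemma upath_head K x y n : upath K x y n -> x \in K.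
Proof. by case=> p [_ _ _ _ sK]; apply: sK; rewrite mem_head. Qed.

Lemma upath_last K x y n : upath K x y n -> y \in K.
Proof. by case=> p [_ <- _ _ sK]; apply: sK; rewrite mem_last. Qed.

Lemma upath_eq0 K x y n : upath K x y n -> (n == 0) = (x == y).
Proof.
case=> [] [|z p] [_ /= <- U <- _]; first by rewrite !eqxx.
apply/esym/negbTE/eqP => xl; move: U; rewrite {1}xl.
by rewrite mem_last.
Qed.

Lemma upath_len0 K x y : upath K x y 0 -> x = y.
Proof. by move/upath_eq0/esym/eqP. Qed.

Lemma upath_cons K x y z n :
  e x y -> x \notin K -> upath K y z n -> upath (x |: K) x z n.+1.
Proof.
move=> exy xK [p [pp lp up sp sK]]; exists (y :: p); split=> //=.
- by rewrite exy.
- by rewrite -/(uniq (y :: p)) up andbT; apply: contra xK; apply: sK.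
- by rewrite sp.
by move=> w; rewrite inE in_setU1 => /orP[->//|/sK->]; rewrite orbT.
Qed.

Lemma upath_cat K L x y x' z n m :
  upath K x y n -> e y x' -> upath L x' z m ->
  (forall w, w \in K -> w \in L -> False) ->
  upath (K :|: L) x z (n + m).+1.
Proof.
case=> p [pp lp up sp sK] eyx [p' [pp' lp' up' sp' sL]] disKL.
exists (p ++ x' :: p'); split.
- by rewrite cat_path pp lp /= eyx.
- by rewrite last_cat.
- rewrite -cat_cons cat_uniq up up' andbT; apply/hasPn => w wL.
  by apply/negP => wK; apply: (disKL w); [apply: sK|apply: sL].
- by rewrite size_cat /= sp sp' addnS.
by move=> w; rewrite -cat_cons mem_cat !inE -!in_cons => /orP[/sK->|/sL->]; rewrite ?orbT.
Qed.

Lemma upath_behead K x y n : upath K x y n.+1 ->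
  exists x', [/\ e x x', x' \in K, x' != x & upath (K :\ x) x' y n].
Proof.
case=> [] [|x' p] [//= /andP[exx' pp] lp /andP[xp up] [sp] sK].
exists x'; split=> //.
- by apply: sK; rewrite !inE eqxx orbT.
- by apply: contraNneq xp => <-; rewrite mem_head.
exists p; split=> // w wp; rewrite in_setD1 sK; last by rewrite inE wp orbT.
by rewrite andbT; apply: contraNneq xp => <-.
Qed.

Lemma upath_join K L x y z n m :
  upath K x y n -> upath L y z m ->
  (forall w, w \in K -> w \in L -> w = y) ->
  upath (K :|: L) x z (n + m).
Proof.
move=> xy; case: m => [|m] yz disKL.
  rewrite -(upath_len0 yz) addn0.
  by apply: upath_sub xy _ => w; rewrite inE => ->.
case/upath_behead: yz => y' [eyy' _ _ y'z]; rewrite addnS.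
apply: upath_sub (upath_cat xy eyy' y'z _) _.
- by move=> w wK; rewrite in_setD1 => /andP[/eqP wy /(disKL _ wK)].
by move=> w; rewrite !inE => /orP[->//|/andP[_ ->]]; rewrite orbT.
Qed.

Lemma upath_first_hit A K y x n : upath K y x n -> x \in A ->
  exists a m, [/\ a \in A, a \in K & upath (a |: (K :\: A)) y a m].
Proof.
elim: n K y => [|n IH] K y P xA; case: (boolP (y \in A)) => yA.
- by exists y, 0; split; [|apply: upath_head P|apply: upath0; rewrite !inE eqxx].
- by rewrite (upath_len0 P) xA in yA.
- by exists y, 0; split; [|apply: upath_head P|apply: upath0; rewrite !inE eqxx].
have yK := upath_head P; case/upath_behead: P => y' [eyy' _ _ P].
case: (IH _ _ P xA) => a [m [aA aK Pa]]; exists a, m.+1; split=> //.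
  by move: aK; rewrite inE => /andP[].
apply: upath_sub (upath_cons eyy' _ Pa) _.
  by rewrite !inE eqxx /= andbF orbF; apply: contraNneq yA => ->.
move=> w; rewrite !inE => /or3P[/eqP->|->//|/and3P[-> _ ->]]; last by rewrite orbT.
by rewrite yA yK orbT.
Qed.

Lemma upath_cycle K x y n : upath K x y n -> e y x -> 1 < n ->
  exists s, [/\ uniq s, size s = n.+1 & cycle e s].
Proof.
case=> p [pp lp up sp _] eyx n1; exists (x :: p); split=> //=; first by rewrite sp.
by rewrite rcons_path pp lp.
Qed.

Definition connected K := forall x y, x \in K -> y \in K -> exists n, upath K x y n.

Definition component K x : {set T} :=
  locked [set y in K | connect [rel u v | [&& u \in K, v \in K & e u v]] x y].

Lemma component_sub K x y : y \in component K x -> y \in K.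
Proof. by rewrite /component -lock inE => /andP[]. Qed.

Lemma component_id K x : x \in K -> x \in component K x.
Proof. by move=> xK; rewrite /component -lock inE xK connect0. Qed.

Lemma component_closed K x y z :
  y \in component K x -> z \in K -> e y z -> z \in component K x.
Proof.
rewrite /component -lock !inE => /andP[yK xy] zK eyz; rewrite zK /=.
by apply: connect_trans xy (connect1 _); rewrite /= yK zK.
Qed.

Lemma componentD_sub K N x : {subset component (K :\: N) x <= K}.
Proof. by move=> w /component_sub; rewrite in_setD => /andP[]. Qed.

Lemma componentD_notin K N x w : w \in component (K :\: N) x -> w \notin N.
Proof. by move/component_sub; rewrite in_setD => /andP[]. Qed.

Lemma componentD1_notin K z x : z \notin component (K :\ z) x.
Proof. by apply/negP => /component_sub; rewrite !inE eqxx. Qed.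

Hypothesis eC : symmetric e.

Lemma upath_rev K x y n : upath K x y n -> upath K y x n.
Proof.
elim: n K x => [|n IH] K x P.
  by rewrite (upath_len0 P); apply: upath0; apply: upath_last P.
have xK := upath_head P; case/upath_behead: P => x' [exx' _ _ /IH P].
rewrite eC in exx'.
rewrite -(addn0 n); apply: upath_sub (upath_cat P exx' (@upath0 [set x] x _) _) _.
- by rewrite inE.
- by move=> w; rewrite !inE => /andP[/negP].
by move=> w; rewrite !inE => /orP[/andP[]//|/eqP->].
Qed.

Lemma upath_rcons K x y z n :
  upath K x y n -> e y z -> z \notin K -> upath (z |: K) x z n.+1.
Proof.
by move=> P eyz zK; apply: upath_rev; apply: upath_cons (upath_rev P) => //; rewrite eC.
Qed.

Lemma upath_last_exit A K x y n : upath K x y n -> x \in A ->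
  exists a m, [/\ a \in A, a \in K & upath (a |: (K :\: A)) a y m].
Proof.
move=> /upath_rev P /(upath_first_hit P)[a [m [aA aK Pa]]].
by exists a, m; split=> //; apply: upath_rev.
Qed.

Lemma upath_component L M x y k : upath L x y k -> {subset L <= M} -> y \in component M x.
Proof.
elim: k y L => [|k IH] y L P LM.
  by rewrite -(upath_len0 P); apply: component_id; apply: LM; apply: upath_head P.
have Py := upath_rev P; have yM := LM _ (upath_head Py).
case/upath_behead: Py => y' [yy' y'L _ Py].
have y'C : y' \in component M x.
  by apply: IH (upath_rev Py) _ => w; rewrite in_setD1 => /andP[_ /LM].
by apply: component_closed y'C yM _; rewrite eC.
Qed.

(* From the end that is not the exit, first run through [A]. *)
Lemma upath_both_ends A K n n' k a m y : {subset A <= K} -> upath A n n' k ->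
  a \in [set n; n'] -> upath (a |: (K :\: A)) a y m ->
  upath K n y m /\ upath K n' y (k + m) \/ upath K n' y m /\ upath K n y (k + m).
Proof.
move=> AK P aE R.
have extend b : upath A b a k -> upath K a y m /\ upath K b y (k + m).
  move=> Pb; have aK := AK _ (upath_last Pb).
  split; first by apply: upath_sub R _; subset_by_mem.
  apply: upath_sub (upath_join Pb R _) _; last by subset_by_mem.
  by move=> w wA; rewrite !inE wA /= orbF => /eqP.
move: aE; rewrite in_set2 => /orP[]/eqP E; subst a; last by right; apply: extend.
by left; apply: extend (upath_rev P).
Qed.

Lemma component_sym K x y : x \in K -> y \in component K x -> x \in component K y.
Proof.
rewrite /component -!lock !inE => xK /andP[_]; rewrite xK sym_connect_sym //.
by move=> u v /=; rewrite eC; case: (u \in K); case: (v \in K).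
Qed.

Lemma component_connected K x : connected (component K x).
Proof.
set r := [rel u v | [&& u \in K, v \in K & e u v]].
have rs : connect_sym r.
  by apply: sym_connect_sym => u v /=; rewrite eC; case: (u \in K); case: (v \in K).
move=> y z yK zK.
have: connect r y z.
  move: yK zK; rewrite /component -lock !inE -/r => /andP[_ xy] /andP[_ xz].
  by apply: connect_trans xz; rewrite rs.
case/connectP => p0 pp0 lz; case: (shortenP pp0) lz => p pp up _ lz.
exists (size p), p; split=> //.
- by apply: sub_path pp => u v /= /and3P[].
elim: p y yK pp {up lz pp0} => [|u p IH] y yK /=.
  by move=> _ w; rewrite inE => /eqP->.
case/andP=> /and3P[_ uK eyu] pp w; rewrite inE => /orP[/eqP->//|].
by apply: IH pp w; apply: component_closed yK uK eyu.
Qed.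

Lemma connected_exit K A a0 y : connected K -> a0 \in A -> a0 \in K -> y \in K ->
  exists a m, [/\ a \in A, a \in K & upath (a |: (K :\: A)) a y m].
Proof. by move=> cK aA aK yK; case: (cK _ _ aK yK) => n P; apply: upath_last_exit P aA. Qed.

Lemma connected_exit_via K A (P : {set T}) a0 y : connected K -> a0 \in A -> a0 \in K -> y \in K ->
  (forall a, a \in A -> a \in K -> a \notin P ->
     a != y /\ forall w, w \in K -> e a w -> w \in A) ->
  exists a m, [/\ a \in P, a \in A & upath (a |: (K :\: A)) a y m].
Proof.
move=> cK aA aK yK onlyP; case: (connected_exit cK aA aK yK) => a [m [{}aA {}aK R]].
exists a, m; split=> //; apply: contraT => aP; case: (onlyP a aA aK aP) => ay closedA.
case: m R => [|m] R; first by rewrite (upath_len0 R) eqxx in ay.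
case/upath_behead: R => b [ab]; rewrite in_setU1 in_setD.
by case/orP => [->//|/andP[bA bK]]; rewrite closedA in bA.
Qed.

Lemma connected_closed K Z z : connected K -> z \in Z -> {subset Z <= K} ->
  (forall y w, y \in Z -> w \in K -> e y w -> w \in Z) -> Z = K.
Proof.
move=> cK zZ ZK clZ; apply/setP => w; apply/idP/idP => [/ZK//|wK].
case: (connected_exit cK zZ (ZK _ zZ) wK) => a [[|m] [aZ _ Pa]].
  by rewrite -(upath_len0 Pa).
case/upath_behead: Pa => b [eab]; rewrite !inE.
case/orP => [/eqP->|/andP[bZ bK] _ _]; first by rewrite eqxx.
by rewrite (clZ _ _ aZ bK eab) in bZ.
Qed.

Lemma connected_independent_single K :
  connected K -> (forall x y, x \in K -> y \in K -> e x y -> False) -> single K.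
Proof.
move=> cK indK x y xK yK; apply/esym/set1P.
rewrite (connected_closed (z := x) (Z := [set x]) cK) ?inE //.
  by move=> w /set1P->.
by move=> u w /set1P-> wK /(indK _ _ xK wK).
Qed.

Lemma component_eq_closed K x Z : x \in Z -> {subset Z <= K} ->
  (forall y w, y \in Z -> w \in K -> e y w -> w \in Z) ->
  {subset component K x <= Z}.
Proof.
move=> xZ ZK clZ; suff <- : Z :&: component K x = component K x.
  by move=> w; rewrite inE => /andP[].
apply: (connected_closed (z := x) (component_connected (x := x))).
- by rewrite inE xZ component_id // ZK.
- by move=> w; rewrite inE => /andP[].
by move=> y w; rewrite !inE => /andP[yZ _] wC yw; rewrite wC (clZ y) //; apply: component_sub wC.
Qed.

Lemma upath_around K s u v : connected K -> s \in K -> v \in K ->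
  v \notin component (K :\ s) u -> exists m, upath (K :\: component (K :\ s) u) s v m.
Proof.
set Z := component _ _ => cK sK vK vZ; have sZ : s \notin Z := componentD1_notin _ _ _.
case: (@connected_exit K (s |: Z) s v) => // [|a [m []]]; first by rewrite !inE eqxx.
rewrite in_setU1 => /orP[/eqP->|aZ] aK P.
  exists m; apply: upath_sub P _ => w; rewrite !inE negb_or => /orP[/eqP->|/andP[/andP[_ ->] ->//]].
  by rewrite sK sZ.
case: m P => [|m] P; first by rewrite -(upath_len0 P) aZ in vZ.
case/upath_behead: P => b [eab]; rewrite in_setU1 => /orP[->//|].
rewrite !inE negb_or => /andP[/andP[bs bZ] bK] _ _.
by case/negP: bZ; apply: component_closed aZ _ eab; rewrite !inE bs.
Qed.

Hypothesis eI : irreflexive e.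

Lemma edge_neq x y : e x y -> x != y.
Proof. by apply: contraTneq => ->; rewrite eI. Qed.

Lemma upath1 K a b : e a b -> a \in K -> b \in K -> upath K a b 1.
Proof.
move=> ab aK bK; exists [:: b]; split=> //=; first by rewrite ab.
  by rewrite inE (edge_neq ab).
by move=> w; rewrite !inE => /orP[]/eqP->.
Qed.

Lemma upath2 a b c : e a b -> e b c -> a != c -> upath [set a; b; c] a c 2.
Proof.
move=> ab bc ac; exists [:: b; c]; split=> //=; first by rewrite ab bc.
  by rewrite !inE negb_or ac (edge_neq ab) (edge_neq bc).
by move=> w; rewrite !inE orbA.
Qed.

Lemma upath4 a b c d f : e a b -> e b c -> e c d -> e d f ->
  uniq [:: a; b; c; d; f] -> upath [set x in [:: a; b; c; d; f]] a f 4.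
Proof.
move=> ab bc cd df U; exists [:: b; c; d; f]; split=> //=; first by rewrite ab bc cd df.
by move=> w; rewrite inE.
Qed.

End Paths.

Section Degrees.
Variables (T : finType) (e : rel T).
Implicit Types (K L A X : {set T}).

Definition deg x := #|[set y | e x y]|.
Definition adj X u := [exists x in X, e u x].

Lemma adjP X u : reflect (exists2 x, x \in X & e u x) (adj X u).
Proof.
by apply: (iffP existsP) => [[x /andP[]]|[x xX eux]]; exists x => //; rewrite xX.
Qed.

Lemma adj1 x u : adj [set x] u = e u x.
Proof. by apply/adjP/idP => [[y /set1P->]|ux] //; exists x; rewrite ?inE. Qed.

Lemma adjS X X' u : {subset X <= X'} -> adj X u -> adj X' u.
Proof. by move=> XX' /adjP[x /XX' xX' ux]; apply/adjP; exists x. Qed.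

Lemma deg_le x A : (forall y, e x y -> y \in A) -> deg x <= #|A|.
Proof. by move=> xA; apply/subset_leq_card/subsetP => y; rewrite inE; apply: xA. Qed.

Lemma cards3_le (a b c : T) : #|[set a; b; c]| <= 3.
Proof. by rewrite -setUA cardsU1 cards2; case: (_ \notin _); case: (_ != _). Qed.

Lemma deg2_adj u a b c : deg u = 2 -> e u a -> e u b -> a != b -> e u c ->
  c = a \/ c = b.
Proof.
move=> d2 ua ub ab uc.
suff: c \in [set a; b] by rewrite !inE => /orP[]/eqP; [left|right].
suff -> : [set a; b] = [set y | e u y] by rewrite inE.
apply/eqP; rewrite eqEcard -/(deg u) d2 cards2 ab andbT.
by apply/subsetP => w; rewrite !inE => /orP[]/eqP->.
Qed.

Lemma deg_eq2 u a b : e u a -> e u b -> a != b ->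
  (forall c, e u c -> c = a \/ c = b) -> deg u = 2.
Proof.
move=> ua ub ab only_ab; rewrite /deg.
suff -> : [set y | e u y] = [set a; b] by rewrite cards2 ab.
apply/setP => w; rewrite !inE; apply/idP/idP; first by case/only_ab => ->; rewrite eqxx ?orbT.
by case/orP => /eqP->.
Qed.

Lemma deg_gt1_neq u a : 1 < deg u -> exists2 b, e u b & b != a.
Proof.
case/card_gt1P => x [y]; rewrite !inE => -[ux uy xy].
by case: (eqVneq x a) => [xa|]; [exists y; rewrite // -xa eq_sym|exists x].
Qed.

Lemma deg_gt2_neq u a b : 2 < deg u -> exists c, [/\ e u c, c != a & c != b].
Proof.
move=> d3; suff /card_gt0P[c] : 0 < #|[set y | e u y] :\: [set a; b]|.
  by rewrite !inE negb_or => /andP[/andP[ca cb] uc]; exists c.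
rewrite cardsD subn_gt0; apply: leq_ltn_trans (subset_leq_card (subsetIr _ _)) _.
by apply: leq_ltn_trans d3; rewrite cards2; case: (_ != _).
Qed.

Definition unique_nb K X := forall u x x',
  u \in K -> x \in X -> x' \in X -> e u x -> e u x' -> x = x'.

(* No path [x - u - s - u' - x'] with inner vertices in [K] and [deg u = deg u' = 2]
   joins two vertices of [X]. *)
Definition hubfree K X := forall u u' s x x',
  u \in K -> u' \in K -> s \in K -> u != u' -> deg u = 2 -> deg u' = 2 ->
  e u s -> e u' s -> x \in X -> x' \in X -> e u x -> e u' x' -> x != x' -> False.

Record tame K X : Prop := Tame { tame_unique : unique_nb K X; tame_hubfree : hubfree K X }.

Lemma hubfree_sub K L X X' :
  {subset L <= K} -> {subset X' <= X} -> hubfree K X -> hubfree L X'.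
Proof.
move=> LK XX' h u u' s x x' /LK uK /LK u'K /LK sK uu' du du' us u's /XX' xX /XX' x'X.
exact: (h u u' s x x').
Qed.

Lemma tame_sub K L X X' :
  {subset L <= K} -> {subset X' <= X} -> tame K X -> tame L X'.
Proof.
move=> LK XX' [oX hX]; split; last exact: hubfree_sub hX.
by move=> u x x' /LK uK /XX' xX /XX' x'X; apply: oX.
Qed.

Lemma tame1 K s : tame K [set s].
Proof.
split; first by move=> u x x' _ /set1P-> /set1P->.
by move=> u u' t x x' _ _ _ _ _ _ _ _ /set1P-> /set1P-> _ _; rewrite eqxx.
Qed.

Definition mod3_const K X Y := forall u v n u' v' n',
  adj X u -> adj Y v -> upath e K u v n ->
  adj X u' -> adj Y v' -> upath e K u' v' n' -> n = n' %[mod 3].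

Lemma mod3_constI K X Y r :
  (forall u v n, adj X u -> adj Y v -> upath e K u v n -> n %% 3 = r) -> mod3_const K X Y.
Proof. by move=> rK u v n u' v' n' uX vY P u'X v'Y P'; rewrite (rK u v n) // (rK u' v' n'). Qed.

Definition cycle1_free := forall s, uniq s -> 2 < size s -> cycle e s -> size s %% 3 <> 1.

Hypothesis freeC : cycle1_free.

Lemma upath_cycle1_free K x y n : upath e K x y n -> e y x -> 1 < n -> n.+1 %% 3 <> 1.
Proof.
move=> P yx n1; case: (upath_cycle P yx n1) => s [us ss cs].
by rewrite -ss; apply: freeC => //; rewrite ss.
Qed.

Hypothesis eI : irreflexive e.

Lemma cycle4_free a b c d : e a b -> e b c -> e c d -> e d a -> a != c -> b != d -> False.
Proof.
move=> ab bc cd da ac bd; apply: (@freeC [:: a; b; c; d]) => //=; last by rewrite ab bc cd da.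
rewrite !inE !negb_or ac bd (edge_neq eI ab) (edge_neq eI bc) (edge_neq eI cd) /=.
by rewrite eq_sym (edge_neq eI da).
Qed.

Lemma uniq_hub (P : pred T) n u m u' n' : P n -> P n' -> ~~ P u -> ~~ P m -> ~~ P u' ->
  n != n' -> u != u' -> e u m -> e u' m -> uniq [:: n; u; m; u'; n'].
Proof.
move=> Pn Pn' Pu Pm Pu' nn' uu' um u'm.
have neq a b : P a -> ~~ P b -> a != b by move=> Pa; apply: contraNneq => <-.
have n_u := neq _ _ Pn Pu; have n_m := neq _ _ Pn Pm; have n_u' := neq _ _ Pn Pu'.
have n'_u := neq _ _ Pn' Pu; have n'_m := neq _ _ Pn' Pm; have n'_u' := neq _ _ Pn' Pu'.
have u_m := edge_neq eI um; have u'_m := edge_neq eI u'm.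
by rewrite /= !inE; neq_simpl.
Qed.

End Degrees.

(* Twice the bound of the theorem up to rounding: 30 q + 3 r at m = 9 q + r. *)
Definition degree_bound m := 3 * m + 3 * (m %/ 9).

Record critical (T : finType) (e : rel T) (S : {set T}) : Prop := Critical {
  crit_sym : symmetric e;
  crit_irr : irreflexive e;
  crit_supp : forall x y, e x y -> x \in S;
  crit_free : cycle1_free e;
  crit_deg_gt1 : forall x, x \in S -> 1 < deg e x;
  crit_deg2_nonadj : forall x y, e x y -> deg e x = 2 -> deg e y = 2 -> False;
  crit_no_cut : forall (K : {set T}) z u, u \in K -> {subset K <= S} -> z \notin K ->
    (forall u v, u \in K -> e u v -> v \notin K -> v = z) -> {subset S <= z |: K};
  crit_no_claw : forall z, deg e z = 3 -> (forall u, e z u -> deg e u = 2) -> False;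
  crit_fold : forall v a b z, deg e v = 2 -> e v a -> e v b -> a != b -> deg e a = 3 ->
    e a z -> z != v -> z != b -> exists y, [/\ e b y, e z y, y != v & y != a];
  crit_dense : degree_bound (#|S| - 1) < \sum_(x in S) deg e x }.

(** * Branches *)

Section Branches.
Variables (T : finType) (e : rel T) (S : {set T}).
Hypothesis crit : critical e S.
Implicit Types (K L M A Z X Y N Q : {set T}).
Local Notation upath := (upath e).
Local Notation connected := (connected e).
Local Notation component := (component e).
Local Notation adj := (adj e).
Local Notation deg := (deg e).
Local Notation tame := (tame e).
Let eC : symmetric e := crit_sym crit.
Let eI : irreflexive e := crit_irr crit.

Record branch K X Y : Prop := Branch {
  branch_connected : connected K;
  branch_sub : {subset K <= S};
  branch_disjX : forall w, w \in K -> w \in X -> False;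
  branch_disjY : forall w, w \in K -> w \in Y -> False;
  branch_closed : forall u w, u \in K -> e u w -> w \notin K -> w \in X \/ w \in Y;
  branch_adjX : exists2 u, u \in K & adj X u;
  branch_adjY : exists2 u, u \in K & adj Y u;
  branch_const : mod3_const e K X Y }.

Lemma branch_sym K X Y : branch K X Y -> branch K Y X.
Proof.
case=> cK KS dX dY cl aX aY cst; split=> //.
  by move=> u w uK uw wK; case: (cl u w uK uw wK); [right|left].
move=> u v k u' v' k' uY vX P u'Y v'X P'.
exact: cst vX uY (upath_rev eC P) v'X u'Y (upath_rev eC P').
Qed.

Lemma const_path_ends K X Y A n n' k a m v :
  mod3_const e K X Y -> {subset A <= K} -> upath A n n' k -> adj X n -> adj X n' ->
  adj Y v -> a \in [set n; n'] -> upath (a |: (K :\: A)) a v m -> k %% 3 = 0.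
Proof.
move=> cst AK P nX n'X vY aE R.
case: (upath_both_ends eC AK P aE R) => -[R1 R2].
  by have := cst _ _ _ _ _ _ nX vY R1 n'X vY R2; clear; lia.
by have := cst _ _ _ _ _ _ n'X vY R1 nX vY R2; clear; lia.
Qed.

Lemma branch_independent K X Y u1 u2 : branch K X Y ->
  u1 \in K -> u2 \in K -> adj X u1 -> adj X u2 -> e u1 u2 -> False.
Proof.
move=> B u1K u2K u1X u2X u12; case: (branch_adjY B) => v vK vY.
case: (connected_exit (A := [set u1; u2]) eC (branch_connected B) _ u1K vK).
  by rewrite !inE eqxx.
have u1A : u1 \in [set u1; u2] by rewrite !inE eqxx.
have u2A : u2 \in [set u1; u2] by rewrite !inE eqxx orbT.
move=> a [m [aA _ P]].
have := const_path_ends (branch_const B) _ (upath1 eI u12 u1A u2A) u1X u2X vY aA P.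
by move/(_ ltac:(by subset_by_mem)).
Qed.

(* Otherwise the paths from [n] and from [n'] to [v] have lengths that differ by [k]. *)
Lemma arm_length K X Y A n n' s k v : branch K X Y -> {subset A <= K} ->
  upath A n n' k -> adj X n -> adj X n' -> n != s ->
  (forall a w, a \in A -> a \notin [set n; n'; s] -> e a w -> w \in A) ->
  v \in component (K :\ s) n -> adj Y v -> k %% 3 = 0.
Proof.
move=> B AK P nX n'X ns inner_closed vZ vY; set Z := component _ _ in vZ.
have ZK : {subset Z <= K} by apply: componentD_sub.
have nA := upath_head P.
have nZ : n \in Z by apply: component_id; rewrite !inE ns AK.
case: (connected_exit_via (P := [set n; n']) eC (component_connected eC (x := n)) nA nZ vZ).
  move=> a aA aZ an; have as_ : a != s by apply: contraTneq aZ => ->; apply: componentD1_notin.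
  have {}inner_closed w : e a w -> w \in A.
    by apply: inner_closed aA _; rewrite in_setU in_set1 negb_or an as_.
  split=> [|w _ /inner_closed //]; apply: contraTneq vY => <-; apply/adjP => -[y yY].
  by move/inner_closed/AK => yK; apply: (branch_disjY B yK).
move=> a [m [aE _ R]].
apply: const_path_ends (branch_const B) AK P nX n'X vY aE (upath_sub R _).
by move=> w; rewrite !inE => /orP[->//|/andP[-> /ZK->]]; rewrite orbT.
Qed.

Lemma component_branch K X Y s u : branch K X Y -> s \in K -> u \in K ->
  (forall v, v \in component (K :\ s) u -> ~~ adj Y v) ->
  (exists2 v, v \in component (K :\ s) u & adj X v) ->
  (exists2 v, v \in component (K :\ s) u & e v s) ->
  branch (component (K :\ s) u) X [set s].
Proof.
move=> B sK uK dead attX [v vZ vs]; set Z := component _ _ in dead attX vZ *.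
have ZK : {subset Z <= K} by apply: componentD_sub.
have sZ : s \notin Z by apply: componentD1_notin.
split=> //.
- exact: component_connected.
- by move=> w /ZK /(branch_sub B).
- by move=> w /ZK /(branch_disjX B).
- by move=> w wZ /set1P ws; rewrite -ws wZ in sZ.
- move=> a w aZ aw wZ; case: (eqVneq w s) => [->|ws]; first by right; rewrite inE.
  case: (boolP (w \in K)) => wK.
    by case/negP: wZ; apply: component_closed aZ _ aw; rewrite !inE ws.
  case: (branch_closed B (ZK _ aZ) aw wK) => [|wY]; first by left.
  by case/negP: (dead a aZ); apply/adjP; exists w.
- by exists v; rewrite // adj1.
case: (branch_adjY B) => v0 v0K v0Y.
have v0Z : v0 \notin Z by apply: contraL v0Y => /dead.
case: (upath_around eC (branch_connected B) sK v0K v0Z) => k Pk.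
have extend a b i : adj [set s] b -> upath Z a b i -> upath K a v0 (i + k).+1.
  rewrite adj1 => bs P.
  by apply: upath_sub (upath_cat P bs Pk _) _; [move=> w wZ; mem_simpl|subset_by_mem].
move=> a b i a' b' i' aX bs P a'X b's P'.
have := branch_const B aX v0Y (extend _ _ _ bs P) a'X v0Y (extend _ _ _ b's P'); clear; lia.
Qed.

Lemma arm_branch K X Y A n n' s k u : branch K X Y -> {subset A <= K} ->
  upath A n n' k -> k %% 3 <> 0 -> adj X n -> adj X n' -> s \in A -> n != s ->
  (forall a w, a \in A -> a \notin [set n; n'; s] -> e a w -> w \in A) ->
  u \in component (K :\ s) n -> e u s ->
  branch (component (K :\ s) n) X [set s] /\
  (forall v, v \in component (K :\ s) n -> ~~ adj Y v).
Proof.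
move=> B AK P k0 nX n'X sA ns inner_closed uZ us.
have dead v : v \in component (K :\ s) n -> ~~ adj Y v.
  by move=> vZ; apply/negP => vY; apply: k0; apply: arm_length B AK P nX n'X ns inner_closed vZ vY.
split=> //; have nK := AK _ (upath_head P).
apply: (component_branch B (AK _ sA) nK dead) => //; last by exists u.
by exists n => //; apply: component_id; rewrite !inE ns.
Qed.

Lemma hub_arm_branch K X Y n u s u' n' : branch K X Y ->
  {subset [:: n; u; s; u'; n'] <= K} -> uniq [:: n; u; s; u'; n'] ->
  adj X n -> adj X n' -> deg u = 2 -> deg u' = 2 ->
  e n u -> e u s -> e s u' -> e u' n' ->
  [/\ u \in component (K :\ s) n, branch (component (K :\ s) n) X [set s]
    & forall v, v \in component (K :\ s) n -> ~~ adj Y v].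
Proof.
move=> B AK U nX n'X du du' nu us su' u'n'.
have un : e u n by rewrite eC.
have u's : e u' s by rewrite eC.
move: (U); rewrite /= !inE !negb_or.
move=> /and5P[/and4P[n_u n_s n_u' n_n'] /and3P[u_s u_u' u_n'] /andP[s_u' s_n'] u'_n' _].
have nK : n \in K by apply: AK; rewrite inE eqxx.
have uK : u \in K by apply: AK; rewrite !inE eqxx orbT.
have uZ : u \in component (K :\ s) n.
  by apply: component_closed nu; [apply: component_id|]; rewrite !inE ?n_s ?u_s.
case: (arm_branch B _ (upath4 nu us su' u'n' U) _ nX n'X _ n_s _ uZ us) => //.
- by move=> w; rewrite inE; apply: AK.
- by rewrite !inE eqxx ?orbT.
move=> a w; rewrite !inE !negb_or => aA /andP[/andP[an an'] as_] aw; move: aA.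
rewrite (negbTE an) (negbTE an') (negbTE as_) /= orbF => /orP[]/eqP E; subst a.
  by case: (deg2_adj du un us n_s aw) => ->; rewrite eqxx ?orbT.
by case: (deg2_adj du' u's u'n' s_n' aw) => ->; rewrite eqxx ?orbT.
Qed.

Definition contact K X : {set T} := locked [set u in K | adj X u].

Lemma contactE K X w : (w \in contact K X) = (w \in K) && adj X w.
Proof. by rewrite /contact -lock inE. Qed.

Lemma contact_sub K X : {subset contact K X <= K}.
Proof. by move=> w; rewrite contactE => /andP[]. Qed.

Lemma contact_adj K X w : w \in contact K X -> adj X w.
Proof. by rewrite contactE => /andP[]. Qed.

Lemma contact_hubfree K X :
  (forall n u m u' n', {subset [:: n; u; m; u'; n'] <= K} -> uniq [:: n; u; m; u'; n'] ->
     adj X n -> adj X n' -> ~~ adj X u -> ~~ adj X u' -> deg u = 2 -> deg u' = 2 ->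
     e n u -> e u m -> e m u' -> e u' n' -> False) ->
  hubfree e (K :\: contact K X) (contact K X).
Proof.
move=> no_hub u u' m n n'; rewrite !in_setD !contactE.
move=> /andP[uX uK] /andP[u'X u'K] /andP[mX mK]; rewrite uK /= in uX; rewrite u'K /= in u'X.
rewrite mK /= in mX => uu' du du' um u'm /andP[nK nX] /andP[n'K n'X] un u'n' nn'.
apply: (no_hub n u m u' n') => //; last 2 first.
- by rewrite eC.
- by rewrite eC.
- by subset_by_mem.
exact: (uniq_hub eI (P := adj X)).
Qed.

Section Layer.
Variables (K N : {set T}) (q : T).
Hypotheses (NK : {subset N <= K}) (tameN : tame (K :\: N) N) (KS : {subset K <= S}).
Hypotheses (qK : q \in K) (qN : q \notin N).
Local Notation Q := (component (K :\: N) q).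
Hypothesis Q_single : forall X Y, branch Q X Y -> tame Q X -> tame Q Y -> single Q.

Let qQ : q \in Q.
Proof. by apply: component_id; rewrite in_setD qN. Qed.

Let QK : {subset Q <= K}.
Proof. exact: componentD_sub. Qed.

Let QN w : w \in Q -> w \notin N.
Proof. exact: componentD_notin. Qed.

Let NQ w : w \in N -> w \notin Q.
Proof. by move=> wN; apply/negP => /QN; rewrite wN. Qed.

Let tameQ (P : {set T}) : {subset P <= N} -> tame Q P.
Proof. by move=> PN; apply: tame_sub PN tameN; apply: component_sub. Qed.

Lemma layer_split (P1 P2 : {set T}) n1 n2 : {subset P1 <= N} -> {subset P2 <= N} ->
  (forall a w, a \in Q -> e a w -> w \notin Q -> w \in P1 \/ w \in P2) ->
  n1 \in P1 -> n2 \in P2 -> adj Q n1 -> adj Q n2 -> n1 != n2 ->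
  mod3_const e Q P1 P2 -> False.
Proof.
move=> P1N P2N clQ n1P n2P /adjP[a1 a1Q n1a] /adjP[a2 a2Q n2a] n12 cst.
rewrite eC in n1a; rewrite eC in n2a.
have singleQ : single Q.
  apply: (Q_single (X := P1) (Y := P2)); [|exact: tameQ|exact: tameQ].
  split=> //.
  - exact: component_connected.
  - by move=> w /QK /KS.
  - by move=> w /QN /negP wN /P1N.
  - by move=> w /QN /negP wN /P2N.
  - by exists a1 => //; apply/adjP; exists n1.
  by exists a2 => //; apply/adjP; exists n2.
case/eqP: n12; rewrite (singleQ _ _ a2Q a1Q) in n2a.
exact: tame_unique (component_sub a1Q) (P1N _ n1P) (P2N _ n2P) n1a n2a.
Qed.

Lemma upath_through_layer n n' a b k : n \in N -> n' \in N -> n != n' ->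
  e a n -> e b n' -> upath Q a b k -> upath (n |: (n' |: Q)) n n' k.+2.
Proof.
move=> nN n'N nn' an bn' P; rewrite eC in an.
by apply: upath_cons an _ (upath_rcons eC P bn' (NQ n'N)); rewrite !inE negb_or nn' NQ.
Qed.

Hypothesis clQ : forall a w, a \in Q -> e a w -> w \notin Q -> w \in N.

Let contactQ a w : a \in Q -> e a w -> w \notin Q -> w \in contact N Q.
Proof.
by move=> aQ aw wQ; rewrite contactE (clQ aQ aw wQ); apply/adjP; exists a; rewrite // eC.
Qed.

Lemma layer_exit v : connected K -> v \in K -> v \notin Q ->
  exists n k, n \in contact N Q /\ upath (n |: (K :\: (Q :|: contact N Q))) n v k.
Proof.
move=> cK vK vQ.
case: (connected_exit (A := Q :|: contact N Q) eC cK _ qK vK).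
  by rewrite in_setU qQ.
move=> n [k [nA nK P]]; exists n, k; split=> //.
move: nA; rewrite in_setU => /orP[nQ|//]; case: k P => [|k] P.
  by rewrite -(upath_len0 P) nQ in vQ.
case/upath_behead: P => b [nb]; rewrite in_setU1 in_setD in_setU negb_or.
case/orP => [/eqP->|/andP[/andP[bQ bC] bK]]; first by rewrite eqxx.
by rewrite (contactQ nQ nb bQ) in bC.
Qed.

Lemma layer_two_contacts n x : x \in S -> x \notin K -> n \in contact N Q ->
  exists2 n', n' \in contact N Q & n' != n.
Proof.
move=> xS xK nC; apply/exists_inP; apply: contraT => no.
have nN := contact_sub nC.
have: x \in n |: Q.
  apply: (crit_no_cut crit qQ _ (NQ nN)) xS => [w /QK/KS//|a w aQ aw wQ].
  by apply/eqP; apply: contraNT no => wn; apply/exists_inP; exists w => //; apply: contactQ aw wQ.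
rewrite in_setU1 => /orP[/eqP E|/QK]; last by rewrite (negbTE xK).
by rewrite E NK in xK.
Qed.

Lemma dead_layer_contra X Y : branch K X Y -> (forall n, n \in contact N Q -> adj X n) ->
  (forall w, w \in Q -> ~~ adj Y w) -> False.
Proof.
move=> B attX dead; case: (branch_adjY B) => v vK vY.
have vQ : v \notin Q by apply: contraL vY => /dead.
case: (layer_exit (branch_connected B) vK vQ) => n1 [k0 [n1C P0]].
have [n2 n2C n21] : exists2 n2, n2 \in contact N Q & n2 != n1.
  case: (branch_adjX B) => u _ /adjP[x xX ux]; rewrite eC in ux.
  apply: layer_two_contacts (crit_supp crit ux) _ n1C.
  by apply/negP => /(branch_disjX B); apply.
have n1N := contact_sub n1C.
apply: (@layer_split (contact N Q :\ n1) [set n1] n2 n1) => //.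
- by move=> w; rewrite in_setD1 => /andP[_ /contact_sub].
- by move=> w /set1P->.
- move=> a w aQ aw wQ; rewrite in_setD1 in_set1 (contactQ aQ aw wQ) andbT.
  by case: eqP; [right|left].
- by rewrite in_setD1 n21.
- by rewrite inE.
- exact: contact_adj n2C.
- exact: contact_adj n1C.
have extend a b k : adj (contact N Q :\ n1) a -> adj [set n1] b -> upath Q a b k ->
    exists2 n, adj X n & upath K n v (k.+2 + k0).
  case/adjP => n; rewrite in_setD1 => /andP[nn1 nC] an; rewrite adj1 => bn1 P.
  have nN := contact_sub nC; exists n; first exact: attX.
  apply: upath_sub (upath_join (upath_through_layer nN n1N nn1 an bn1 P) P0 _) _.
    move=> w; rewrite !in_setU1 in_setD in_setU => wA /orP[/eqP//|/andP[wQC _]]; move: wA wQC.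
    by case/or3P => [/eqP->|/eqP->|->//]; rewrite ?nC ?n1C orbT.
  by move=> w; rewrite in_setU !in_setU1 in_setD => wA; mem_split; mem_simpl.
move=> a b k a' b' k' aP bP P a'P b'P P'.
case: (extend _ _ _ aP bP P) => n nX R; case: (extend _ _ _ a'P b'P P') => n' n'X R'.
have := branch_const B nX vY R n'X vY R'; clear; lia.
Qed.

End Layer.

Section FirstLayer.
Variables (K X Y : {set T}).
Hypothesis B : branch K X Y.
Local Notation N := (contact K X).
Hypotheses (tameN : tame (K :\: N) N) (tameY : tame K Y).
Hypothesis IH : forall Q, #|Q| < #|K| -> forall X' Y', branch Q X' Y' ->
  tame Q X' -> tame Q Y' -> single Q.
Variable q : T.
Hypotheses (qK : q \in K) (qN : q \notin N).
Local Notation Q := (component (K :\: N) q).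

Let qQ : q \in Q.
Proof. by apply: component_id; rewrite in_setD qN. Qed.

Let QK : {subset Q <= K}.
Proof. exact: componentD_sub. Qed.

Let NQ w : w \in N -> w \notin Q.
Proof. by move=> wN; apply/negP => /componentD_notin; rewrite wN. Qed.

Let Q_single X' Y' : branch Q X' Y' -> tame Q X' -> tame Q Y' -> single Q.
Proof.
case: (branch_adjX B) => n nK nX; apply: IH; apply: (card_lt_notin QK nK).
by apply: NQ; rewrite contactE nK.
Qed.

Let Q_closed a w : a \in Q -> e a w -> w \notin Q -> w \in N \/ w \in Y.
Proof.
move=> aQ aw wQ; case: (boolP (w \in K)) => wK.
  left; apply: contraR wQ => wN; apply: component_closed aQ _ aw.
  by rewrite in_setD wN.
case: (branch_closed B (QK aQ) aw wK) => [wX|]; last by right.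
by case/negP: (componentD_notin aQ); rewrite contactE (QK aQ); apply/adjP; exists w.
Qed.

Lemma layer_branch v : v \in Q -> adj Y v -> branch Q N Y.
Proof.
move=> vQ vY; split.
- exact: component_connected.
- by move=> w /QK /(branch_sub B).
- by move=> w wQ wN; move: wQ; apply/negP/NQ.
- by move=> w /QK /(branch_disjY B).
- exact: Q_closed.
- case: (branch_adjX B) => n0 n0K n0X.
  have n0Q : n0 \notin Q by apply: NQ; rewrite contactE n0K.
  case: (connected_exit eC (branch_connected B) qQ qK n0K) => a [[|k] [aQ _ P]].
    by rewrite (upath_len0 P) (negbTE n0Q) in aQ.
  case/upath_behead: P => b [ab]; rewrite in_setU1 in_setD => bA b_a _.
  rewrite (negbTE b_a) /= in bA; case/andP: bA => bQ bK.
  exists a => //; apply/adjP; exists b => //.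
  by case: (Q_closed aQ ab bQ) => // /(branch_disjY B bK).
- by exists v.
have extend a b i : adj N a -> upath Q a b i -> exists2 n, adj X n & upath K n b i.+1.
  case/adjP => n nN an P; exists n; first exact: contact_adj nN.
  have nK := contact_sub nN; rewrite eC in an.
  by apply: upath_sub (upath_cons an (NQ nN) P) _; subset_by_mem.
move=> a b i a' b' i' aN bY P a'N b'Y P'.
case: (extend _ _ _ aN P) => n nX R; case: (extend _ _ _ a'N P') => n' n'X R'.
have := branch_const B nX bY R n'X b'Y R'; clear; lia.
Qed.

Lemma layer_component_single : single Q /\ adj Y q.
Proof.
case: (boolP [exists v in Q, adj Y v]) => [/existsP[v /andP[vQ vY]]|dead].
  have singleQ : single Q.
    apply: Q_single (layer_branch vQ vY) _ _; last exact: tame_sub tameY.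
    by apply: tame_sub tameN; [apply: component_sub|].
  by split=> //; rewrite (singleQ q v).
have {}dead w : w \in Q -> ~~ adj Y w.
  by move=> wQ; apply: contra dead => wY; apply/existsP; exists w; rewrite wQ.
exfalso; apply: (dead_layer_contra _ tameN _ qK qN Q_single _ B _ dead).
- exact: contact_sub.
- exact: branch_sub B.
- move=> a w aQ aw wQ; case: (Q_closed aQ aw wQ) => // wY.
  by case/negP: (dead a aQ); apply/adjP; exists w.
by move=> n /contact_sub /contact_adj.
Qed.

Lemma second_layer_vertex :
  exists n y, [/\ n \in N, y \in Y, e q n, e q y & deg q = 2].
Proof.
case: layer_component_single => singleQ /adjP[y yY qy].
have nbq c : e q c -> c \in N \/ c \in Y.
  move=> qc; apply: (Q_closed qQ qc); apply/negP => /(singleQ _ _ qQ) E.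
  by rewrite -E eI in qc.
case: (deg_gt1_neq y (crit_deg_gt1 crit (branch_sub B qK))) => n qn ny.
have nN : n \in N.
  by case: (nbq _ qn) => // nY; rewrite (tame_unique tameY qK nY yY qn qy) eqxx in ny.
exists n, y; split=> //; apply: (deg_eq2 qn qy ny) => c qc.
case: (nbq _ qc) => [cN|cY]; last by right; apply: (tame_unique tameY qK).
by left; apply: (tame_unique tameN _ cN nN qc qn); rewrite in_setD qN.
Qed.

End FirstLayer.

Section BranchInduction.
Variables (K X Y : {set T}).
Hypotheses (B : branch K X Y) (tameX : tame K X) (tameY : tame K Y).
Hypothesis IH : forall Q, #|Q| < #|K| -> forall X' Y', branch Q X' Y' ->
  tame Q X' -> tame Q Y' -> single Q.
Local Notation N := (contact K X).

Let NK w : w \in N -> w \in K.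
Proof. exact: contact_sub. Qed.

Let NX w : w \in N -> adj X w.
Proof. exact: contact_adj. Qed.

Lemma dead_component_single s u : s \in K ->
  branch (component (K :\ s) u) X [set s] -> single (component (K :\ s) u).
Proof.
move=> sK BZ; apply: (IH _ BZ); last exact: tame1.
  by apply: card_lt_notin sK (componentD1_notin _ _ _ _); apply: componentD_sub.
by apply: tame_sub tameX; [apply: componentD_sub|].
Qed.

Lemma arm_end_deg2 a b s : s \in K -> s \notin N -> a \in N -> b \in N ->
  e a s -> e b s -> a != b -> deg a = 2 /\ exists2 x, x \in X & e a x.
Proof.
move=> sK sN aN bN as_ bs ab; rewrite eC in bs.
have aK := NK aN; have bK := NK bN; have a_s := edge_neq eI as_.
have aZ : a \in component (K :\ s) a by apply: component_id; rewrite !inE a_s.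
have [|||a' w|BZ dead] := arm_branch B _ (upath2 eI as_ bs ab) _ (NX aN) (NX bN) _ a_s _ aZ as_.
- by subset_by_mem.
- by [].
- by rewrite !inE eqxx orbT.
- rewrite !inE !negb_or -orbA => aA /andP[/andP[na nb] ns]; move: aA.
  by rewrite (negbTE na) (negbTE nb) (negbTE ns).
have singleZ := dead_component_single sK BZ.
case/adjP: (NX aN) => x xX ax; split; last by exists x.
apply: (deg_eq2 ax as_).
  by apply: contraTneq xX => ->; apply/negP => /(branch_disjX B sK).
move=> c ac; case: (eqVneq c s) => [->|cs]; [by right|left].
case: (boolP (c \in K)) => cK.
  have cZ : c \in component (K :\ s) a by apply: component_closed aZ _ ac; rewrite !inE cs.
  by rewrite (singleZ _ _ aZ cZ) eI in ac.
case: (branch_closed B aK ac cK) => [cX|cY]; first exact: (tame_unique tameX aK).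
by case/negP: (dead _ aZ); apply/adjP; exists c.
Qed.

Lemma first_layer_unique_nb : unique_nb e (K :\: N) N.
Proof.
move=> s a b; rewrite in_setD => /andP[sN sK] aN bN sa sb; apply/eqP; apply: contraT => ab.
have as_ : e a s by rewrite eC.
have bs : e b s by rewrite eC.
have ba : b != a by rewrite eq_sym.
case: (arm_end_deg2 sK sN aN bN as_ bs ab) => da [x xX ax].
case: (arm_end_deg2 sK sN bN aN bs as_ ba) => db [y yX by_].
case: (eqVneq x y) => [E|xy]; last first.
  by case: (tame_hubfree tameX (NK aN) (NK bN) sK ab da db as_ bs xX yX ax by_ xy).
subst y; case: (@cycle4_free _ e (crit_free crit) eI a s b x) => //; first by rewrite eC.
by apply: contraTneq xX => <-; apply/negP => /(branch_disjX B sK).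
Qed.

Lemma first_layer_hubfree : hubfree e (K :\: N) N.
Proof.
apply: contact_hubfree => n u m u' n' sub U nX n'X _ _ du du' nu um mu' u'n'.
case: (hub_arm_branch B sub U nX n'X du du' nu um mu' u'n') => uZ BZ _.
have mK : m \in K by apply: sub; rewrite !inE eqxx ?orbT.
have nZ : n \in component (K :\ m) n.
  apply: component_id; rewrite !inE (sub n) ?mem_head // andbT.
  by move: U; rewrite /= !inE !negb_or => /andP[/and4P[]].
by case/eqP: (edge_neq eI nu); apply: (dead_component_single mK BZ).
Qed.

Lemma second_layer_empty v : v \in K -> v \in N.
Proof.
move=> vK; apply: contraT => vN.
have tameN := Tame first_layer_unique_nb first_layer_hubfree.
have second := second_layer_vertex B tameN tameY IH.
case: (second _ vK vN) => n [y [nN yY vn vy dv]].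
have nK := NK nN; case/adjP: (NX nN) => x xX nx.
have nv : e n v by rewrite eC.
have dn : 2 < deg n.
  rewrite ltn_neqAle (crit_deg_gt1 crit (branch_sub B nK)) andbT.
  by apply/eqP => dn; apply: (crit_deg2_nonadj crit vn dv).
case: (deg_gt2_neq x v dn) => c [nc cx cv].
case: (boolP (c \in K)) => cK; last first.
  case: (branch_closed B nK nc cK) => [cX|cY].
    by rewrite (tame_unique tameX nK cX xX nc nx) eqxx in cx.
  have nY : adj Y n by apply/adjP; exists c.
  have vY : adj Y v by apply/adjP; exists y.
  have := branch_const B (NX nN) nY (upath0 e nK) (NX nN) vY (upath1 eI nv nK vK).
  by clear.
case: (boolP (c \in N)) => cN; first by case: (branch_independent B nK cK (NX nN) (NX cN)).
case: (second _ cK cN) => n' [y' [n'N y'Y cn' cy' dc]].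
have cn : e c n by rewrite eC.
rewrite eq_sym in cv.
case: (eqVneq y y') => [E|yy'].
  subst y'; case: (@cycle4_free _ e (crit_free crit) eI n v y c) => //; first by rewrite eC.
  by apply: contraTneq yY => <-; apply/negP => /(branch_disjY B nK).
by case: (tame_hubfree tameY vK cK nK cv dv dc vn cn yY y'Y vy cy' yy').
Qed.

End BranchInduction.

Lemma branch_single K X Y : branch K X Y -> tame K X -> tame K Y -> single K.
Proof.
elim/card_set_ind: K X Y => K IH X Y B tameX tameY.
apply: (@connected_independent_single _ _ eC K (branch_connected B)) => u v uK vK uv.
have inN w : w \in K -> adj X w.
  by move/(second_layer_empty B tameX tameY IH)/contact_adj.
exact: branch_independent B uK vK (inN _ uK) (inN _ vK) uv.
Qed.

End Branches.

(** * A shortest cycle of length divisible by 3 *)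

Record shortest_cycle0 (T : finType) (e : rel T) (s : seq T) : Prop := ShortestCycle0 {
  sc0_uniq : uniq s;
  sc0_size : 2 < size s;
  sc0_cycle : cycle e s;
  sc0_mod3 : size s %% 3 = 0;
  sc0_min : forall t, uniq t -> 2 < size t -> cycle e t -> size t %% 3 = 0 -> size s <= size t }.

Lemma close_pairs_eq (p p' q q' L : nat) :
  let close x y := (x - y) + (y - x) <= 2 /\ L <= (x - y) + (y - x) + 2 in
  close p q -> close p q' -> close p' q -> close p' q' ->
  p < L -> p' < L -> q < L -> q' < L -> p != p' -> q != q' ->
  p = q /\ p' = q' \/ p = q' /\ p' = q.
Proof. by move=> close [? ?] [? ?] [? ?] [? ?]; lia. Qed.

Section ShortestCycle.
Variables (T : finType) (e : rel T) (S : {set T}) (s : seq T).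
Hypotheses (crit : critical e S) (short : shortest_cycle0 e s).
Implicit Types (K L M A Z X Y N Q : {set T}).
Local Notation upath := (upath e).
Local Notation connected := (connected e).
Local Notation component := (component e).
Local Notation adj := (adj e).
Local Notation deg := (deg e).
Local Notation tame := (tame e).
Local Notation branch := (branch e S).
Local Notation contact := (contact e).
Local Notation ell := (size s).
Let eC : symmetric e := crit_sym crit.
Let eI : irreflexive e := crit_irr crit.
Let cycle4F := cycle4_free (crit_free crit) eI.
Let s3 : 2 < ell := sc0_size short.
Let s0 : ell %% 3 = 0 := sc0_mod3 short.

Definition length_ok m := m %% 3 <> 1 /\ (m %% 3 = 0 -> ell <= m).

Lemma upath_length_ok K x y n : upath K x y n -> e y x -> 1 < n -> length_ok n.+1.
Proof.
move=> P yx n1; case: (upath_cycle P yx n1) => t [ut st ct]; rewrite -st; split.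
  by apply: (crit_free crit ut) ct; rewrite st.
by move=> t0; apply: (sc0_min short); rewrite ?st // -st.
Qed.

Variable x0 : T.
Definition cyc i := nth x0 s i.
Local Notation c := cyc.
Definition arc i j : {set T} := [set x in s | i <= index x s <= j].
Definition coarc i j : {set T} := [set x in s | (index x s <= i) || (j <= index x s)].

Lemma cyc_in i : i < ell -> c i \in s.
Proof. exact: mem_nth. Qed.

Lemma index_cyc i : i < ell -> index (c i) s = i.
Proof. by move=> il; rewrite index_uniq // (sc0_uniq short). Qed.

Lemma cyc_index x : x \in s -> c (index x s) = x.
Proof. exact: nth_index. Qed.

Lemma cyc_inj i j : i < ell -> j < ell -> c i = c j -> i = j.
Proof. by move=> il jl /eqP; rewrite nth_uniq ?(sc0_uniq short) // => /eqP. Qed.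

Lemma cycP x : reflect (exists2 i, i < ell & x = c i) (x \in s).
Proof.
apply: (iffP idP) => [xs|[i il ->]]; last exact: cyc_in.
by exists (index x s); rewrite ?index_mem ?cyc_index.
Qed.

Lemma cyc_step i : i.+1 < ell -> e (c i) (c i.+1).
Proof.
rewrite /c; case: s (sc0_cycle short) => //= x p /(pathP x0) step il.
have := step i; rewrite size_rcons -rcons_cons !nth_rcons /= => /(_ (ltnW il)).
by rewrite !ltnS in il *; rewrite il (ltnW il).
Qed.

Lemma cyc_wrap : e (c ell.-1) (c 0).
Proof.
rewrite /c; case: s (sc0_cycle short) s3 => //= x p.
by rewrite rcons_path (last_nth x0) => /andP[_].
Qed.

Definition consecutive a b :=
  [|| a + 1 == b, b + 1 == a, (a == 0) && (b == ell.-1) | (b == 0) && (a == ell.-1)].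

Lemma cyc_edge a b : a < ell -> b < ell -> consecutive a b -> e (c a) (c b).
Proof.
move=> al bl; rewrite /consecutive !addn1.
case/or4P => [/eqP E|/eqP E|/andP[/eqP-> /eqP->]|/andP[/eqP-> /eqP->]]; last exact: cyc_wrap.
- by rewrite -E in bl *; apply: cyc_step.
- by rewrite -E in al *; rewrite eC; apply: cyc_step.
by rewrite eC; apply: cyc_wrap.
Qed.

Lemma arc_shift_upath i d : i + d < ell -> upath (arc i (i + d)) (c i) (c (i + d)) d.
Proof.
elim: d => [|d IH] idl.
  by rewrite addn0 in idl *; apply: upath0; rewrite inE cyc_in //= index_cyc // !leqnn.
rewrite addnS in idl *; have {}IH := IH (ltnW idl).
apply: upath_sub (upath_rcons eC IH (cyc_step idl) _) _.
  by rewrite inE index_cyc // cyc_in //= ltnn andbF.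
move=> w; rewrite !inE => /orP[/eqP->|/and3P[-> -> wd]]; last exact: leqW.
by rewrite cyc_in // index_cyc //; lia.
Qed.

Lemma arc_upath i j : i <= j -> j < ell -> upath (arc i j) (c i) (c j) (j - i).
Proof. by move=> ij jl; have := @arc_shift_upath i (j - i); rewrite subnKC //; apply. Qed.

Lemma coarc_upath i j : i < j -> j < ell -> upath (coarc i j) (c j) (c i) (ell - (j - i)).
Proof.
move=> ij jl; have l1 : ell.-1 < ell by lia.
have P1 := arc_upath (i := j) (j := ell.-1) ltac:(lia) l1.
have P2 := arc_upath (i := 0) (j := i) ltac:(lia) ltac:(lia).
have := upath_cat P1 cyc_wrap P2.
have -> : (ell.-1 - j + (i - 0)).+1 = ell - (j - i) by clear - ij jl; lia.
move=> P; apply: upath_sub (P _) _.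
  by move=> w; rewrite !inE => /and3P[_ ? ?] /and3P[_ _ ?]; lia.
move=> w; rewrite !inE => /orP[/and3P[-> -> _]|/andP[-> /= ->]//].
by rewrite orbT.
Qed.

Definition off K := forall w, w \in K -> w \notin s.

Lemma off_sub K L : off K -> {subset L <= K} -> off L.
Proof. by move=> oK LK w /LK /oK. Qed.

Lemma off_arc K i j w : off K -> w \in arc i j -> w \in K -> False.
Proof. by move=> oK; rewrite inE => /andP[ws _] /oK; rewrite ws. Qed.

Lemma off_coarc K i j w : off K -> w \in coarc i j -> w \in K -> False.
Proof. by move=> oK; rewrite inE => /andP[ws _] /oK; rewrite ws. Qed.

Lemma link_lengths K n n' k i j : off K -> upath K n n' k ->
  e n (c i) -> e n' (c j) -> i < j -> j < ell ->
  length_ok (j - i + k + 2) /\ length_ok (ell - (j - i) + k + 2).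
Proof.
move=> oK P ni n'j ij jl; have Pr := upath_rev eC P.
have jn' : e (c j) n' by rewrite eC.
have in_ : e (c i) n by rewrite eC.
split.
  have := upath_cat (arc_upath (ltnW ij) jl) jn' Pr (fun w => @off_arc K i j w oK).
  by move/upath_length_ok => /(_ ni); rewrite !addnS addn0; apply; lia.
have := upath_cat (coarc_upath ij jl) in_ P (fun w => @off_coarc K i j w oK).
by move/upath_length_ok => /(_ n'j); rewrite !addnS addn0; apply; lia.
Qed.

Lemma four_upaths_length_ok A B K K' x y z w n n' m m' a b k k' :
  upath A x y a -> upath K' n' m' k' -> upath B z w b -> upath K n m k ->
  e y n' -> e m' z -> e w n -> e m x ->
  (forall t, t \in A -> t \in K' -> False) -> (forall t, t \in A -> t \in B -> False) ->
  (forall t, t \in A -> t \in K -> False) -> (forall t, t \in K' -> t \in B -> False) ->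
  (forall t, t \in K' -> t \in K -> False) -> (forall t, t \in B -> t \in K -> False) ->
  length_ok (a + b + k + k' + 4).
Proof.
move=> PA PK' PB PK yn' m'z wn mx AK' AB AK K'B K'K BK.
have P1 := upath_cat PA yn' PK' AK'.
have P2 : upath (A :|: K' :|: B) x w ((a + k').+1 + b).+1.
  by apply: upath_cat P1 m'z PB _ => t /setUP[]; [apply: AB|apply: K'B].
have P3 : upath (A :|: K' :|: B :|: K) x m (((a + k').+1 + b).+1 + k).+1.
  by apply: upath_cat P2 wn PK _ => t /setUP[/setUP[]|]; [apply: AK|apply: K'K|apply: BK].
have -> : a + b + k + k' + 4 = (((a + k').+1 + b).+1 + k).+2 by clear; lia.
by apply: upath_length_ok P3 mx _; clear; lia.
Qed.

Lemma crossing_lengths K K' n1 n2 n3 n4 k k' i1 i2 i3 i4 : off K -> off K' ->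
  (forall w, w \in K -> w \in K' -> False) ->
  upath K n1 n3 k -> upath K' n2 n4 k' ->
  e n1 (c i1) -> e n2 (c i2) -> e n3 (c i3) -> e n4 (c i4) ->
  i1 < i2 -> i2 < i3 -> i3 < i4 -> i4 < ell ->
  length_ok ((i2 - i1) + (i4 - i3) + k + k' + 4) /\
  length_ok ((i3 - i2) + (ell - (i4 - i1)) + k' + k + 4).
Proof.
move=> oK oK' KK' P P' n1c n2c n3c n4c i12 i23 i34 i4l.
have cn2 : e (c i2) n2 by rewrite eC.
have cn3 : e (c i3) n3 by rewrite eC.
have cn4 : e (c i4) n4 by rewrite eC.
have i3l := ltn_trans i34 i4l; have i2l := ltn_trans i23 i3l.
have i14 : i1 < i4 := ltn_trans i12 (ltn_trans i23 i34).
split.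
  apply: (four_upaths_length_ok (arc_upath (ltnW i12) i2l) P'
            (upath_rev eC (arc_upath (ltnW i34) i4l)) (upath_rev eC P) cn2 n4c cn3 n1c).
  - by move=> w; apply: off_arc.
  - by move=> w; rewrite !inE => /and3P[_ _ wi2] /and3P[_ i3w _]; move: wi2 i3w i23; clear; lia.
  - by move=> w; apply: off_arc.
  - by move=> w wK' wB; apply: off_arc wB wK'.
  - by move=> w wK' wK; apply: KK' wK wK'.
  by move=> w; apply: off_arc.
apply: (four_upaths_length_ok (arc_upath (ltnW i23) i3l) (upath_rev eC P)
          (upath_rev eC (coarc_upath i14 i4l)) (upath_rev eC P') cn3 n1c cn4 n2c).
- by move=> w; apply: off_arc.
- by move=> w; rewrite !inE => /and3P[_ i2w wi3] /andP[_]; move: i2w wi3 i12 i34; clear; lia.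
- by move=> w; apply: off_arc.
- by move=> w wK wB; apply: off_coarc wB wK.
- by move=> w; apply: KK'.
by move=> w; apply: off_coarc.
Qed.

Lemma chord_free i j : i < j -> j < ell -> e (c i) (c j) ->
  j = i.+1 \/ (i = 0 /\ j = ell.-1).
Proof.
move=> ij jl eij; have eji : e (c j) (c i) by rewrite eC.
case: (ltnP 1 (j - i)) => [d1|d1]; last by left; move: ij d1; clear; lia.
have [o1 o1'] := upath_length_ok (arc_upath (ltnW ij) jl) eji d1.
case: (ltnP 1 (ell - (j - i))) => [d2|d2]; last by right; move: ij jl d1 d2; clear; lia.
have [o2 o2'] := upath_length_ok (coarc_upath ij jl) eij d2.
move: o1 o1' o2 o2' d1 d2 ij jl s0; clear; lia.
Qed.

Lemma cyc_adj a y : a < ell -> e (c a) y -> y \in s ->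
  exists b, [/\ b < ell, y = c b & consecutive a b].
Proof.
move=> al ay /cycP[b bl E]; exists b; split=> //; rewrite /consecutive E in ay *.
case: (ltngtP a b) => [lt|gt|E']; last by rewrite E' eI in ay.
  by case: (chord_free lt bl ay) => [->|[-> ->]]; rewrite ?addn1 ?eqxx ?orbT.
rewrite eC in ay.
by case: (chord_free gt al ay) => [->|[-> ->]]; rewrite ?addn1 ?eqxx ?orbT.
Qed.

Lemma cyc_supp x : x \in s -> x \in S.
Proof.
case/cycP => i il ->; case: (ltnP i.+1 ell) => [lt|ge]; first exact: crit_supp (cyc_step lt).
have -> : i = ell.-1 by move: il ge; clear; lia.
exact: crit_supp cyc_wrap.
Qed.

(** * Colours *)

Definition colour x := index x s %% 3.
Definition colour_class i : {set T} := [set x in s | colour x == i].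
Definition other_colours i : {set T} := [set x in s | colour x != i].
Local Notation sees i := (adj (colour_class i)).
Local Notation attached := (adj [set x in s]).

Definition doubly_sees i n :=
  exists x x', [/\ x \in colour_class i, x' \in colour_class i, x != x', e n x & e n x'].

Lemma colour_classP i x : x \in colour_class i -> x \in s /\ colour x = i.
Proof. by rewrite inE => /andP[-> /eqP]. Qed.

Lemma colour_class_in i x : x \in colour_class i -> x \in s.
Proof. by case/colour_classP. Qed.

Lemma mem_colour_class x : x \in s -> x \in colour_class (colour x).
Proof. by move=> xs; rewrite inE xs /=. Qed.

Lemma sees_colour x u : x \in s -> e u x -> sees (colour x) u.
Proof. by move=> xs ux; apply/adjP; exists x => //; apply: mem_colour_class. Qed.

Lemma attachedI x u : x \in s -> e u x -> attached u.
Proof. by move=> xs ux; apply/adjP; exists x; rewrite // inE. Qed.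

Lemma sees_attached u i : sees i u -> attached u.
Proof. by case/adjP => x /colour_classP[xs _]; apply: attachedI. Qed.

Lemma attachedP u : attached u -> exists2 i, i < 3 & sees i u.
Proof.
case/adjP => x; rewrite inE => xs ux; exists (colour x); first by rewrite ltn_pmod.
exact: sees_colour.
Qed.

Lemma sees_lt3 u i : sees i u -> i < 3.
Proof. by case/adjP => x /colour_classP[_ <-] _; rewrite ltn_pmod. Qed.

Lemma doubly_sees_sees i n : doubly_sees i n -> sees i n.
Proof. by case=> x [_ [xi _ _ nx _]]; apply/adjP; exists x. Qed.

Lemma cyc_colour_class a : a < ell -> c a \in colour_class (a %% 3).
Proof. by move=> al; rewrite inE cyc_in //= /colour index_cyc. Qed.

Lemma colour_class_cyc i x :
  x \in colour_class i -> exists a, [/\ a < ell, a %% 3 = i & x = c a].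
Proof.
case/colour_classP => xs xi; exists (index x s); split=> //; first by rewrite index_mem.
by rewrite cyc_index.
Qed.

Lemma sees_cyc i n : sees i n -> exists a, [/\ a < ell, a %% 3 = i & e n (c a)].
Proof. by case/adjP => x /colour_class_cyc[a [al ai ->]] nx; exists a. Qed.

Lemma doubly_sees_cyc i n : doubly_sees i n ->
  exists a a', [/\ a < a', a' < ell, a %% 3 = i, a' %% 3 = i & e n (c a) /\ e n (c a')].
Proof.
case=> x [x' [/colour_class_cyc[a [al ai ->]] /colour_class_cyc[b [bl bi ->]] ab na nb]].
case: (ltngtP a b) => [lt|gt|E]; last by rewrite E eqxx in ab.
- by exists a, b.
by exists b, a.
Qed.

Lemma doubly_sees_size i n : doubly_sees i n -> 6 <= ell.
Proof.
case/doubly_sees_cyc => a [a' [aa a'l ai a'i _]].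
by move: aa a'l ai a'i s0; clear; lia.
Qed.

Lemma link_colour K n n' k x y : off K -> upath K n n' k -> x \in s -> y \in s ->
  e n x -> e n' y ->
  [/\ colour x != colour y -> k %% 3 = 2,
      colour x = colour y -> x != y -> k %% 3 <> 2
    & x = y -> 0 < k -> k %% 3 <> 2].
Proof.
move=> oK P xs ys nx n'y; rewrite /colour.
have il : index x s < ell by rewrite index_mem.
have jl : index y s < ell by rewrite index_mem.
have nx' : e n (c (index x s)) by rewrite cyc_index.
have n'y' : e n' (c (index y s)) by rewrite cyc_index.
have residues a b k' l : (b - a + k' + 2) %% 3 <> 1 -> (l - (b - a) + k' + 2) %% 3 <> 1 ->
    a < b -> b < l -> l %% 3 = 0 ->
    (a %% 3 != b %% 3 -> k' %% 3 = 2) /\ (a %% 3 = b %% 3 -> k' %% 3 <> 2) by clear; lia.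
case: (ltngtP (index x s) (index y s)) => [lt|gt|eq].
- case: (link_lengths oK P nx' n'y' lt jl) => -[o1 _] [o2 _].
  have [differ same] := residues _ _ _ _ o1 o2 lt jl s0.
  by split=> [|E _|E]; [exact: differ|exact: same|move: lt; rewrite E ltnn].
- case: (link_lengths oK (upath_rev eC P) n'y' nx' gt il) => -[o1 _] [o2 _].
  have [differ same] := residues _ _ _ _ o1 o2 gt il s0.
  split=> [?|/esym ? _|E]; last by move: gt; rewrite E ltnn.
    by apply: differ; rewrite eq_sym.
  exact: same.
have xy : x = y by rewrite -(cyc_index xs) eq cyc_index.
subst y; split; rewrite ?eqxx //; move=> _ k0.
have xK : x \notin K by apply/negP => /oK; rewrite xs.
have xn : e x n by rewrite eC.
have [o1 _] := upath_length_ok (upath_cons xn xK P) n'y k0.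
by move: o1; clear; lia.
Qed.

Lemma same_colour_link K n n' k i : off K -> upath K n n' k ->
  sees i n -> sees i n' -> n != n' -> k %% 3 <> 2.
Proof.
move=> oK P /adjP[x /colour_classP[xs xi] nx] /adjP[y /colour_classP[ys yi] n'y] nn'.
case: (link_colour oK P xs ys nx n'y) => _ distinct equal.
case: (eqVneq x y) => [xy|xy]; last by apply: distinct; rewrite // xi yi.
by apply: equal => //; rewrite lt0n (upath_eq0 P).
Qed.

Lemma two_colour_link K n n' k i j : off K -> upath K n n' k ->
  sees i n -> sees j n' -> i != j -> k %% 3 = 2.
Proof.
move=> oK P /adjP[x /colour_classP[xs xi] nx] /adjP[y /colour_classP[ys yi] n'y] ij.
by case: (link_colour oK P xs ys nx n'y) => two _ _; apply: two; rewrite xi yi.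
Qed.

Lemma sees_inj u i j : u \notin s -> sees i u -> sees j u -> i = j.
Proof.
move=> us ui uj; apply/eqP; apply: contraT => ij.
have ou : off [set u] by move=> w /set1P->.
by have := two_colour_link ou (upath0 e (set11 u)) ui uj ij.
Qed.

Lemma feet_distance A n n' i a b : off A -> upath A n n' 4 ->
  a \in colour_class i -> b \in colour_class i -> e n a -> e n' b ->
  let p := index a s %/ 3 in let q := index b s %/ 3 in
  (p - q) + (q - p) <= 2 /\ ell %/ 3 <= (p - q) + (q - p) + 2.
Proof.
move=> oA P /colour_class_cyc[p [pl pi ->]] /colour_class_cyc[q [ql qi ->]] np n'q.
rewrite !index_cyc //; case: (ltngtP p q) => [pq|qp|E].
- have [[_ o1] [_ o2]] := link_lengths oA P np n'q pq ql.
  by move: o1 o2 pl ql pi qi pq s0; move: (size s) => L; clear; lia.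
- have [[_ o1] [_ o2]] := link_lengths oA (upath_rev eC P) n'q np qp pl.
  by move: o1 o2 pl ql pi qi qp s0; move: (size s) => L; clear; lia.
subst q; have pA : c p \notin A by apply/negP => /oA; rewrite cyc_in.
rewrite eC in np; have [_ /(_ erefl)] := upath_length_ok (upath_cons np pA P) n'q isT.
by rewrite /= subnn; move: (size s) => L; clear; lia.
Qed.

Lemma doubly_sees_path4_contra i n1 v1 m v2 n2 :
  {in [:: n1; v1; m; v2; n2], forall w, w \notin s} -> uniq [:: n1; v1; m; v2; n2] ->
  e n1 v1 -> e v1 m -> e m v2 -> e v2 n2 -> doubly_sees i n1 -> doubly_sees i n2 -> False.
Proof.
move=> out U n1v1 v1m mv2 v2n2 [x [x' [xi x'i xx' n1x n1x']]] [y [y' [yi y'i yy' n2y n2y']]].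
have P := upath4 n1v1 v1m mv2 v2n2 U.
have oA : off [set w in [:: n1; v1; m; v2; n2]] by move=> w; rewrite inE => /out.
have n12 : n1 != n2 by move: U; rewrite /= !inE !negb_or => /andP[/and4P[]].
have block_inj a b : a \in colour_class i -> b \in colour_class i ->
    index a s %/ 3 = index b s %/ 3 -> a = b.
  move=> /colour_classP[as_ ai] /colour_classP[bs bi] E; rewrite -(cyc_index as_) -(cyc_index bs).
  by rewrite (divn_eq (index a s) 3) E -/(colour a) ai -bi -divn_eq.
have block_neq a b : a \in colour_class i -> b \in colour_class i -> a != b ->
    index a s %/ 3 != index b s %/ 3.
  by move=> ai bi; apply: contra => /eqP /(block_inj _ _ ai bi)/eqP.
have block_lt a : a \in colour_class i -> index a s %/ 3 < ell %/ 3.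
  by case/colour_class_cyc => p [pl _ ->]; rewrite index_cyc //; move: pl s0; clear; lia.
have : (x = y /\ x' = y') \/ (x = y' /\ x' = y).
  have close a b ai bi na nb := @feet_distance _ _ _ i a b oA P ai bi na nb.
  by case: (close_pairs_eq (close _ _ xi yi n1x n2y) (close _ _ xi y'i n1x n2y')
    (close _ _ x'i yi n1x' n2y) (close _ _ x'i y'i n1x' n2y') (block_lt _ xi) (block_lt _ x'i)
    (block_lt _ yi) (block_lt _ y'i) (block_neq _ _ xi x'i xx') (block_neq _ _ yi y'i yy'));
    case=> E1 E2; [left|right]; split; apply: block_inj.
have yn2 : e y n2 by rewrite eC.
have y'n1 : e n1 y' -> e y' n1 by rewrite eC.
by case=> -[E1 E2]; subst; apply: (@cycle4F n1 y n2 y') => //; apply: y'n1.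
Qed.

(** * Dead ends of a single colour *)

Definition dead_end_pairs i Z := forall w u, branch Z (colour_class i) [set w] -> off Z ->
  u \in Z -> ~~ sees i u ->
  exists n, [/\ Z = [set n; u], doubly_sees i n, e n u, e u w & deg u = 2].

Section HubArms.
Variables (K X Y : {set T}) (i : nat).
Hypotheses (B : branch K X Y) (oK : off K) (Xi : {subset X <= colour_class i}).
Hypothesis cover : forall t, t \in K -> sees i t -> adj X t \/ adj Y t.
Hypothesis smaller : forall Z, #|Z| < #|K| -> dead_end_pairs i Z.

Lemma hub_arm_doubly_sees n u m u' n' :
  {subset [:: n; u; m; u'; n'] <= K} -> uniq [:: n; u; m; u'; n'] ->
  adj X n -> adj X n' -> ~~ sees i u -> deg u = 2 -> deg u' = 2 ->
  e n u -> e u m -> e m u' -> e u' n' -> doubly_sees i n.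
Proof.
move=> sub U nX n'X ui du du' nu um mu' u'n'.
have mK : m \in K by apply: sub; rewrite !inE eqxx ?orbT.
have nm : n != m by move: U; rewrite /= !inE !negb_or => /andP[/and4P[]].
have nK : n \in K by apply: sub; rewrite inE eqxx.
have nC : n \in component (K :\ m) n by apply: component_id; rewrite !inE nm.
have [uC BC dead] := hub_arm_branch crit B sub U nX n'X du du' nu um mu' u'n'.
have CK : {subset component (K :\ m) n <= K} by apply: componentD_sub.
have XtoC t : adj X t -> sees i t by apply: adjS.
have CtoX t : t \in component (K :\ m) n -> sees i t -> adj X t.
  by move=> tC /(cover (CK _ tC))[//|tY]; have := dead _ tC; rewrite tY.
have BC' : branch (component (K :\ m) n) (colour_class i) [set m].
  case: BC => cC CS _ dY clC _ aY cst; split=> //.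
  - by move=> w /CK /oK ws /colour_class_in; rewrite (negbTE ws).
  - by move=> a w aC aw wC; case: (clC a w aC aw wC); [move/Xi; left|right].
  - by exists n => //; apply: XtoC.
  move=> a b k a' b' k' /CtoX aX bY P /CtoX a'X b'Y P'.
  exact: cst (aX (upath_head P)) bY P (a'X (upath_head P')) b'Y P'.
have Clt := card_lt_notin CK mK (componentD1_notin _ _ _ _).
case: (smaller Clt BC' (off_sub oK CK) uC ui) => t [CE dt _ _ _].
by move: nC (edge_neq eI nu); rewrite CE !inE => /orP[]/eqP->; rewrite ?eqxx.
Qed.

End HubArms.

Lemma hub_arms_contra K X Y i n u m u' n' : branch K X Y -> off K ->
  {subset X <= colour_class i} -> (forall t, t \in K -> sees i t -> adj X t \/ adj Y t) ->
  (forall Z, #|Z| < #|K| -> dead_end_pairs i Z) ->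
  {subset [:: n; u; m; u'; n'] <= K} -> uniq [:: n; u; m; u'; n'] ->
  adj X n -> adj X n' -> ~~ sees i u -> ~~ sees i u' -> deg u = 2 -> deg u' = 2 ->
  e n u -> e u m -> e m u' -> e u' n' -> False.
Proof.
move=> B oK Xi cover smaller sub U nX n'X ui u'i du du' nu um mu' u'n'.
apply: (@doubly_sees_path4_contra i n u m u' n') => //; first by move=> t /sub /oK.
  exact: (hub_arm_doubly_sees B oK Xi cover smaller sub U nX n'X ui du du' nu um mu' u'n').
apply: (hub_arm_doubly_sees (m := m) B oK Xi cover smaller _ _ n'X nX u'i du' du); rewrite 1?eC //.
  by move=> t; rewrite -(mem_rev [:: n'; u'; m; u; n]); apply: sub.
by rewrite -(rev_uniq [:: n'; u'; m; u; n]).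
Qed.

Lemma colour_contact_unique_nb K i : off K ->
  unique_nb e (K :\: contact K (colour_class i)) (contact K (colour_class i)).
Proof.
move=> oK u x x'; rewrite in_setD !contactE => /andP[_ uK] /andP[xK xi] /andP[x'K x'i] ux ux'.
apply/eqP; apply: contraT => xx'; rewrite eC in ux.
have P : upath K x x' 2 by apply: upath_sub (upath2 eI ux ux' xx') _; subset_by_mem.
by case: (same_colour_link oK P xi x'i xx').
Qed.

Lemma colour_contact_hubfree Z i w : branch Z (colour_class i) [set w] -> off Z ->
  (forall Z', #|Z'| < #|Z| -> dead_end_pairs i Z') ->
  hubfree e (Z :\: contact Z (colour_class i)) (contact Z (colour_class i)).
Proof.
move=> B oZ smaller; apply: (contact_hubfree crit) => n u m u' n'.
by apply: (hub_arms_contra B oZ _ _ smaller) => // t _; left.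
Qed.

Lemma dead_end_doubly_sees i Z w n u : branch Z (colour_class i) [set w] -> Z = [set n; u] ->
  sees i n -> e n u -> e u w -> deg u = 2 -> doubly_sees i n.
Proof.
move=> B ZE ni nu uw du; have [nZ uZ] : n \in Z /\ u \in Z by rewrite ZE !inE !eqxx orbT.
case/adjP: (ni) => x xi nx.
have dn : 2 < deg n.
  rewrite ltn_neqAle (crit_deg_gt1 crit (branch_sub B nZ)) andbT.
  by apply/eqP => dn; apply: (crit_deg2_nonadj crit nu).
case: (deg_gt2_neq x u dn) => a [na ax au]; exists x, a; split=> //; last by rewrite eq_sym.
have aZ : a \notin Z.
  by rewrite ZE !inE negb_or au andbT eq_sym (edge_neq eI na).
case: (branch_closed B nZ na aZ) => // aw.
have nY : adj [set w] n by apply/adjP; exists a.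
have uY : adj [set w] u by rewrite adj1.
by have := branch_const B ni nY (upath0 e nZ) ni uY (upath1 eI nu nZ uZ).
Qed.

Lemma dead_end_pair i Z : dead_end_pairs i Z.
Proof.
elim/card_set_ind: Z => Z smaller w u B oZ uZ ui.
pose N := contact Z (colour_class i).
have NZ : {subset N <= Z} by apply: contact_sub.
have Ni t : t \in N -> sees i t by apply: contact_adj.
have tameN : tame (Z :\: N) N.
  by split; [apply: colour_contact_unique_nb|apply: colour_contact_hubfree B oZ smaller].
have second t : t \in Z -> t \notin N -> exists n, [/\ n \in N, e t n, e t w & deg t = 2].
  move=> tZ tN; have IHZ Q (_ : #|Q| < #|Z|) := @branch_single _ _ _ crit Q.
  case: (second_layer_vertex crit B tameN (tame1 e Z w) IHZ tZ tN) => n [y [nN]].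
  by move=> /set1P-> tn tw dt; exists n.
have uN : u \notin N by rewrite contactE (negbTE ui) andbF.
case: (second u uZ uN) => n [nN un uw du]; exists n.
have nZ := NZ _ nN; have nu : e n u by rewrite eC.
have wZ : w \notin Z by apply/negP => /(branch_disjY B); rewrite inE eqxx; apply.
have nw : n != w by apply: contraNneq wZ => <-.
have ZE : Z = [set n; u].
  apply/esym; apply: (connected_closed eC (z := n) (branch_connected B)).
  - by rewrite !inE eqxx.
  - by subset_by_mem.
  move=> y t /set2P[]-> tZ yt; last first.
    case: (deg2_adj du un uw nw yt) => E; first by rewrite E !inE eqxx.
    by rewrite E (negbTE wZ) in tZ.
  case: (boolP (t \in N)) => tN.
    by case: (branch_independent crit B nZ tZ (Ni _ nN) (Ni _ tN)).
  case: (second t tZ tN) => _ [_ _ tw _]; case: (eqVneq t u) => [->|tu].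
    by rewrite !inE eqxx orbT.
  by case: (@cycle4F n u w t) => //; [rewrite eC|rewrite eC|rewrite eq_sym].
by split=> //; apply: dead_end_doubly_sees B ZE (Ni _ nN) nu uw du.
Qed.

(** * Components off the cycle *)

Record outer K : Prop := Outer {
  outer_connected : connected K;
  outer_sub : {subset K <= S};
  outer_off : off K;
  outer_closed : forall u w, u \in K -> e u w -> w \notin K -> w \in s }.

Definition rim K := contact K [set x in s].
Definition inner K := K :\: rim K.

Definition polychromatic K := exists i j a b,
  [/\ i != j, a \in K, b \in K, sees i a & sees j b].

Lemma rimE K w : (w \in rim K) = (w \in K) && attached w.
Proof. exact: contactE. Qed.

Lemma innerE K w : (w \in inner K) = (w \in K) && ~~ attached w.
Proof. by rewrite in_setD rimE; case: (w \in K); rewrite /= ?andbF ?andbT. Qed.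

Lemma inner_sub K : {subset inner K <= K}.
Proof. by move=> w; rewrite innerE => /andP[]. Qed.

Lemma inner_unattached K w : w \in inner K -> ~~ attached w.
Proof. by rewrite innerE => /andP[]. Qed.

Lemma rim_inner_disjoint K w : w \in rim K -> w \in inner K -> False.
Proof. by rewrite in_setD => ->. Qed.

Lemma colour_contact_rim K i : {subset contact K (colour_class i) <= rim K}.
Proof. by move=> w; rewrite contactE rimE => /andP[-> /sees_attached]. Qed.

Lemma attached_neq x y : attached x -> ~~ attached y -> x != y.
Proof. by move=> xC; apply: contraNneq => <-. Qed.

Lemma colours_neq i j n n' : i != j -> n \notin s -> sees i n -> sees j n' -> n != n'.
Proof.
move=> ij ns ni n'j; apply: contraNneq ij => E; rewrite -E in n'j.
by apply/eqP; apply: sees_inj ns ni n'j.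
Qed.

Lemma same_colour_common_nb K i w n n' : off K -> w \in K -> n \in K -> n' \in K ->
  sees i n -> sees i n' -> e w n -> e w n' -> n = n'.
Proof.
move=> oK wK nK n'K ni n'i wn wn'; apply/eqP; apply: contraT => nn'; rewrite eC in wn.
have P : upath K n n' 2 by apply: upath_sub (upath2 eI wn wn' nn') _; subset_by_mem.
by case: (same_colour_link oK P ni n'i nn').
Qed.

Lemma third_colour i j : i < 3 -> j < 3 -> i != j ->
  exists l, [/\ l < 3, i != l, j != l & forall k, k < 3 -> [\/ k = i, k = j | k = l]].
Proof.
move=> i3 j3 ij; exists (3 - i - j); split; try by move: i3 j3 ij; clear; lia.
move=> k k3; have : [|| k == i, k == j | k == 3 - i - j] by move: k3 i3 j3 ij; clear; lia.
by case/or3P => /eqP; [constructor 1|constructor 2|constructor 3].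
Qed.

Record colour_link K v n n' i j : Prop := ColourLink {
  cl_neq : i != j;
  cl_mid : v \in K;
  cl_unattached : ~~ attached v;
  cl_deg : deg v = 2;
  cl_edge : e v n;
  cl_edge' : e v n';
  cl_end : n \in K;
  cl_end' : n' \in K;
  cl_sees : sees i n;
  cl_sees' : sees j n' }.

Lemma colour_link_sym K v n n' i j : colour_link K v n n' i j -> colour_link K v n' n j i.
Proof. by case=> ij *; split; rewrite // eq_sym. Qed.

Record tripod K z (leaf : nat -> T) : Prop := Tripod {
  tp_center : z \in K;
  tp_unattached : ~~ attached z;
  tp_leaf : forall k, k < 3 -> leaf k \in K;
  tp_sees : forall k, k < 3 -> sees k (leaf k);
  tp_edge : forall k, k < 3 -> e z (leaf k) }.

Definition leaves (leaf : nat -> T) : {set T} := [set leaf 0; leaf 1; leaf 2].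

Lemma leavesP leaf t : reflect (exists2 k, k < 3 & t = leaf k) (t \in leaves leaf).
Proof.
rewrite !inE -orbA; apply: (iffP or3P) => [[]/eqP->|[[|[|[|//]]] _ ->]]; rewrite ?eqxx.
- by exists 0.
- by exists 1.
- by exists 2.
- by constructor 1.
- by constructor 2.
by constructor 3.
Qed.

Section Polychromatic.
Variable K : {set T}.
Hypotheses (oK : outer K) (polyK : polychromatic K).
Let offK := outer_off oK.
Let connK := outer_connected oK.
Local Notation rimK := (rim K).
Local Notation rim_of i := (contact K (colour_class i)).
Local Notation innerK := (inner K).

Lemma outer_branch i n : n \in K -> sees i n -> branch K (colour_class i) (other_colours i).
Proof.
move=> nK ni; split=> //.
- exact: outer_sub oK.
- by move=> w /offK ws /colour_class_in; rewrite (negbTE ws).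
- by move=> w /offK ws; rewrite inE (negbTE ws).
- move=> u w uK uw /(outer_closed oK uK uw) ws; rewrite !inE ws /=.
  by case: eqP; [left|right].
- by exists n.
- case: polyK => k [l [a [b [kl aK bK /adjP[x xk ax] /adjP[y yl by_]]]]].
  case/colour_classP: xk => xs xk; case/colour_classP: yl => ys yl.
  case: (eqVneq k i) => [E|ki]; [exists b|exists a] => //; apply/adjP.
    by exists y; rewrite // inE ys yl -E eq_sym.
  by exists x; rewrite // inE xs xk.
apply: (mod3_constI (r := 2)) => u v k ui /adjP[x].
rewrite inE => /andP[xs xi] vx P.
by apply: two_colour_link offK P ui (sees_colour xs vx) _; rewrite eq_sym.
Qed.

Lemma rim_independent u u' : u \in rimK -> u' \in rimK -> e u u' -> False.
Proof.
rewrite !rimE => /andP[uK /attachedP[i _ ui]] /andP[u'K /attachedP[j _ u'j]] uu'.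
case: (eqVneq i j) => [ij|ij]; last first.
  by have := two_colour_link offK (upath1 eI uu' uK u'K) ui u'j ij.
rewrite -ij in u'j; exact: (branch_independent crit (outer_branch uK ui) uK u'K ui u'j uu').
Qed.

Lemma inner_hubfree : hubfree e innerK rimK.
Proof.
apply: (contact_hubfree crit) => n u m u' n' sub U nC n'C uC u'C du du' nu um mu' u'n'.
have [nK n'K] : n \in K /\ n' \in K by split; apply: sub; rewrite !inE eqxx ?orbT.
case/attachedP: nC => i _ ni; case/attachedP: n'C => j _ n'j.
case: (eqVneq i j) => [E|ij]; last first.
  have P : upath K n n' 4.
    by apply: upath_sub (upath4 nu um mu' u'n' U) _ => w; rewrite inE; apply: sub.
  by have := two_colour_link offK P ni n'j ij.
subst j; have unseen t : ~~ attached t -> ~~ sees i t by apply: contra; apply: sees_attached.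
apply: (hub_arms_contra (outer_branch nK ni) offK _ _ (fun Z _ => @dead_end_pair i Z)
          sub U ni n'j (unseen _ uC) (unseen _ u'C) du du' nu um mu' u'n') => //.
by move=> t _; left.
Qed.

Lemma upath_inner_ends L n b k : upath L n b k -> {subset L <= n |: (b |: innerK)} ->
  n != b -> n \in rimK -> b \in rimK ->
  exists q1 q2, [/\ q1 \in innerK, q2 \in component innerK q1, e n q1, e b q2 & q1 \in L].
Proof.
move=> P LI nb nC bC; case: k P => [|k] P; first by rewrite (upath_len0 P) eqxx in nb.
case/upath_behead: P => q1 [nq1 q1L q1n P].
have q1b : q1 != b by apply/eqP => E; subst q1; apply: (rim_independent nC bC nq1).
have q1I : q1 \in innerK.
  by have := LI _ q1L; rewrite !in_setU1 (negbTE q1n) (negbTE q1b).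
case: k P => [|k] /(upath_rev eC) P; first by rewrite (upath_len0 P) eqxx in q1b.
case/upath_behead: P => q2 [bq2 _ _ P].
exists q1, q2; split=> //; apply: (upath_component eC (upath_rev eC P)) => w.
by rewrite !in_setD1 => /and3P[wb wn /LI]; rewrite !in_setU1 (negbTE wb) (negbTE wn).
Qed.

Section InnerComponent.
Variable q : T.
Local Notation Q := (component innerK q).

Lemma inner_component_sub : {subset Q <= innerK}.
Proof. exact: component_sub. Qed.

Lemma inner_component_closed u w : u \in Q -> e u w -> w \notin Q -> w \in rimK.
Proof.
move=> uQ uw wQ; have uI := inner_component_sub uQ.
have wK : w \in K.
  apply: contraT => wK; case/negP: (inner_unattached uI).
  exact: attachedI (outer_closed oK (inner_sub uI) uw wK) uw.
apply: contraR wQ => wC; apply: component_closed uQ _ uw; by rewrite in_setD wC.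
Qed.

Lemma upath_through_inner n n' u v k : n \in rimK -> n' \in rimK -> n != n' ->
  e n u -> e v n' -> upath Q u v k -> upath K n n' k.+2.
Proof.
move=> nC n'C nn' nu vn' P.
have rimQ w : w \in rimK -> w \notin Q.
  by move=> wC; apply/negP => /inner_component_sub; apply: rim_inner_disjoint.
have nQ := rimQ _ nC; have n'Q := rimQ _ n'C.
have nK := contact_sub nC; have n'K := contact_sub n'C.
have QK : {subset Q <= K} by move=> w /inner_component_sub/inner_sub.
by apply: upath_sub (upath_rcons eC (upath_cons nu nQ P) vn' _) _; [mem_simpl|subset_by_mem].
Qed.

Lemma colour_inner_link i j n n' u v k : n \in rim_of i -> n' \in rim_of j -> i != j ->
  e n u -> e v n' -> upath Q u v k -> k %% 3 = 0.
Proof.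
move=> nC n'C ij nu vn' P.
have [ni n'j] := (contact_adj nC, contact_adj n'C).
have nn' := colours_neq ij (offK (contact_sub nC)) ni n'j.
have R := upath_through_inner (colour_contact_rim nC) (colour_contact_rim n'C) nn' nu vn' P.
by have := two_colour_link offK R ni n'j ij; clear; lia.
Qed.

Lemma inner_component_single X Y r : {subset X <= rimK} -> {subset Y <= rimK} ->
  (forall u w, u \in Q -> e u w -> w \in rimK -> w \in X \/ w \in Y) ->
  (exists2 u, u \in Q & adj X u) -> (exists2 u, u \in Q & adj Y u) ->
  (forall n n' u v k, n \in X -> n' \in Y -> e n u -> e v n' -> upath Q u v k -> k %% 3 = r) ->
  unique_nb e Q X -> unique_nb e Q Y -> single Q.
Proof.
move=> XC YC clQ attX attY cst uX uY.
have hubQ (Z : {set T}) : {subset Z <= rimK} -> hubfree e Q Z.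
  by move=> ZC; apply: hubfree_sub inner_component_sub ZC inner_hubfree.
apply: (branch_single crit (X := X) (Y := Y)); [|by split; auto|by split; auto].
split=> //.
- exact: component_connected.
- by move=> w /inner_component_sub/inner_sub/(outer_sub oK).
- by move=> w /inner_component_sub wI /XC wC; apply: rim_inner_disjoint wC wI.
- by move=> w /inner_component_sub wI /YC wC; apply: rim_inner_disjoint wC wI.
- by move=> u w uQ uw wQ; apply: clQ uQ uw (inner_component_closed uQ uw wQ).
apply: mod3_constI => u v k /adjP[n nX un] /adjP[n' n'Y vn'] P; rewrite eC in un.
exact: cst nX n'Y un vn' P.
Qed.

Lemma rim_of_unique_nb i : unique_nb e Q (rim_of i).
Proof.
move=> u x x' /inner_component_sub/inner_sub uK; rewrite !contactE.
move=> /andP[xK xi] /andP[x'K x'i]; exact: same_colour_common_nb offK uK xK x'K xi x'i.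
Qed.

Lemma two_coloured_component_single i j : i != j ->
  (exists2 u, u \in Q & adj (rim_of i) u) -> (exists2 u, u \in Q & adj (rim_of j) u) ->
  (forall u w, u \in Q -> e u w -> w \in rimK -> w \in rim_of i \/ w \in rim_of j) ->
  single Q.
Proof.
move=> ij atti attj clQ.
apply: (@inner_component_single (rim_of i) (rim_of j) 0) => //.
- exact: colour_contact_rim.
- exact: colour_contact_rim.
- by move=> n n' u v k ni n'j nu vn' P; apply: colour_inner_link ni n'j ij nu vn' P.
- exact: rim_of_unique_nb.
exact: rim_of_unique_nb.
Qed.

Lemma single_component_link i j n n' : q \in innerK -> i != j -> single Q ->
  n \in rim_of i -> n' \in rim_of j -> e q n -> e q n' ->
  (forall w, e q w -> w \in rimK -> w \in rim_of i \/ w \in rim_of j) ->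
  colour_link K q n n' i j.
Proof.
move=> qI ij singleQ; rewrite !contactE => /andP[nK ni] /andP[n'K n'j] qn qn' clq.
have qK := inner_sub qI; split=> //; first exact: inner_unattached qI.
apply: (deg_eq2 qn qn' (colours_neq ij (offK nK) ni n'j)) => w qw.
have qQ := component_id e qI; have wQ : w \notin Q.
  by apply/negP => /(singleQ _ _ qQ) E; rewrite -E eI in qw.
case: (clq w qw (inner_component_closed qQ qw wQ)); rewrite contactE => /andP[wK wc].
  by left; apply: same_colour_common_nb offK qK wK nK wc ni qw qn.
by right; apply: same_colour_common_nb offK qK wK n'K wc n'j qw qn'.
Qed.

Lemma three_colours_two_at_once i j l : i != j -> j != l -> i != l ->
  (forall k, k < 3 -> [\/ k = i, k = j | k = l]) ->
  (exists2 u, u \in Q & adj (rim_of i) u) -> (exists2 u, u \in Q & adj (rim_of j) u) ->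
  (exists2 u, u \in Q & adj (rim_of l) u) ->
  exists z, [/\ z \in Q, adj (rim_of j) z & adj (rim_of l) z].
Proof.
move=> ij jl il ijl atti attj attl.
case: (boolP [exists z in Q, adj (rim_of j) z && adj (rim_of l) z]).
  by case/existsP => z /and3P[]; exists z.
move=> none; have {}none z : z \in Q -> adj (rim_of j) z -> adj (rim_of l) z -> False.
  by move=> zQ zj zl; case/existsP: none; exists z; rewrite zQ zj.
suff singleQ : single Q.
  case: attj attl => u uQ uj [u' u'Q u'l].
  by case: (none u uQ uj); rewrite (singleQ u u').
apply: (@inner_component_single (rim_of i) (rim_of j :|: rim_of l) 0) => //.
- exact: colour_contact_rim.
- by move=> w /setUP[]; apply: colour_contact_rim.
- move=> u w uQ uw; rewrite rimE => /andP[wK /attachedP[k k3 wk]]; rewrite in_setU.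
  by case: (ijl k k3) => E; subst k; [left|right|right]; rewrite !contactE wK wk ?orbT.
- by case: attj => u uQ uj; exists u => //; apply: adjS uj => w wj; rewrite in_setU wj.
- move=> n n' u v k ni /setUP[n'j|n'l] nu vn' P; first exact: colour_inner_link ni n'j ij nu vn' P.
  exact: colour_inner_link ni n'l il nu vn' P.
- exact: rim_of_unique_nb.
move=> u x x' uQ /setUP[xj|xl] /setUP[x'j|x'l] ux ux'.
- exact: (rim_of_unique_nb uQ xj x'j).
- by case: (none u uQ); apply/adjP; [exists x|exists x'].
- by case: (none u uQ); apply/adjP; [exists x'|exists x].
exact: (rim_of_unique_nb uQ xl x'l).
Qed.

Lemma three_colours_at_once i j l : i != j -> j != l -> i != l ->
  (forall k, k < 3 -> [\/ k = i, k = j | k = l]) ->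
  (exists2 u, u \in Q & adj (rim_of i) u) -> (exists2 u, u \in Q & adj (rim_of j) u) ->
  (exists2 u, u \in Q & adj (rim_of l) u) ->
  exists z, [/\ z \in Q, adj (rim_of i) z, adj (rim_of j) z & adj (rim_of l) z].
Proof.
move=> ij jl il ijl atti attj attl; have ji : j != i by rewrite eq_sym.
have jil k : k < 3 -> [\/ k = j, k = i | k = l].
  by case/ijl; [constructor 2|constructor 1|constructor 3].
have [z1 [z1Q z1j z1l]] := three_colours_two_at_once ij jl il ijl atti attj attl.
have [z2 [z2Q z2i z2l]] := three_colours_two_at_once ji il jl jil attj atti attl.
case: (eqVneq z1 z2) => [E|z12]; first by subst z2; exists z1.
case/adjP: z1j => nj njC z1nj; case/adjP: z1l => nl nlC z1nl.
case/adjP: z2i => ni niC z2ni; case/adjP: z2l => nl' nl'C z2nl'.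
have [k P] := component_connected eC z1Q z2Q.
rewrite eC in z1nj; rewrite eC in z1nl.
have k0 := colour_inner_link njC niC ji z1nj z2ni P.
have sees_of a n : n \in rim_of a -> sees a n by apply: contact_adj.
case: (eqVneq nl nl') => [E|nll]; last first.
  have R := upath_through_inner (colour_contact_rim nlC) (colour_contact_rim nl'C) nll z1nl z2nl' P.
  case: (same_colour_link offK R (sees_of _ _ nlC) (sees_of _ _ nl'C) nll).
  by move: k0; clear; lia.
subst nl'; rewrite eC in z2nl'.
have zK z : z \in Q -> z \in K by move/inner_component_sub/inner_sub.
have zC z : z \in Q -> ~~ attached z by move/inner_component_sub/inner_unattached.
have z1K := zK _ z1Q; have z2K := zK _ z2Q.
have njK := contact_sub njC; have niK := contact_sub niC; have nlK := contact_sub nlC.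
have nj_neq z (zQ : z \in Q) := attached_neq (sees_attached (sees_of _ _ njC)) (zC z zQ).
have ni_neq z (zQ : z \in Q) := attached_neq (sees_attached (sees_of _ _ niC)) (zC z zQ).
have nl_neq z (zQ : z \in Q) := attached_neq (sees_attached (sees_of _ _ nlC)) (zC z zQ).
have njz1 := nj_neq _ z1Q; have njz2 := nj_neq _ z2Q; have niz1 := ni_neq _ z1Q.
have niz2 := ni_neq _ z2Q; have nlz1 := nl_neq _ z1Q; have nlz2 := nl_neq _ z2Q.
have nji := colours_neq ji (offK njK) (sees_of _ _ njC) (sees_of _ _ niC).
have njl := colours_neq jl (offK njK) (sees_of _ _ njC) (sees_of _ _ nlC).
have nil := colours_neq il (offK niK) (sees_of _ _ niC) (sees_of _ _ nlC).
have P4 : upath K nj ni 4.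
  have z1nl' : e z1 nl by rewrite eC.
  apply: upath_sub (upath4 z1nj z1nl' z2nl' z2ni _) _; last by subset_by_mem.
  by rewrite /= !inE; neq_simpl.
by have := two_colour_link offK P4 (sees_of _ _ njC) (sees_of _ _ niC) ji.
Qed.

End InnerComponent.

Section ColourLink.
Variables (v n n' : T) (i j : nat).
Hypothesis lk : colour_link K v n n' i j.
Let ij : i != j := cl_neq lk.
Let vK : v \in K := cl_mid lk.
Let vC : ~~ attached v := cl_unattached lk.
Let vn : e v n := cl_edge lk.
Let vn' : e v n' := cl_edge' lk.
Let nK : n \in K := cl_end lk.
Let n'K : n' \in K := cl_end' lk.
Let ni : sees i n := cl_sees lk.
Let n'j : sees j n' := cl_sees' lk.
Let nC : attached n := sees_attached ni.
Let n'C : attached n' := sees_attached n'j.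
Let nn' : n != n' := colours_neq ij (offK nK) ni n'j.
Let nv : n != v := attached_neq nC vC.
Let n'v : n' != v := attached_neq n'C vC.

Lemma link_nb w : e v w -> w = n \/ w = n'.
Proof. exact: deg2_adj (cl_deg lk) vn vn' nn'. Qed.

Lemma link_inner_component q : q \in innerK -> v \in component innerK q -> q = v.
Proof.
move=> qI /(component_sym eC qI) qv; apply/set1P; move: q qv {qI}.
apply: (component_eq_closed eC) => [|w /set1P->|y w /set1P-> wI vw]; first by rewrite inE.
  by rewrite innerE vK.
by case: (link_nb vw) wI => ->; rewrite innerE ?nC ?n'C andbF.
Qed.

Lemma link_colours t : t \in rimK -> t \in rim_of i \/ t \in rim_of j.
Proof.
rewrite rimE !contactE => /andP[tK tC]; rewrite tK.
case/attachedP: (tC) => l _ tl.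
case: (eqVneq l i) => [<-|li]; first by left.
case: (eqVneq l j) => [<-|lj]; first by right.
pose A : {set T} := [set n; v; n'].
have nv_ : e n v by rewrite eC.
case: (connected_exit_via (A := A) (P := [set n; n']) eC connK _ nK tK).
- by rewrite !inE eqxx.
- move=> a aA _ an; have -> : a = v.
    by move: aA an; rewrite !inE; case: (a == n); case: (a == n'); rewrite ?orbT //= orbF => /eqP.
  split; first by rewrite eq_sym (attached_neq tC vC).
  by move=> w _ /link_nb[->|->]; rewrite !inE eqxx ?orbT.
have AK : {subset A <= K} by subset_by_mem.
move=> a [m [aE _ R]]; rewrite eq_sym in li; rewrite eq_sym in lj.
case: (upath_both_ends eC AK (upath2 eI nv_ vn' nn') aE R) => -[R1 R2].
  have := two_colour_link offK R1 ni tl li; have := two_colour_link offK R2 n'j tl lj.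
  by clear; lia.
have := two_colour_link offK R2 ni tl li; have := two_colour_link offK R1 n'j tl lj.
by clear; lia.
Qed.

Lemma next_rim_vertex m : m \in component (K :\ n) v -> sees i m ->
  exists b q1 q2, [/\ b \in rimK, b != n' & b != n] /\
    [/\ q1 \in innerK, q1 != v, q2 \in component innerK q1, e n' q1 & e b q2].
Proof.
set Z := component _ _ => mZ mi.
have ZK : {subset Z <= K} by apply: componentD_sub.
have nZ : n \notin Z by apply: componentD1_notin.
have mK := ZK _ mZ; have mC := sees_attached mi.
have vZ : v \in Z by apply: component_id; rewrite !inE vK eq_sym nv.
have mn' : m != n' := colours_neq ij (offK mK) mi n'j.
have vA : v \in [set v; n'] by rewrite !inE eqxx.
case: (connected_exit_via (P := [set n']) eC (component_connected eC (x := v)) vA vZ mZ).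
  move=> a aA _ an; have -> : a = v by move: aA an; rewrite !inE => /orP[/eqP//|->].
  split; first by rewrite eq_sym (attached_neq mC vC).
  by move=> w wZ /link_nb[E|->]; [rewrite E (negbTE nZ) in wZ|rewrite !inE eqxx orbT].
move=> _ [k [/set1P-> _ P]].
have mB : m \in rimK :\ n' by rewrite in_setD1 mn' rimE mK.
case: (upath_first_hit P mB) => b [k' [bB bL R]].
move: (bB); rewrite in_setD1 => /andP[bn' bC].
have bn : b != n by apply: contraTneq bL => ->; rewrite !inE (negbTE nZ) (negbTE nn') andbF.
have n'C' : n' \in rimK by rewrite rimE n'K.
have n'b : n' != b by rewrite eq_sym.
case: (upath_inner_ends R _ n'b n'C' bC) => [w|q1 [q2 [q1I q2Q n'q1 bq2 q1L]]].
  rewrite !in_setU1 in_setD in_setD1 in_setU1 in_setD.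
  case: (eqVneq w b) => [->|wb]; first by rewrite !orbT.
  case: (eqVneq w n') => [->|wn'] //=.
  by move=> /and3P[wC _ /ZK wK]; rewrite innerE wK; move: wC; rewrite rimE wK.
exists b, q1, q2; split=> //; split=> //; apply: contraTneq q1L => ->.
have bv := attached_neq (contact_adj bC) vC.
by rewrite !in_setU1 in_setD in_setU1 in_setD; mem_simpl.
Qed.

Section Gate.
Variables (b q1 q2 : T).
Hypotheses (bC : b \in rimK) (bn' : b != n').
Hypotheses (q1I : q1 \in innerK) (q1v : q1 != v) (q2Q : q2 \in component innerK q1).
Hypotheses (n'q1 : e n' q1) (bq2 : e b q2).
Local Notation Q := (component innerK q1).
Let bK : b \in K := contact_sub bC.
Let q1Q : q1 \in Q := component_id e q1I.

Let q1n' : e q1 n'.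
Proof. by rewrite eC. Qed.

Let n'_adj : adj (rim_of j) q1.
Proof. by apply/adjP; exists n'; rewrite // contactE n'K. Qed.

Lemma gate_upath_mod3 n2 u w r : n2 \in rim_of j -> n2 != n' -> e n' u -> e w n2 ->
  upath Q u w r -> r %% 3 = 1.
Proof.
move=> n2C n2n' n'u wn2 P; have n2j := contact_adj n2C; have n2K := contact_sub n2C.
have QI : {subset Q <= innerK} by apply: component_sub.
have QK : {subset Q <= K} by move=> t /QI/inner_sub.
have attachedQ t : attached t -> t \notin Q.
  by move=> tC; apply/negP => /QI/inner_unattached; rewrite tC.
have n'Q := attachedQ _ n'C; have nQ := attachedQ _ nC.
have n2Q := attachedQ _ (sees_attached n2j).
have vQ : v \notin Q by apply: contra q1v => vQ; rewrite (link_inner_component q1I vQ).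
have nn2 := colours_neq ij (offK nK) ni n2j; have n2v := attached_neq (sees_attached n2j) vC.
have nv_ : e n v by rewrite eC.
have R1 := upath_rcons eC (upath_cons n'u n'Q P) wn2.
have R2 := fun n2L => upath_cons vn' _ (R1 n2L).
have R3 := fun n2L vL => upath_cons nv_ _ (R2 n2L vL).
have R : upath K n n2 r.+4.
  by apply: upath_sub (R3 _ _ _) _; [mem_simpl|mem_simpl|mem_simpl|subset_by_mem].
by have := two_colour_link offK R ni n2j ij; clear; lia.
Qed.

Lemma gate_same_colour_contra : sees j b -> False.
Proof.
move=> bj; suff singleQ : single Q.
  have q1b : e q1 b by rewrite eC (singleQ _ _ q1Q q2Q).
  case/eqP: bn'; exact: same_colour_common_nb offK (inner_sub q1I) bK n'K bj n'j q1b q1n'.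
have bj' : b \in rim_of j by rewrite contactE bK.
case: (boolP [exists u in Q, adj (rim_of i) u]) => [/existsP[u /andP[uQ ui]]|no_i].
  apply: (two_coloured_component_single ij); [by exists u|by exists q1|].
  by move=> u' w _ _; apply: link_colours.
apply: (@inner_component_single q1 [set n'] (rim_of j :\ n') 1).
- by move=> w /set1P->; rewrite rimE n'K.
- by move=> w /setD1P[_ /colour_contact_rim].
- move=> u w uQ uw /link_colours[wi|wj]; last by rewrite !inE wj; case: eqP; [left|right].
  by case/existsP: no_i; exists u; rewrite uQ; apply/adjP; exists w.
- by exists q1; rewrite // adj1.
- by exists q2 => //; apply/adjP; exists b; [rewrite in_setD1 bn'|rewrite eC].
- move=> _ n2 u w r /set1P-> /setD1P[n2n' n2C] n'u wn2 P; exact: gate_upath_mod3 n2C n2n' n'u wn2 P.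
- exact: tame_unique (tame1 e Q n').
by move=> u x x' uQ /setD1P[_ xj] /setD1P[_ x'j]; apply: rim_of_unique_nb uQ xj x'j.
Qed.

Lemma gate_colour_link : sees i b -> colour_link K q1 b n' i j.
Proof.
move=> bi; have bi' : b \in rim_of i by rewrite contactE bK.
have singleQ : single Q.
  apply: (two_coloured_component_single ij).
  - by exists q2 => //; apply/adjP; exists b; rewrite // eC.
  - by exists q1.
  by move=> u w _ _; apply: link_colours.
have q1b : e q1 b by rewrite eC (singleQ _ _ q1Q q2Q).
have n'C' : n' \in rim_of j by rewrite contactE n'K.
by apply: single_component_link q1I ij singleQ bi' n'C' q1b q1n' _ => w _; apply: link_colours.
Qed.

End Gate.

Lemma next_colour_link m : m \in component (K :\ n) v -> sees i m ->
  exists v' m', [/\ colour_link K v' m' n' i j, m' != n & v' != v].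
Proof.
move=> mZ mi; case: (next_rim_vertex mZ mi).
move=> b [q1 [q2 [[bC bn' bn] [q1I q1v q2Q n'q1 bq2]]]].
exists q1, b; split=> //; apply: (gate_colour_link bC q1I q2Q n'q1 bq2).
case: (link_colours bC) => [/contact_adj//|/contact_adj bj].
by case: (gate_same_colour_contra bC bn' q1I q1v q2Q n'q1 bq2 bj).
Qed.

Lemma link_dead_side : (forall m, m \in component (K :\ n) v -> ~~ sees i m) ->
  component (K :\ n) v = [set n'; v] /\ doubly_sees j n'.
Proof.
move=> no_i.
have vZ : v \in component (K :\ n) v by apply: component_id; rewrite !inE vK eq_sym nv.
have n'Z : n' \in component (K :\ n) v.
  by apply: component_closed vZ _ vn'; rewrite !inE n'K eq_sym nn'.
have ZK : {subset component (K :\ n) v <= K} by apply: componentD_sub.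
have BZ : branch (component (K :\ n) v) (colour_class j) [set n].
  apply: (component_branch crit (outer_branch n'K n'j) nK vK); [|by exists n'|by exists v].
  move=> t tZ; apply/negP => /adjP[x]; rewrite inE => /andP[xs xj] tx.
  have tK := ZK _ tZ; have tC : t \in rimK by rewrite rimE tK (attachedI xs tx).
  case: (link_colours tC) => /contact_adj tc; first by move: (no_i t tZ); rewrite tc.
  by rewrite (sees_inj (offK tK) (sees_colour xs tx) tc) eqxx in xj.
have vj : ~~ sees j v by apply: contra vC; apply: sees_attached.
case: (dead_end_pair BZ (off_sub offK ZK) vZ vj) => t [ZE tj _ _ _].
by move: n'Z; rewrite ZE !inE (negbTE n'v) orbF => /eqP->.
Qed.

End ColourLink.

Lemma parallel_links_doubly v1 n1 v2 n2 n' i j :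
  colour_link K v1 n1 n' i j -> colour_link K v2 n2 n' i j -> n2 != n1 -> v2 != v1 ->
  doubly_sees i n1.
Proof.
move=> l1 l2 n21 v21; have l1' := colour_link_sym l1.
case: (link_dead_side l1') => // t tZ; apply/negP => tj.
case: (next_colour_link l1' tZ tj) => v3 [b [l3 bn' v31]].
case: l1 => ij v1K v1C _ v1n1 v1n' n1K n'K n1i n'j {l1' tZ tj}.
case: l2 => _ v2K v2C d2 v2n2 v2n' n2K _ n2i _.
case: l3 => _ v3K v3C _ v3b v3n1 bK _ bj _.
have n1C := sees_attached n1i; have n2C := sees_attached n2i.
have bC := sees_attached bj; have n'C := sees_attached n'j.
have n1n' := colours_neq ij (offK n1K) n1i n'j; have n2n' := colours_neq ij (offK n2K) n2i n'j.
have n1b := colours_neq ij (offK n1K) n1i bj; have n2b := colours_neq ij (offK n2K) n2i bj.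
have n1v1 := attached_neq n1C v1C; have n1v2 := attached_neq n1C v2C.
have n1v3 := attached_neq n1C v3C; have n2v1 := attached_neq n2C v1C.
have n2v2 := attached_neq n2C v2C; have n2v3 := attached_neq n2C v3C.
have bv1 := attached_neq bC v1C; have bv2 := attached_neq bC v2C.
have bv3 := attached_neq bC v3C; have n'v1 := attached_neq n'C v1C.
have n'v2 := attached_neq n'C v2C; have n'v3 := attached_neq n'C v3C.
have v32 : v3 != v2.
  apply/eqP => E; subst v3.
  by case: (deg2_adj d2 v2n2 v2n' n2n' v3n1) => E; [move: n21|move: n1n']; rewrite E eqxx.
have P : upath K n2 b 6.
  exists [:: v2; n'; v1; n1; v3; b]; split=> //=.
  - by rewrite ![e _ v2]eC ![e _ v1]eC ![e _ v3]eC v2n2 v2n' v1n' v1n1 v3n1 v3b.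
  - by rewrite !inE; neq_simpl.
  by subset_by_mem.
by have := two_colour_link offK P n2i bj ij.
Qed.

Lemma link_side_contra v n n' i j m : colour_link K v n n' i j ->
  m \in component (K :\ n) v -> sees i m -> False.
Proof.
move=> lk mZ mi; have [v' [m' [lk' m'n v'v]]] := next_colour_link lk mZ mi.
have dn : doubly_sees i n by apply: parallel_links_doubly lk lk' m'n v'v.
have dm' : doubly_sees i m'.
  by apply: (parallel_links_doubly lk' lk); rewrite eq_sym.
case: lk => ij vK vC _ vn vn' nK n'K ni n'j; case: lk' => _ v'K v'C _ v'm' v'n' m'K _ m'i _.
have n'v' : e n' v' by rewrite eC.
have nv : e n v by rewrite eC.
apply: (@doubly_sees_path4_contra i n v n' v' m') => //.
  by move=> t; rewrite !inE => tA; apply: offK; mem_split.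
have nC := sees_attached ni; have m'C := sees_attached m'i; have n'C := sees_attached n'j.
have nn' := colours_neq ij (offK nK) ni n'j; have m'n' := colours_neq ij (offK m'K) m'i n'j.
have n_v := attached_neq nC vC; have n_v' := attached_neq nC v'C.
have m'_v := attached_neq m'C vC; have m'_v' := attached_neq m'C v'C.
have n'_v := attached_neq n'C vC; have n'_v' := attached_neq n'C v'C.
by rewrite /= !inE; neq_simpl.
Qed.

Lemma link_side v n n' i j : colour_link K v n n' i j ->
  component (K :\ n) v = [set n'; v] /\ doubly_sees j n'.
Proof.
by move=> lk; apply: (link_dead_side lk) => m mZ; apply/negP; apply: link_side_contra lk mZ.
Qed.

Lemma link_shape v n n' i j : colour_link K v n n' i j ->
  [/\ K = [set n; v; n'], doubly_sees i n & doubly_sees j n'].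
Proof.
move=> lk; have [Z1 dn'] := link_side lk; have [Z2 dn] := link_side (colour_link_sym lk).
case: (lk) => ij vK vC _ vn vn' nK n'K ni n'j.
have rim_n : n \in rimK by rewrite rimE nK (sees_attached ni).
have rim_n' : n' \in rimK by rewrite rimE n'K (sees_attached n'j).
have side a b w : component (K :\ a) v = [set b; v] -> w \in K -> e b w -> w != a -> w = v.
  move=> Z wK bw wa; have bZ : b \in component (K :\ a) v by rewrite Z !inE eqxx.
  have: w \in component (K :\ a) v by apply: component_closed bZ _ bw; rewrite !inE wa.
  by rewrite Z !inE eq_sym (negbTE (edge_neq eI bw)) => /eqP.
split=> //; apply/esym; apply: (connected_closed eC (z := n) connK); first by rewrite !inE eqxx.
  by subset_by_mem.
move=> y w; rewrite !inE -orbA => /or3P[]/eqP-> wK yw.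
- case: (eqVneq w n') => [E|wn']; first by subst w; case: (rim_independent rim_n rim_n' yw).
  by rewrite (side n' n w Z2) ?eqxx ?orbT.
- by case: (link_nb lk yw) => ->; rewrite eqxx ?orbT.
case: (eqVneq w n) => //= wn.
by rewrite (side n n' w Z1) ?eqxx ?orbT.
Qed.

Lemma inner_component_two_colours : exists q i j,
  [/\ q \in innerK, i != j, i < 3, j < 3 &
    (exists2 u, u \in component innerK q & adj (rim_of i) u) /\
    (exists2 u, u \in component innerK q & adj (rim_of j) u)].
Proof.
case: polyK => i [l [a0 [b0 [il a0K b0K a0i b0l]]]].
have aI : a0 \in rim_of i by rewrite contactE a0K.
case: (connected_exit eC connK aI a0K b0K) => a [k [{}aI aK P]].
have bA : b0 \in rimK :\: rim_of i.
  rewrite in_setD rimE contactE b0K (sees_attached b0l) /= andbT; apply/negP => b0i.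
  by case/eqP: il; apply: sees_inj (offK b0K) b0i b0l.
case: (upath_first_hit P bA) => b [k' [bA' _ R]].
move: bA'; rewrite in_setD => /andP[bi bC].
have ab : a != b by apply: contraNneq bi => <-.
case: (upath_inner_ends R _ ab (colour_contact_rim aI) bC) => [w|q1 [q2 [q1I q2Q aq1 bq2 _]]].
  rewrite !in_setU1 in_setD in_setD in_setU1 in_setD.
  case: (eqVneq w a) => [->|wa] //=; case: (eqVneq w b) => [->|wb] //=.
  by case/and3P => wA wi wK; rewrite in_setD wK andbT; apply: contra wA => wC; rewrite wi.
move: (bC); rewrite rimE => /andP[bK /attachedP[j j3 bj]].
have ij : i != j by apply: contraNneq bi => ->; rewrite contactE bK.
exists q1, i, j; split=> //; first exact: sees_lt3 a0i.
split; first by exists q1; [apply: component_id|apply/adjP; exists a; rewrite // eC].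
by exists q2 => //; apply/adjP; exists b; [rewrite contactE bK|rewrite eC].
Qed.

Lemma polychromatic_link_or_tripod :
  (exists v n n' i j, colour_link K v n n' i j) \/ (exists z leaf, tripod K z leaf).
Proof.
case: inner_component_two_colours => q [i [j [qI ij i3 j3 [[u uQ ui] [u' u'Q u'j]]]]].
have [l [l3 il jl ijl]] := third_colour i3 j3 ij.
case: (boolP [exists u in component innerK q, adj (rim_of l) u]) => [/existsP[w /andP[wQ wl]]|no_l].
  right; have [z [zQ zi zj zl]] := three_colours_at_once ij jl il ijl
    (ex_intro2 _ _ u uQ ui) (ex_intro2 _ _ u' u'Q u'j) (ex_intro2 _ _ w wQ wl).
  have zI := inner_component_sub zQ; exists z.
  have leafP k : k < 3 -> [exists n, (n \in rim_of k) && e z n].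
    by case/ijl => ->; [case/adjP: zi|case/adjP: zj|case/adjP: zl] => n nC zn;
      apply/existsP; exists n; rewrite nC.
  exists (fun k => odflt z [pick n | (n \in rim_of k) && e z n]).
  have pick_leaf k : k < 3 -> let n := odflt z [pick n | (n \in rim_of k) && e z n] in
      n \in rim_of k /\ e z n.
    by move=> /leafP/existsP[n kn]; case: pickP => [n' /andP[]|/(_ n)] //=; rewrite kn.
  split=> [||k /pick_leaf[/contact_sub]|k /pick_leaf[/contact_adj]|k /pick_leaf[]] //.
    exact: inner_sub zI.
  exact: inner_unattached zI.
left; have clQ w t : w \in component innerK q -> e w t -> t \in rimK ->
    t \in rim_of i \/ t \in rim_of j.
  rewrite rimE => wQ wt /andP[tK /attachedP[k k3 tk]]; rewrite !contactE tK.
  case: (ijl k k3) => E; subst k; [by left|by right|].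
  by case/existsP: no_l; exists w; rewrite wQ; apply/adjP; exists t; rewrite // contactE tK.
have singleQ : single (component innerK q).
  by apply: (two_coloured_component_single ij _ _ clQ); [exists u|exists u'].
have qQ := component_id e qI.
rewrite (singleQ _ _ uQ qQ) in ui; rewrite (singleQ _ _ u'Q qQ) in u'j.
case/adjP: ui => n nC qn; case/adjP: u'j => n' n'C qn'; exists q, n, n', i, j.
by apply: single_component_link qI ij singleQ nC n'C qn qn' _ => w; apply: clQ.
Qed.

Section TripodShape.
Variables (z : T) (leaf : nat -> T).
Hypothesis tp : tripod K z leaf.
Local Notation U := (leaves leaf).
Local Notation D := (z |: leaves leaf).

Lemma leaf_neq j k : j < 3 -> k < 3 -> j != k -> leaf j != leaf k.
Proof.
move=> j3 k3 jk.
exact: colours_neq jk (offK (tp_leaf tp j3)) (tp_sees tp j3) (tp_sees tp k3).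
Qed.

Lemma leaf_center_neq j : j < 3 -> leaf j != z.
Proof.
by move=> j3; apply: attached_neq (tp_unattached tp); apply: sees_attached (tp_sees tp j3).
Qed.

Lemma leaf_rim j : j < 3 -> leaf j \in rimK.
Proof. by move=> j3; rewrite rimE (tp_leaf tp j3) (sees_attached (tp_sees tp j3)). Qed.

Lemma leaf_center j : j < 3 -> e (leaf j) z.
Proof. by move=> j3; rewrite eC; apply: (tp_edge tp). Qed.

Lemma tripod_sub : {subset D <= K}.
Proof.
move=> w; rewrite in_setU1 => /orP[/eqP->|/leavesP[k k3 ->]]; first exact: tp_center tp.
exact: (tp_leaf tp).
Qed.

Section Outside.
Variables (y g : T).
Hypotheses (gK : g \in K) (gD : g \notin D) (yD : y \in D) (yg : e y g).
Local Notation M := (component (K :\: D) g).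

Let gM : g \in M.
Proof. by apply: component_id; rewrite in_setD gD. Qed.

Let MK : {subset M <= K}.
Proof. exact: componentD_sub. Qed.

Let zM : z \notin M.
Proof. by apply/negP => /componentD_notin; rewrite !inE eqxx. Qed.

Let leafM k : k < 3 -> leaf k \notin M.
Proof.
move=> k3; apply/negP => /componentD_notin; rewrite in_setU1 negb_or => /andP[_ /negP].
by apply; apply/leavesP; exists k.
Qed.

Let M_closed a w : a \in M -> e a w -> w \notin M -> w \in D \/ w \in s.
Proof.
move=> aM aw wM; case: (boolP (w \in K)) => wK; last first.
  by right; exact: (outer_closed oK (MK aM) aw wK).
left; apply: contraR wM => wD; apply: component_closed aM _ aw.
by rewrite in_setD wD.
Qed.

Lemma upath_leaf_center t m k j : j < 3 -> e z t -> upath M t m k -> upath K (leaf j) m k.+2.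
Proof.
move=> j3 zt P; have ljM := leafM j3; have ljz := leaf_center_neq j3.
have zK := tp_center tp; have ljK := tp_leaf tp j3.
have zP := upath_cons zt zM P.
by apply: upath_sub (upath_cons (leaf_center j3) _ zP) _; [mem_simpl|subset_by_mem].
Qed.

Lemma upath_through_center t m k j l : j < 3 -> l < 3 -> l != j -> e (leaf j) t -> upath M t m k ->
  upath K (leaf j) m k.+1 /\ upath K (leaf l) m k.+3.
Proof.
move=> j3 l3 lj jt P; have zK := tp_center tp.
have jK := tp_leaf tp j3; have lK := tp_leaf tp l3.
have jz := leaf_center_neq j3; have lz := leaf_center_neq l3; have jl := leaf_neq l3 j3 lj.
have jM := leafM j3; have lM := leafM l3.
have P1 := upath_cons jt jM P; split; first by apply: upath_sub P1 _; subset_by_mem.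
have P2 := fun zL => upath_cons (tp_edge tp j3) zL P1.
have P3 := fun zL lL => upath_cons (leaf_center l3) lL (P2 zL).
by apply: upath_sub (P3 _ _) _; [mem_simpl|mem_simpl|subset_by_mem].
Qed.

Lemma gate_of_seeing t d m a : t \in M -> d \in D -> e d t -> m \in M -> sees a m -> d = leaf a.
Proof.
move=> tM dD dt mM ma; have a3 := sees_lt3 ma.
have [k P] := component_connected eC tM mM.
have a1 : (a + 1) %% 3 < 3 by rewrite ltn_pmod.
have a_a1 : (a + 1) %% 3 != a by move: a3; clear; lia.
move: dD; rewrite in_setU1 => /orP[/eqP dz|/leavesP[j j3 dj]]; subst d.
  have am : leaf a != m by apply: contraTneq mM => <-; apply: leafM.
  case: (same_colour_link offK (upath_leaf_center a3 dt P) (tp_sees tp a3) ma am).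
  exact: two_colour_link offK (upath_leaf_center a1 dt P) (tp_sees tp a1) ma a_a1.
case: (eqVneq j a) => [->//|ja].
have [l [l3 jl al _]] := third_colour j3 a3 ja; rewrite eq_sym in jl; rewrite eq_sym in al.
have [P1 P3] := upath_through_center j3 l3 jl dt P.
have := two_colour_link offK P1 (tp_sees tp j3) ma ja.
by have := two_colour_link offK P3 (tp_sees tp l3) ma al; clear; lia.
Qed.

Lemma outside_unattached m : m \in M -> ~~ attached m.
Proof.
move=> mM; apply/negP => /attachedP[a a3 ma].
have ya := gate_of_seeing gM yD yg mM ma.
have colour_a m' b : m' \in M -> sees b m' -> b = a.
  move=> m'M m'b; apply/eqP; apply: contraT => ba.
  have := leaf_neq (sees_lt3 m'b) a3 ba.
  by rewrite -(gate_of_seeing gM yD yg m'M m'b) ya eqxx.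
have a1 : (a + 1) %% 3 < 3 by rewrite ltn_pmod.
have a_a1 : (a + 1) %% 3 != a by move: a3; clear; lia.
have leafC := leaf_rim a3.
have B : branch M (colour_class a) [set leaf a].
  split.
  - exact: component_connected.
  - by move=> w /MK /(outer_sub oK).
  - by move=> w /MK /offK ws /colour_class_in; rewrite (negbTE ws).
  - by move=> w wM /set1P E; move: (leafM a3); rewrite -E wM.
  - move=> b w bM bw /(M_closed bM bw)[wD|ws].
      by right; rewrite inE; rewrite eC in bw; rewrite (gate_of_seeing bM wD bw mM ma).
    by left; rewrite inE ws (colour_a b (colour w) bM (sees_colour ws bw)) /=.
  - by exists m.
  - by exists g; rewrite // adj1 eC -ya.
  apply: (mod3_constI (r := 2)) => u v k ua; rewrite adj1 eC => av /(upath_rev eC) P.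
  have [_ P3] := upath_through_center a3 a1 a_a1 av P.
  by have := two_colour_link offK P3 (tp_sees tp a1) ua a_a1; clear; lia.
have gC : ~~ sees a g.
  have ag : e (leaf a) g by rewrite -ya.
  apply/negP => ga; apply: (rim_independent leafC _ ag).
  by rewrite rimE gK (sees_attached ga).
case: (dead_end_pair B (off_sub offK MK) gM gC) => n [ME na ng gl _].
have nM : n \in M by rewrite ME !inE eqxx.
rewrite eC in ng; have := leafM a3.
by rewrite -(same_colour_common_nb offK gK (MK nM) (contact_sub leafC)
               (doubly_sees_sees na) (tp_sees tp a3) ng gl) nM.
Qed.

Let M_inner : {subset M <= innerK}.
Proof. by move=> w wM; rewrite innerE (MK wM) outside_unattached. Qed.

Let M_closed_tripod a w : a \in M -> e a w -> w \notin M -> w \in D.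
Proof.
move=> aM aw wM; case: (M_closed aM aw wM) => // ws.
by case/negP: (outside_unattached aM); apply: attachedI aw.
Qed.

Lemma second_gate d : d \in D -> exists t d', [/\ t \in M, d' \in D, e t d' & d' != d].
Proof.
move=> dD; have dM : d \notin M by apply/negP => /componentD_notin; rewrite dD.
case: (boolP [exists t in M, exists d' in D, e t d' && (d' != d)]) => [|none].
  by case/existsP => t /andP[tM /existsP[d' /and3P[? ? ?]]]; exists t, d'.
have /adjP[x /colour_classP[xs _] leafx] := tp_sees tp (ltn0Sn 2).
have : x \in d |: M.
  apply: (crit_no_cut crit gM _ dM _ (cyc_supp xs)) => [w /MK/(outer_sub oK)//|a w aM aw wM].
  apply/eqP; apply: contraNT none => wd; apply/existsP; exists a; rewrite aM.
  by apply/existsP; exists w; rewrite (M_closed_tripod aM aw wM) aw.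
rewrite in_setU1 => /orP[/eqP xd|/MK/offK]; last by rewrite xs.
by move: (offK (tripod_sub dD)); rewrite -xd xs.
Qed.

Lemma leaves_tame : tame M U.
Proof.
split; last first.
  by apply: hubfree_sub M_inner _ inner_hubfree => w /leavesP[k k3 ->]; apply: leaf_rim.
move=> w x x' wM /leavesP[k k3 ->] /leavesP[l l3 ->] wk wl; case: (eqVneq k l) => [->//|kl].
rewrite eC in wk; have zw : z != w by apply: contraTneq wM => <-; apply: zM.
by case: (cycle4F (tp_edge tp k3) wk wl (leaf_center l3) zw (leaf_neq k3 l3 kl)).
Qed.

Lemma outside_branch (X Y : {set T}) d d' t t' : {subset X <= D} -> {subset Y <= D} ->
  (forall a w, a \in M -> e a w -> w \notin M -> w \in X \/ w \in Y) ->
  t \in M -> d \in X -> e t d -> t' \in M -> d' \in Y -> e t' d' ->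
  mod3_const e M X Y -> branch M X Y.
Proof.
move=> XD YD cl tM dX td t'M d'Y t'd' cst; split=> //.
- exact: component_connected.
- by move=> w /MK /(outer_sub oK).
- by move=> w /componentD_notin wD /XD; rewrite (negbTE wD).
- by move=> w /componentD_notin wD /YD; rewrite (negbTE wD).
- by exists t => //; apply/adjP; exists d.
by exists t' => //; apply/adjP; exists d'.
Qed.

Lemma center_not_gate t : t \in M -> e t z -> False.
Proof.
move=> tM tz; have zD : z \in D by rewrite setU11.
have [t' [d [t'M dD t'd dz]]] := second_gate zD.
have dU : d \in U by move: dD; rewrite in_setU1 (negbTE dz).
have length2 u v k : adj [set z] u -> adj U v -> upath M u v k -> k %% 3 = 2.
  rewrite adj1 eC => zu /adjP[_ /leavesP[j j3 ->] vj] P.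
  rewrite eC in vj; have j1 : (j + 1) %% 3 < 3 by rewrite ltn_pmod.
  have jj1 : (j + 1) %% 3 != j by move: j3; clear; lia.
  have zK := tp_center tp; have jK := tp_leaf tp j3; have j1K := tp_leaf tp j1.
  have P1 := upath_cons vj (leafM j3) (upath_rev eC P).
  rewrite eC in zu; have P2 := fun zL => upath_rcons eC P1 zu zL.
  have P3 := fun zL lL => upath_rcons eC (P2 zL) (tp_edge tp j1) lL.
  have jz := leaf_center_neq j3; have j1z := leaf_center_neq j1.
  have j1M := leafM j1; have nj := leaf_neq j1 j3 jj1.
  have R : upath K (leaf j) (leaf ((j + 1) %% 3)) k.+3.
    by apply: upath_sub (P3 _ _) _; [mem_simpl|mem_simpl|subset_by_mem].
  rewrite eq_sym in jj1.
  by have := two_colour_link offK R (tp_sees tp j3) (tp_sees tp j1) jj1; clear; lia.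
have B : branch M [set z] U.
  apply: (@outside_branch _ _ z d t t'); rewrite ?set11 //.
  - by move=> w /set1P->.
  - by move=> w wU; rewrite in_setU1 wU orbT.
  - by move=> a w aM aw /(M_closed_tripod aM aw); rewrite in_setU1 in_set1 => /orP.
  exact: mod3_constI length2.
have singleM := branch_single crit B (tame1 e M z) leaves_tame.
rewrite (singleM _ _ t'M tM) in t'd.
have tU : adj U t by apply/adjP; exists d.
have tz' : adj [set z] t by rewrite adj1.
by have := length2 t t 0 tz' tU (upath0 e tM).
Qed.

Lemma outside_contra : False.
Proof.
have notz t d : t \in M -> d \in D -> e t d -> d \in U.
  by move=> tM; rewrite in_setU1 => /orP[/eqP->|//] /(center_not_gate tM).
have gy : e g y by rewrite eC.
have yU := notz _ _ gM yD gy.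
have [t [d [tM dD td dy]]] := second_gate yD; have dU := notz _ _ tM dD td.
case/leavesP: (yU) => a a3 ya.
have length0 u v k : adj [set y] u -> adj (U :\ y) v -> upath M u v k -> k %% 3 = 0.
  rewrite adj1 ya eC => au /adjP[x /setD1P[xa /leavesP[j j3 xj]] vj] P; subst x.
  have ja : a != j by apply: contraNneq xa => ->.
  have jM := leafM j3; have aM := leafM a3; have aK := tp_leaf tp a3; have jK := tp_leaf tp j3.
  have R : upath K (leaf a) (leaf j) k.+2.
    by apply: upath_sub (upath_rcons eC (upath_cons au aM P) vj _) _; [mem_simpl|subset_by_mem].
  by have := two_colour_link offK R (tp_sees tp a3) (tp_sees tp j3) ja; clear; lia.
have tameU : tame M (U :\ y) by apply: tame_sub leaves_tame => // w /setD1P[].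
have B : branch M [set y] (U :\ y).
  apply: (@outside_branch _ _ y d g t); rewrite ?in_setD1 ?dy ?set11 //.
  - by move=> w /set1P->.
  - by move=> w /setD1P[_ wU]; rewrite in_setU1 wU orbT.
  - move=> b w bM bw wM; rewrite in_setD1 in_set1 (notz b w) ?andbT ?(M_closed_tripod bM bw) //.
    by case: eqP; [left|right].
  exact: mod3_constI length0.
have singleM := branch_single crit B (tame1 e M y) tameU.
rewrite (singleM _ _ tM gM) in td.
by rewrite (tame_unique leaves_tame gM dU yU td gy) eqxx in dy.
Qed.

End Outside.

Lemma tripod_shape : K = D.
Proof.
apply/esym; apply: (connected_closed eC (z := z) connK).
- by rewrite setU11.
- exact: tripod_sub.
by move=> y g yD gK yg; apply: contraT => gD; case: (outside_contra gK gD yD yg).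
Qed.

End TripodShape.

End Polychromatic.

Lemma colour_link_shape K v n n' i j : outer K -> colour_link K v n n' i j ->
  [/\ K = [set n; v; n'], doubly_sees i n & doubly_sees j n'].
Proof.
move=> oK lk; apply: (link_shape oK _ lk); exists i, j, n, n'; split.
- exact: cl_neq lk.
- exact: cl_end lk.
- exact: cl_end' lk.
- exact: cl_sees lk.
exact: cl_sees' lk.
Qed.

Lemma tripod_eq K z leaf : outer K -> tripod K z leaf -> K = z |: leaves leaf.
Proof.
move=> oK tp; apply: (tripod_shape oK _ tp); exists 0, 1, (leaf 0), (leaf 1).
by split=> //; [apply: (tp_leaf tp)|apply: (tp_leaf tp)|apply: (tp_sees tp)|apply: (tp_sees tp)].
Qed.

Definition monochromatic i K := forall t, t \in K -> attached t -> sees i t.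

Lemma outer_component u : u \in S -> u \notin s ->
  exists K, outer K /\ u \in K.
Proof.
move=> uS us; exists (component (S :\: [set x in s]) u).
split; last by apply: component_id; rewrite !inE us.
split.
- exact: component_connected.
- exact: componentD_sub.
- by move=> w /componentD_notin; rewrite inE.
move=> a w aC aw wC; apply: contraR wC => ws.
have wS : w \in S by move: aw; rewrite eC; apply: (crit_supp crit).
by apply: component_closed aC _ aw; rewrite !inE ws.
Qed.

Lemma outer_sub_closed K M w : outer K -> w \in K -> w \in M ->
  (forall u t, u \in M -> e u t -> t \notin M -> t \in s) -> {subset K <= M}.
Proof.
move=> oK wK wM clM; suff <- : M :&: K = K by move=> t; rewrite inE => /andP[].
apply: (connected_closed eC (z := w) (outer_connected oK)); first by rewrite inE wM.
  by move=> t; rewrite inE => /andP[].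
move=> y t; rewrite !inE => /andP[yM _] tK yt; rewrite tK andbT.
by apply: contraT => /(clM y t yM yt); rewrite (negbTE (outer_off oK tK)).
Qed.

Lemma outer_eq K K' w : outer K -> outer K' -> w \in K -> w \in K' -> K = K'.
Proof.
move=> oK oK' wK wK'; apply/setP => t; apply/idP/idP.
  exact: outer_sub_closed oK wK wK' (outer_closed oK') t.
exact: outer_sub_closed oK' wK' wK (outer_closed oK) t.
Qed.

Lemma outer_foot_neq K u y : outer K -> u \in K -> y \in s ->
  exists n x, [/\ n \in K, e n x, x \in s & x != y].
Proof.
move=> oK uK ys; case: (boolP [exists n in K, exists x in [set x in s], e n x && (x != y)]).
  case/existsP => n /andP[nK /existsP[x]]; rewrite inE => /and3P[xs nx xy].
  by exists n, x.
move=> none; have yK : y \notin K by apply/negP => /(outer_off oK); rewrite ys.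
have [t ts ty] : exists2 t, t \in s & t != y.
  have l0 : 0 < ell by apply: ltn_trans s3.
  have l1 : 1 < ell by apply: ltn_trans s3.
  case: (eqVneq (c 0) y) => [E|]; last by exists (c 0) => //; apply: cyc_in.
  exists (c 1); first exact: cyc_in.
  by rewrite -E; apply/eqP => /(cyc_inj l1 l0).
have : t \in y |: K.
  apply: (crit_no_cut crit uK (outer_sub oK) yK _ (cyc_supp ts)) => a w aK aw wK.
  apply/eqP; apply: contraNT none => wy.
  apply/existsP; exists a; rewrite aK; apply/existsP; exists w.
  by rewrite inE (outer_closed oK aK aw wK) aw.
by rewrite in_setU1 (negbTE ty) => /(outer_off oK); rewrite ts.
Qed.

Lemma outer_two_feet K u : outer K -> u \in K ->
  exists n n' x x', [/\ n \in K, n' \in K, e n x, e n' x' & x != x'] /\ (x \in s /\ x' \in s).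
Proof.
move=> oK uK; have l0 : 0 < ell by apply: ltn_trans s3.
case: (outer_foot_neq oK uK (cyc_in l0)) => n [x [nK nx xs _]].
case: (outer_foot_neq oK uK xs) => n' [x' [n'K n'x' x's xx']].
by exists n, n', x, x'; split=> //; split=> //; rewrite eq_sym.
Qed.

Lemma outer_cases K u : outer K -> u \in K ->
  [\/ exists2 i, i < 3 & monochromatic i K,
      exists v n n' i j, colour_link K v n n' i j
    | exists z leaf, tripod K z leaf].
Proof.
move=> oK uK; case: (outer_two_feet oK uK) => n [_ [x [_ [[nK _ nx _ _] [xs _]]]]].
have ni := sees_colour xs nx.
case: (boolP [exists t in K, attached t && ~~ sees (colour x) t]) => [|mono].
  case/existsP => t /and3P[tK /attachedP[j _ tj] tx].
  have poly : polychromatic K.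
    by exists (colour x), j, n, t; split=> //; apply: contraNneq tx => ->.
  by case: (polychromatic_link_or_tripod oK poly); [constructor 2|constructor 3].
constructor 1; exists (colour x); first exact: sees_lt3 ni.
by move=> t tK tN; apply: contraNT mono => tx; apply/existsP; exists t; rewrite tK tN.
Qed.

Lemma feet_two_apart K n n' a b : off K -> upath K n n' 2 -> a < ell -> b < ell ->
  e n (c a) -> e n' (c b) -> (a + 1) %% 3 = b %% 3 ->
  [|| a + 1 == b, a + 4 == b, a + 1 == b + ell | a + 4 == b + ell].
Proof.
move=> oK P al bl na n'b ab.
case: (ltngtP a b) => [lt|gt|E]; last by move: ab; rewrite E; clear; lia.
- case: (link_lengths oK P na n'b lt bl) => _ [_ o].
  by move: o lt al bl ab s0; clear; lia.
case: (link_lengths oK (upath_rev eC P) n'b na gt al) => [[_ o] _].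
by move: o gt al bl ab s0; clear; lia.
Qed.

Lemma doubly_sees_pair_size K i j n n' : off K -> upath K n n' 2 ->
  doubly_sees i n -> doubly_sees j n' -> i != j -> ell = 6.
Proof.
wlog ij1 : i j n n' / (i + 1) %% 3 = j => [next oK P di dj ij|].
  have := sees_lt3 (doubly_sees_sees di); have := sees_lt3 (doubly_sees_sees dj) => j3 i3.
  have: ((i + 1) %% 3 == j) || ((j + 1) %% 3 == i) by move: i3 j3 ij; clear; lia.
  case/orP => /eqP E; first exact: (next i j n n').
  by apply: (next j i n' n); rewrite 1?eq_sym //; apply: upath_rev.
move=> oK P /doubly_sees_cyc[a [a' [aa a'l ai a'i [na na']]]].
move=> /doubly_sees_cyc[b [b' [bb b'l bi b'i [nb nb']]]] _.
have al : a < ell by apply: ltn_trans a'l.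
have bl : b < ell by apply: ltn_trans b'l.
have next p q : p %% 3 = i -> q %% 3 = j -> (p + 1) %% 3 = q %% 3.
  by move: ij1; clear; lia.
have := feet_two_apart oK P al bl na nb (next _ _ ai bi).
have := feet_two_apart oK P al b'l na nb' (next _ _ ai b'i).
have := feet_two_apart oK P a'l bl na' nb (next _ _ a'i bi).
have := feet_two_apart oK P a'l b'l na' nb' (next _ _ a'i b'i).
move: al bl a'l b'l s0 aa bb; move: (size s) => L; clear.
move=> al bl a'l b'l l0 aa bb.
by case/or4P => /eqP ?; case/or4P => /eqP ?; case/or4P => /eqP ?; case/or4P => /eqP ?; lia.
Qed.

(** * Tripods *)

Section TripodSize.
Variables (K : {set T}) (z : T) (leaf : nat -> T).
Hypotheses (oK : outer K) (tp : tripod K z leaf).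
Let offK := outer_off oK.

Lemma mem_tripod t : t \in K -> t = z \/ exists2 k, k < 3 & t = leaf k.
Proof.
by rewrite (tripod_eq oK tp) in_setU1 => /orP[/eqP->|/leavesP]; [left|right].
Qed.

Lemma tripod_upath j k : j < 3 -> k < 3 -> j != k -> upath K (leaf j) (leaf k) 2.
Proof.
move=> j3 k3 jk; have zK := tp_center tp; have jK := tp_leaf tp j3; have kK := tp_leaf tp k3.
apply: upath_sub (upath2 eI (leaf_center tp j3) (tp_edge tp k3) (leaf_neq oK tp j3 k3 jk)) _.
by subset_by_mem.
Qed.

Lemma center_nb t : e z t -> exists2 k, k < 3 & t = leaf k.
Proof.
move=> zt; case: (boolP (t \in K)) => [/mem_tripod[E|//]|tK]; first by rewrite E eI in zt.
case/negP: (tp_unattached tp).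
exact: attachedI (outer_closed oK (tp_center tp) zt tK) zt.
Qed.

Lemma deg_center : deg z = 3.
Proof.
rewrite /deg; suff -> : [set y | e z y] = leaves leaf.
  by rewrite /leaves -setUA cardsU1 cards2 !inE negb_or !(leaf_neq oK tp).
apply/setP => t; rewrite inE; apply/idP/leavesP; first exact: center_nb.
by case=> k k3 ->; apply: (tp_edge tp).
Qed.

Lemma leaf_nb k t : k < 3 -> e (leaf k) t -> t = z \/ t \in colour_class k.
Proof.
move=> k3 kt; have kK := tp_leaf tp k3; have ks := tp_sees tp k3.
case: (boolP (t \in K)) => [/mem_tripod[->|[j j3 E]]|tK]; first by left.
  subst t; have [kj|kj] := eqVneq k j; first by rewrite kj eI in kt.
  by have := two_colour_link offK (upath1 eI kt kK (tp_leaf tp j3)) ks (tp_sees tp j3) kj.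
right; have ts := outer_closed oK kK kt tK.
by rewrite -(sees_inj (offK kK) (sees_colour ts kt) ks) mem_colour_class.
Qed.

Lemma leaf_doubly_or_deg2 k : k < 3 -> doubly_sees k (leaf k) \/ deg (leaf k) = 2.
Proof.
move=> k3; case: (eqVneq (deg (leaf k)) 2) => [|d2]; [by right|left].
case/adjP: (tp_sees tp k3) => x xk kx.
have [t [kt tx tz]] : exists t, [/\ e (leaf k) t, t != x & t != z].
  apply: deg_gt2_neq; rewrite ltn_neqAle eq_sym d2 (crit_deg_gt1 crit) //.
  exact: outer_sub oK _ (tp_leaf tp k3).
exists x, t; split=> //; last by rewrite eq_sym.
by case: (leaf_nb k3 kt) => // E; rewrite E eqxx in tz.
Qed.

Lemma some_leaf_doubly : exists2 k, k < 3 & doubly_sees k (leaf k).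
Proof.
case: (@leaf_doubly_or_deg2 0) => // d0; first by exists 0.
case: (@leaf_doubly_or_deg2 1) => // d1; first by exists 1.
case: (@leaf_doubly_or_deg2 2) => // d2; first by exists 2.
by case: (crit_no_claw crit deg_center) => u /center_nb[[|[|[|//]]] _ ->].
Qed.

Let center_cyc k : k < ell -> z != c k.
Proof. by move=> kl; apply: contraTneq (cyc_in kl) => <-; apply: offK (tp_center tp). Qed.

(* The folding property of a critical graph, applied to [c b - leaf m - z - leaf m']. *)
Lemma deg2_leaf_fold m m' b : m < 3 -> m' < 3 -> m != m' -> deg (leaf m) = 2 -> b < ell ->
  e (leaf m) (c b) ->
  exists r, [/\ r < ell, r %% 3 = m', e (leaf m') (c r) & consecutive b r].
Proof.
move=> m3 m'3 mm' dm bl mb; have m'K := tp_leaf tp m'3.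
have m'm : leaf m' != leaf m by rewrite eq_sym (leaf_neq oK tp).
have m'b : leaf m' != c b by apply: contraTneq (cyc_in bl) => <-; apply: offK.
case: (crit_fold crit dm (leaf_center tp m3) mb (center_cyc bl) deg_center
         (tp_edge tp m'3) m'm m'b) => y [by_ m'y _ yz].
case: (leaf_nb m'3 m'y) => [E|yc]; first by rewrite E eqxx in yz.
case: (cyc_adj bl by_ (colour_class_in yc)) => r [rl yr adj_br].
exists r; split=> //; last by rewrite -yr.
by move/colour_classP: yc => [_]; rewrite yr /colour index_cyc.
Qed.

Lemma tripod_size : ell = 6.
Proof.
have two i j : i < 3 -> j < 3 -> i != j -> doubly_sees i (leaf i) -> doubly_sees j (leaf j) ->
    ell = 6.
  by move=> i3 j3 ij di dj; apply: doubly_sees_pair_size offK (tripod_upath i3 j3 ij) di dj ij.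
have [l l3 dl] := some_leaf_doubly.
pose i := (l + 1) %% 3; pose j := (l + 2) %% 3.
have [i3 j3] : i < 3 /\ j < 3 by rewrite !ltn_pmod.
have [ij il jl] : [/\ i != j, i != l & j != l].
  by rewrite /i /j; split; move: l3; clear; lia.
case: (leaf_doubly_or_deg2 i3) => di; first exact: two i3 l3 il di dl.
case: (leaf_doubly_or_deg2 j3) => dj; first exact: two j3 l3 jl dj dl.
have ell_ge6 := doubly_sees_size dl.
case: (sees_cyc (tp_sees tp i3)) => p [pl pi ip]; case: (sees_cyc (tp_sees tp j3)) => q [ql qj jq].
case: (deg2_leaf_fold i3 j3 ij di pl ip) => q' [q'l q'j jq' adj_pq'].
have qq : q' = q.
  apply: cyc_inj => //; case: (deg2_adj dj (leaf_center tp j3) jq (center_cyc ql) jq') => // E.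
  by move: (center_cyc q'l); rewrite E eqxx.
subst q'; case: (deg2_leaf_fold i3 l3 il di pl ip) => r [rl r_l lr adj_pr].
have := feet_two_apart offK (tripod_upath j3 l3 jl) ql rl jq lr.
move: ell_ge6 pl ql rl pi qj r_l adj_pq' adj_pr s0 l3.
rewrite /consecutive /i /j; move: (size s) => L; clear.
move=> L6 pl ql rl pi qj r_l adj_pq adj_pr L0 l3 apart.
have {}apart : [|| q + 1 == r, q + 4 == r, q + 1 == r + L | q + 4 == r + L] by apply: apart; lia.
by case/or4P: apart => /eqP ?; lia.
Qed.

End TripodSize.

Lemma sum_deg_le A m : (forall x, x \in A -> deg x <= m) -> \sum_(x in A) deg x <= m * #|A|.
Proof. by move=> Am; rewrite mulnC -sum_nat_const; apply: leq_sum. Qed.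

Lemma sparse_contra : (forall x, x \in S -> deg x <= 3) -> #|S| <= 10 ->
  #|S| = 10 \/ (exists A, [/\ {subset A <= S}, 3 <= #|A| & forall x, x \in A -> deg x <= 2]) ->
  False.
Proof.
move=> d3 S10 few; have le3 := sum_deg_le d3; have := crit_dense crit; rewrite /degree_bound.
case: few => [S10'|[A [AS A3 dA]]]; first by move: le3; rewrite S10'; clear; lia.
have : \sum_(x in S) deg x + #|A| <= 3 * #|S|.
  have -> : #|A| = \sum_(x in S) (x \in A : nat).
    rewrite -sum1_card [RHS]big_mkcond [LHS]big_mkcond; apply: eq_bigr => x _ /=.
    by case: (boolP (x \in A)) => [/AS->|_] //; case: ifP.
  rewrite -big_split /= mulnC -sum_nat_const; apply: leq_sum => x xS.
  by case: (boolP (x \in A)) => [/dA|_]; rewrite ?addn1 // addn0 d3.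
have : (#|S| - 1) %/ 9 * 9 <= #|S| - 1 by apply: leq_divM.
by move: le3 S10 A3; clear; lia.
Qed.

(** * Cycles of length 6 *)

Section SixCycle.
Hypothesis ell6 : ell = 6.

Let lt6 p : p < 6 -> p < ell.
Proof. by rewrite ell6. Qed.

Lemma cyc6_in p : p < 6 -> c p \in s.
Proof. by move/lt6/cyc_in. Qed.

Lemma cyc6_neq p q : p < 6 -> q < 6 -> p != q -> c p != c q.
Proof. by move=> /lt6 pl /lt6 ql; apply: contraNneq => /(cyc_inj pl ql)->. Qed.

Lemma cyc6_off_neq t p : t \notin s -> p < 6 -> t != c p.
Proof. by move=> ts p6; apply: contraNneq ts => ->; apply: cyc6_in. Qed.

Lemma cyc6_colour_class p : p < 6 -> c p \in colour_class (p %% 3).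
Proof. by move/lt6/cyc_colour_class. Qed.

Lemma cyc6P x : x \in s -> exists2 p, p < 6 & x = c p.
Proof. by case/cycP => p pl ->; exists p; rewrite // -ell6. Qed.

Lemma cyc6_nb p t : p < 6 -> e (c p) t -> t \in s ->
  t = c ((p + 1) %% 6) \/ t = c ((p + 5) %% 6).
Proof.
move=> p6 pt ts; case: (cyc_adj (lt6 p6) pt ts) => b [bl -> adj_pb].
rewrite /consecutive ell6 in bl adj_pb.
have : (b == (p + 1) %% 6) || (b == (p + 5) %% 6) by move: p6 bl adj_pb; clear; lia.
by case/orP => /eqP->; [left|right].
Qed.

Lemma cyc6_deg_le3 p t : p < 6 -> (forall u, e (c p) u -> u \notin s -> u = t) ->
  deg (c p) <= 3.
Proof.
move=> p6 only_t; apply: leq_trans (deg_le _) (cards3_le (c ((p + 1) %% 6)) (c ((p + 5) %% 6)) t).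
move=> u pu; rewrite !inE; case: (boolP (u \in s)) => us.
  by case: (cyc6_nb p6 pu us) => ->; rewrite eqxx ?orbT.
by rewrite (only_t u pu us) eqxx orbT.
Qed.

Lemma cyc6_deg_le2 p : p < 6 -> (forall u, e (c p) u -> u \in s) -> deg (c p) <= 2.
Proof.
move=> p6 onC; apply: leq_trans (deg_le (A := [set c ((p + 1) %% 6); c ((p + 5) %% 6)]) _) _.
  by move=> u pu; rewrite !inE; case: (cyc6_nb p6 pu (onC _ pu)) => ->; rewrite eqxx ?orbT.
by rewrite cards2; case: (_ != _).
Qed.

Lemma cyc6_sees u p : p < 6 -> e (c p) u -> sees (p %% 3) u.
Proof. by move=> p6 pu; apply/adjP; exists (c p); rewrite ?cyc6_colour_class // eC. Qed.

Lemma colour_class6 i x : x \in colour_class i -> i < 3 /\ (x = c i \/ x = c (i + 3)).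
Proof.
case/colour_class_cyc => a [al ai ->]; rewrite ell6 in al.
have i3 : i < 3 by rewrite -ai ltn_pmod.
split=> //; have : (a == i) || (a == i + 3) by move: al ai; clear; lia.
by case/orP => /eqP->; [left|right].
Qed.

Lemma opposite6 i : i < 3 -> [/\ i < 6, i + 3 < 6 & c i != c (i + 3)].
Proof.
move=> i3; have [i6 i36] : i < 6 /\ i + 3 < 6 by move: i3; clear; lia.
by split=> //; apply: cyc6_neq => //; clear; lia.
Qed.

Lemma doubly_sees6 i n : doubly_sees i n -> [/\ i < 3, e n (c i) & e n (c (i + 3))].
Proof.
case=> x [x' [/colour_class6[i3 xE] /colour_class6[_ x'E] xx' nx nx']]; split=> //.
  by case: xE x'E => [<-//|E] [<-//|E']; rewrite E E' eqxx in xx'.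
by case: xE x'E => [E|<-//] [E'|<-//]; rewrite E E' eqxx in xx'.
Qed.

Lemma doubly_sees6I i n : i < 3 -> e n (c i) -> e n (c (i + 3)) -> doubly_sees i n.
Proof.
move=> i3 ni ni3; case: (opposite6 i3) => i6 i36 ne; exists (c i), (c (i + 3)); split=> //.
  by have := cyc6_colour_class i6; rewrite modn_small.
by have := cyc6_colour_class i36; rewrite modnDr modn_small.
Qed.

Lemma doubly_sees_upath i n : n \notin s -> doubly_sees i n ->
  upath [set c i; n; c (i + 3)] (c i) (c (i + 3)) 2.
Proof.
move=> ns /doubly_sees6[i3 ni ni3]; rewrite eC in ni.
by apply: upath2 => //; case: (opposite6 i3).
Qed.

Lemma doubly_sees_opposite_length i n L k : n \notin L -> doubly_sees i n ->
  upath L (c i) (c (i + 3)) k -> 0 < k -> k %% 3 <> 2.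
Proof.
move=> nL /doubly_sees6[i3 ni ni3] P k0.
by have := upath_cycle1_free (crit_free crit) (upath_cons ni nL P); rewrite eC => /(_ ni3 k0);
  clear; lia.
Qed.

Section Monochromatic.
Variables (K L : {set T}) (i k : nat) (w : T).
Hypotheses (oK : outer K) (wK : w \in K) (i3 : i < 3) (mono : monochromatic i K).
Hypotheses (P : upath L (c i) (c (i + 3)) k) (disLK : forall t, t \in L -> t \in K -> False).
Hypothesis k0 : k %% 3 <> 0.

Lemma mono6_foot t x : t \in K -> e t x -> x \in s -> x = c i \/ x = c (i + 3).
Proof.
move=> tK tx xs; have tC := attachedI xs tx.
have E := sees_inj (outer_off oK tK) (sees_colour xs tx) (mono tK tC).
by case: (@colour_class6 i x); rewrite // -E mem_colour_class.
Qed.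

Lemma mono6_feet : (exists2 n, n \in K & e n (c i)) /\ (exists2 n, n \in K & e n (c (i + 3))).
Proof.
case: (outer_two_feet oK wK) => n [n' [x [x' [[nK n'K nx n'x' xx'] [xs x's]]]]].
case: (mono6_foot nK nx xs) (mono6_foot n'K n'x' x's) => E [E'|E']; subst.
- by rewrite eqxx in xx'.
- by split; [exists n|exists n'].
- by split; [exists n'|exists n].
by rewrite eqxx in xx'.
Qed.

Lemma mono6_length a b r : e a (c i) -> e b (c (i + 3)) -> upath K a b r ->
  r %% 3 <> 2 /\ (r + k) %% 3 <> 2.
Proof.
move=> ai bi R; case: (opposite6 i3) => i6 i36 ne; split.
  case: (link_colour (outer_off oK) R (cyc6_in i6) (cyc6_in i36) ai bi) => _ distinct _.
  by apply: distinct => //; rewrite /colour !index_cyc ?ell6 // modnDr.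
have ib : e (c (i + 3)) b by rewrite eC.
have := upath_cycle1_free (crit_free crit) (upath_cat P ib (upath_rev eC R) disLK) ai.
have k1 : 0 < k by move: k0; clear; lia.
by move=> /(_ ltac:(by move: k1; clear; lia)); clear; lia.
Qed.

Lemma mono6_single : single K.
Proof.
case: (opposite6 i3) => i6 i36 ne; have [[n nK ni] [n' n'K n'i]] := mono6_feet.
apply: (branch_single crit (X := [set c i]) (Y := [set c (i + 3)])); [|exact: tame1|exact: tame1].
split.
- exact: outer_connected oK.
- exact: outer_sub oK.
- by move=> t /(outer_off oK) ts /set1P E; rewrite E cyc6_in in ts.
- by move=> t /(outer_off oK) ts /set1P E; rewrite E cyc6_in in ts.
- move=> a t aK at_ /(outer_closed oK aK at_) ts; rewrite !inE.
  by case: (mono6_foot aK at_ ts) => ->; rewrite eqxx; [left|right].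
- by exists n; rewrite // adj1.
- by exists n'; rewrite // adj1.
move=> a b r a' b' r'; rewrite !adj1 => ai bi R a'i b'i R'.
have := mono6_length ai bi R; have := mono6_length a'i b'i R'.
by move: k0; clear; lia.
Qed.

Lemma mono6_vertex : [/\ k %% 3 = 1, doubly_sees i w & deg w = 2].
Proof.
case: (opposite6 i3) => i6 i36 ne; have [[n nK ni] [n' n'K n'i]] := mono6_feet.
rewrite (mono6_single nK wK) in ni; rewrite (mono6_single n'K wK) in n'i.
split; last 2 first.
- exact: doubly_sees6I.
- apply: (deg_eq2 ni n'i ne) => x wx; apply: (mono6_foot wK wx).
  apply: (outer_closed oK wK wx); apply/negP => /(mono6_single wK) E.
  by rewrite -E eI in wx.
by have [_] := mono6_length ni n'i (upath0 e wK); move: k0; clear; lia.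
Qed.

End Monochromatic.

Lemma card_cyc6U M : off M -> #|[set x in s] :|: M| = 6 + #|M|.
Proof.
move=> oM; rewrite cardsU cardsE (card_uniqP (sc0_uniq short)) ell6.
have -> : [set x in s] :&: M = set0; last by rewrite cards0 subn0.
by apply/setP => x; rewrite !inE; apply/negP => /andP[xs /oM]; rewrite xs.
Qed.

Section NoTripod.
Variables (K : {set T}) (z : T) (leaf : nat -> T).
Hypotheses (oK : outer K) (tp : tripod K z leaf).
Let offK := outer_off oK.

Lemma tripod_long_upath i j a : i < 3 -> j < 3 -> i != j -> a < 6 -> a %% 3 = i ->
  e (leaf i) (c a) -> doubly_sees j (leaf j) ->
  upath (K :|: [set x in s]) (c a) (c ((a + 3) %% 6)) 5.
Proof.
move=> i3 j3 ij a6 ai ia /doubly_sees6[_ jj jj3].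
have [b [b6 jb ba']] : exists b, [/\ b < 6, e (leaf j) (c b) & e (c b) (c ((a + 3) %% 6))].
  have [j6 j36 _] := opposite6 j3; have a'l : (a + 3) %% 6 < ell by rewrite ell6 ltn_pmod.
  case: (boolP (consecutive j ((a + 3) %% 6))) => near.
    by exists j; split=> //; apply: cyc_edge near => //; apply: lt6.
  exists (j + 3); split=> //; apply: cyc_edge => //; first exact: lt6.
  by move: i3 j3 ij a6 ai near; rewrite /consecutive ell6; clear; lia.
have a'6 : (a + 3) %% 6 < 6 by rewrite ltn_pmod.
have b_a' : b != (a + 3) %% 6 by apply: contraTneq ba' => ->; rewrite eI.
have b_a : b != a.
  have jbc : sees (b %% 3) (leaf j) by apply: cyc6_sees; rewrite 1?eC.
  have E := sees_inj (offK (tp_leaf tp j3)) jbc (tp_sees tp j3).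
  by move: E ij ai; clear; lia.
have a_a' : a != (a + 3) %% 6 by move: a6; clear; lia.
have is_ := offK (tp_leaf tp i3); have js := offK (tp_leaf tp j3); have zs := offK (tp_center tp).
have i_a := cyc6_off_neq is_ a6; have i_b := cyc6_off_neq is_ b6; have i_a' := cyc6_off_neq is_ a'6.
have j_a := cyc6_off_neq js a6; have j_b := cyc6_off_neq js b6; have j_a' := cyc6_off_neq js a'6.
have z_a := cyc6_off_neq zs a6; have z_b := cyc6_off_neq zs b6; have z_a' := cyc6_off_neq zs a'6.
have cb_a' := cyc6_neq b6 a'6 b_a'; have cb_a := cyc6_neq b6 a6 b_a.
have ca_a' := cyc6_neq a6 a'6 a_a'; have l_ij := leaf_neq oK tp i3 j3 ij.
have z_i := edge_neq eI (tp_edge tp i3); have z_j := edge_neq eI (tp_edge tp j3).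
have as_ := cyc6_in a6; have bs := cyc6_in b6; have a's := cyc6_in a'6.
have iK := tp_leaf tp i3; have jK := tp_leaf tp j3; have zK := tp_center tp.
exists [:: leaf i; z; leaf j; c b; c ((a + 3) %% 6)]; split=> //=.
- by rewrite eC ia (leaf_center tp i3) (tp_edge tp j3) jb ba'.
- by rewrite !inE; neq_simpl.
by subset_by_mem.
Qed.

Lemma tripod_opposite_upath i : i < 3 ->
  exists k, [/\ upath (K :|: [set x in s]) (c i) (c (i + 3)) k, 0 < k & k %% 3 = 2].
Proof.
move=> i3; have iK := tp_leaf tp i3; case: (opposite6 i3) => i6 i36 _.
case: (some_leaf_doubly oK tp) => j j3 dj.
case: (eqVneq i j) => [E|ij].
  subst j; exists 2; split=> //; apply: upath_sub (doubly_sees_upath (offK iK) dj) _.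
  by have := cyc6_in i6; have := cyc6_in i36 => ci3 ci; subset_by_mem.
case: (sees_cyc (tp_sees tp i3)) => a [al ai ia]; rewrite ell6 in al.
have P := tripod_long_upath i3 j3 ij al ai ia dj; exists 5; split=> //.
have: (a == i) || (a == i + 3) by move: al ai; clear; lia.
case/orP => /eqP E; move: P; rewrite E; first by rewrite modn_small.
by rewrite -addnA modnDr modn_small //; apply: upath_rev.
Qed.

Lemma off_in_tripod u : u \in S -> u \notin s -> u \in K.
Proof.
move=> uS us; case: (outer_component uS us) => K' [oK' uK']; apply: contraT => uK.
have dis w : w \in K :|: [set x in s] -> w \in K' -> False.
  rewrite !inE => /orP[wK|ws] wK'; last by move: (outer_off oK' wK'); rewrite ws.
  by move: uK; rewrite (outer_eq oK oK' wK wK') uK'.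
have no_doubly i n : n \in K' -> doubly_sees i n -> False.
  move=> nK' di; case/doubly_sees6: (di) => i3 _ _.
  case: (tripod_opposite_upath i3) => k [P k0 k2].
  have nL : n \notin K :|: [set x in s] by apply/negP => /dis; apply.
  exact: (doubly_sees_opposite_length nL di P k0 k2).
case: (outer_cases oK' uK') => [[i i3 mono]|[v [n [n' [i [j lk]]]]]|[z' [leaf' tp']]].
- case: (tripod_opposite_upath i3) => k [P k0 k2].
  by case: (mono6_vertex oK' uK' i3 mono P dis); rewrite k2.
- by case: (colour_link_shape oK' lk) => _ di _; case: (no_doubly i n (cl_end lk) di).
by case: (some_leaf_doubly oK' tp') => j j3 dj; case: (no_doubly j _ (tp_leaf tp' j3) dj).
Qed.

Lemma card_tripod : #|K| = 4.
Proof.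
have z_leaf k : k < 3 -> z != leaf k by move=> k3; apply: edge_neq eI _ _ (tp_edge tp k3).
rewrite (tripod_eq oK tp) cardsU1 /leaves -setUA cardsU1 cards2 !inE !negb_or !z_leaf //.
by rewrite !(leaf_neq oK tp).
Qed.

Lemma no_tripod6 : False.
Proof.
have SE : S = [set x in s] :|: K.
  apply/setP => x; rewrite in_setU inE; case: (boolP (x \in s)) => xs; first by rewrite cyc_supp.
  by apply/idP/idP => [/off_in_tripod|/(outer_sub oK)]; [apply|].
have S10 : #|S| = 10 by rewrite SE (card_cyc6U offK) card_tripod.
apply: sparse_contra; [|by rewrite S10|by left].
move=> x; rewrite SE in_setU inE => /orP[/cyc6P[p p6 ->]|/(mem_tripod oK tp)[->|[k k3 ->]]].
- apply: (cyc6_deg_le3 (t := leaf (p %% 3))) => // u pu us.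
  have uS : u \in S by rewrite eC in pu; apply: (crit_supp crit pu).
  have up := cyc6_sees p6 pu.
  case/(mem_tripod oK tp): (off_in_tripod uS us) => [E|[k k3 E]]; subst u.
    by case/negP: (tp_unattached tp); apply: sees_attached up.
  by rewrite (sees_inj (offK (tp_leaf tp k3)) up (tp_sees tp k3)).
- by rewrite (deg_center oK tp).
apply: leq_trans (deg_le _) (cards3_le z (c k) (c (k + 3))) => t.
by rewrite !inE => /(leaf_nb oK tp k3)[->|/colour_class6[_ [->|->]]]; rewrite eqxx ?orbT.
Qed.

End NoTripod.

Section DoublyPair.
Variables (M A : {set T}) (n n' : T) (i j : nat).
Hypotheses (ij : i != j) (di : doubly_sees i n) (dj : doubly_sees j n').
Hypotheses (nM : n \in M) (n'M : n' \in M) (offM : off M) (MS : {subset M <= S}).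
Hypothesis M_closed : forall u w, u \in M -> e u w -> w \notin M -> w \in s.
Hypothesis M_attached : forall t, t \in M -> attached t -> t = n \/ t = n'.
Hypotheses (deg_M : forall t, t \in M -> deg t <= 3) (AM : {subset A <= M}).
Hypothesis deg_A : forall t, t \in A -> deg t <= 2.
Hypothesis card_MA : #|M| = 3 /\ #|A| = 1 \/ #|M| = 2 /\ #|A| = 2.
Let l := 3 - i - j.

Let colours_ijl : [/\ i < 3, j < 3, l < 3, i != l & j != l].
Proof.
case/doubly_sees6: di => i3 _ _; case/doubly_sees6: dj => j3 _ _.
by rewrite /l; split=> //; move: i3 j3 ij; clear; lia.
Qed.

(* The path runs through [n] and its two feet. *)
Lemma third_colour_upath : upath (n |: [set x in s]) (c l) (c (l + 3)) 4.
Proof.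
case: colours_ijl => i3 j3 l3 il jl; case/doubly_sees6: di => _ ni ni3.
have [a [a' [[a6 a'6 aa' la a'l] [na na']]]] : exists a a',
    [/\ a < 6, a' < 6, a != a', e (c l) (c a) & e (c a') (c (l + 3))] /\ (e n (c a) /\ e n (c a')).
  case: (boolP (consecutive l i)) => near.
    by exists i, (i + 3); split=> //; split=> //; rewrite ?cyc_edge //;
      move: i3 j3 l3 il jl near; rewrite /consecutive ell6; clear; lia.
  by exists (i + 3), i; split=> //; split=> //; rewrite ?cyc_edge //;
    move: i3 j3 l3 il jl near; rewrite /consecutive ell6; clear; lia.
case: (opposite6 l3) => l6 l36 ll; have ns := offM nM.
have foot_neq b : e n (c b) -> b < 6 -> b != l /\ b != l + 3.
  move=> nb b6; have bn : e (c b) n by rewrite eC.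
  have E := sees_inj ns (cyc6_sees b6 bn) (doubly_sees_sees di).
  by split; move: E b6 l3 il i3; clear; lia.
case: (foot_neq a na a6) => a_l a_l3; case: (foot_neq a' na' a'6) => a'_l a'_l3.
have n_a := cyc6_off_neq ns a6; have n_a' := cyc6_off_neq ns a'6.
have n_l := cyc6_off_neq ns l6; have n_l3 := cyc6_off_neq ns l36.
have ca_ca' := cyc6_neq a6 a'6 aa'; have ca_cl := cyc6_neq a6 l6 a_l.
have ca_cl3 := cyc6_neq a6 l36 a_l3; have ca'_cl := cyc6_neq a'6 l6 a'_l.
have ca'_cl3 := cyc6_neq a'6 l36 a'_l3.
have an : e (c a) n by rewrite eC.
apply: upath_sub (upath4 la an na' a'l _) _; first by rewrite /= !inE; neq_simpl.
have ca := cyc6_in a6; have ca' := cyc6_in a'6; have cl := cyc6_in l6; have cl3 := cyc6_in l36.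
by subset_by_mem.
Qed.

Lemma rest_third_colour u : u \in S -> u \notin s -> u \notin M ->
  doubly_sees l u /\ deg u = 2.
Proof.
move=> uS us uM; case: (outer_component uS us) => K [oK uK].
case: colours_ijl => i3 j3 l3 il jl.
have KM w : w \in K -> w \in M -> False.
  by move=> wK wM; case/negP: uM; apply: (outer_sub_closed oK wK wM M_closed).
have gate_disjoint m t : m < 3 -> t \in M ->
    forall w, w \in [set c m; t; c (m + 3)] -> w \in K -> False.
  move=> m3 tM w; case: (opposite6 m3) => m6 m36 _.
  rewrite !inE -orbA => /or3P[]/eqP-> wK; last by move: (outer_off oK wK); rewrite cyc6_in.
    by move: (outer_off oK wK); rewrite cyc6_in.
  exact: KM wK tM.
have doubly_neq m t w m' : t \in M -> doubly_sees m t -> w \in K -> doubly_sees m' w -> m' != m.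
  move=> tM dm wK dm'; apply/eqP => E; subst m'; case/doubly_sees6: (dm) => m3 _ _.
  have wL : w \notin [set c m; t; c (m + 3)].
    by apply/negP => /(gate_disjoint m t m3 tM); apply.
  exact: (doubly_sees_opposite_length wL dm' (doubly_sees_upath (offM tM) dm) isT erefl).
have no_link v1 n1 n2 i' j' : colour_link K v1 n1 n2 i' j' -> False.
  move=> lk; case: (colour_link_shape oK lk) => _ di' dj'; have := cl_neq lk.
  case/doubly_sees6: (di') => i'3 _ _; case/doubly_sees6: (dj') => j'3 _ _.
  have := doubly_neq i n n1 i' nM di (cl_end lk) di'.
  have := doubly_neq j n' n1 i' n'M dj (cl_end lk) di'.
  have := doubly_neq i n n2 j' nM di (cl_end' lk) dj'.
  have := doubly_neq j n' n2 j' n'M dj (cl_end' lk) dj'.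
  by move: ij i'3 j'3 i3 j3; clear; lia.
case: (outer_cases oK uK) => [[m m3 mono]|[v [n1 [n2 [i' [j' lk]]]]]|[z [leaf tp]]].
- have mono_neq m' t : t \in M -> doubly_sees m' t -> m <> m'.
    move=> tM dm' E; subst m'.
    have P := doubly_sees_upath (offM tM) dm'.
    by case: (mono6_vertex oK uK m3 mono P (gate_disjoint _ _ m3 tM)).
  have ml : m = l.
    by have := mono_neq _ _ nM di; have := mono_neq _ _ n'M dj; rewrite /l; move: m3 i3 j3 ij;
      clear; lia.
  subst m; case: (mono6_vertex oK uK l3 mono third_colour_upath) => //.
  move=> w; rewrite !inE => /orP[/eqP->|ws] wK; first exact: KM wK nM.
  by move: (outer_off oK wK); rewrite ws.
- by case: (no_link _ _ _ _ _ lk).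
by case: (no_tripod6 oK tp).
Qed.

Lemma rest_unique u u' : u \in S -> u \notin s -> u \notin M ->
  u' \in S -> u' \notin s -> u' \notin M -> u = u'.
Proof.
move=> uS us uM u'S u's u'M; apply/eqP; apply: contraT => uu'.
case: (rest_third_colour uS us uM) => /doubly_sees6[l3 ul ul3] _.
case: (rest_third_colour u'S u's u'M) => /doubly_sees6[_ u'l u'l3] _.
case: (opposite6 l3) => _ _ ll; rewrite eC in u'l; rewrite eC in ul3.
by case: (@cycle4F u (c l) u' (c (l + 3))); rewrite // eC.
Qed.

Lemma cyc6_off_nb p u : p < 6 -> e (c p) u -> u \notin s ->
  [\/ p %% 3 = i /\ u = n, p %% 3 = j /\ u = n' | [/\ p %% 3 = l, u \notin M & u \in S]].
Proof.
move=> p6 pu us; have up := cyc6_sees p6 pu.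
have uS : u \in S by rewrite eC in pu; apply: (crit_supp crit pu).
case: (boolP (u \in M)) => uM.
  case: (M_attached uM (sees_attached up)) => E; [constructor 1|constructor 2]; split=> //;
    rewrite {}E in us up.
    exact: sees_inj us up (doubly_sees_sees di).
  exact: sees_inj us up (doubly_sees_sees dj).
constructor 3; split=> //; case: (rest_third_colour uS us uM) => dl _.
exact: sees_inj us up (doubly_sees_sees dl).
Qed.

Lemma cyc6_deg_pair p t : p < 6 ->
  (forall u, e (c p) u -> u \notin s -> u \notin M -> u \in S -> u = t) -> deg (c p) <= 3.
Proof.
case: colours_ijl => i3 j3 l3 il jl p6 only_t.
case: (eqVneq (p %% 3) i) => [pi|pi]; last case: (eqVneq (p %% 3) j) => [pj|pj].
- apply: (cyc6_deg_le3 (t := n)) => // u pu us.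
  by case: (cyc6_off_nb p6 pu us) => [[_ //]|[E _]|[E _ _]]; move: E ij il pi; clear; lia.
- apply: (cyc6_deg_le3 (t := n')) => // u pu us.
  by case: (cyc6_off_nb p6 pu us) => [[E _]|[_ //]|[E _ _]]; move: E jl pi pj; clear; lia.
apply: (cyc6_deg_le3 (t := t)) => // u pu us.
by case: (cyc6_off_nb p6 pu us) => [[E _]|[E _]|[_ uM uS]]; [move: E pi; clear; lia
  |move: E pj; clear; lia|exact: only_t].
Qed.

Lemma pair_rest_empty v : v \in S -> v \notin s -> v \in M.
Proof.
move=> vS vs; apply: contraT => vM; exfalso; case: (rest_third_colour vS vs vM) => _ dv.
have SE : S = v |: ([set x in s] :|: M).
  apply/setP => x; rewrite !inE; apply/idP/idP.
    move=> xS; case: (boolP (x \in s)) => xs; first by rewrite orbT.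
    case: (boolP (x \in M)) => xM; first by rewrite !orbT.
    by rewrite (rest_unique xS xs xM vS vs vM) eqxx.
  by case/or3P => [/eqP->//|/cyc_supp|/MS].
have Sc : #|S| = 7 + #|M| by rewrite SE cardsU1 card_cyc6U // !inE negb_or vs vM.
apply: sparse_contra.
- move=> x; rewrite SE !inE => /or3P[/eqP->|/cyc6P[p p6 ->]|/deg_M//]; first by rewrite dv.
  by apply: (@cyc6_deg_pair p v) => // u pu us uM uS; apply: rest_unique.
- by rewrite Sc; case: card_MA => -[-> _].
case: card_MA => -[cM cA]; [left|right]; first by rewrite Sc cM.
exists (v |: A); split.
- by move=> x; rewrite !inE => /orP[/eqP->//|/AM/MS].
- by rewrite cardsU1 cA; have -> // : v \notin A by apply: contra vM; apply: AM.
by move=> x; rewrite !inE => /orP[/eqP->|/deg_A//]; rewrite dv.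
Qed.

Lemma doubly_pair_contra : False.
Proof.
case: colours_ijl => i3 j3 l3 il jl; case: (opposite6 l3) => l6 l36 ll.
have SE : S = [set x in s] :|: M.
  apply/setP => x; rewrite !inE; apply/idP/idP.
    by move=> xS; case: (boolP (x \in s)) => xs //=; apply: pair_rest_empty.
  by case/orP => [/cyc_supp|/MS].
apply: sparse_contra.
- move=> x; rewrite SE !inE => /orP[/cyc6P[p p6 ->]|/deg_M//].
  by apply: (@cyc6_deg_pair p n) => // u pu us uM uS; rewrite pair_rest_empty in uM.
- by rewrite SE card_cyc6U //; case: card_MA => -[-> _].
right.
have deg_l p : p < 6 -> p %% 3 = l -> deg (c p) <= 2.
  move=> p6 pl; apply: cyc6_deg_le2 => // u pu; apply: contraT => us.
  case: (cyc6_off_nb p6 pu us) => [[E _]|[E _]|[_ uM uS]].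
  - by move: E pl il; clear; lia.
  - by move: E pl jl; clear; lia.
  by rewrite pair_rest_empty in uM.
have notA p : p < 6 -> c p \notin A by move=> p6; apply/negP => /AM/offM; rewrite cyc6_in.
exists (c l |: (c (l + 3) |: A)); split.
- by move=> x; rewrite !inE => /or3P[/eqP->|/eqP->|/AM/MS//]; apply: cyc_supp; apply: cyc6_in.
- by rewrite !cardsU1 !inE negb_or ll !notA //=; case: card_MA => -[_ ->].
move=> x; rewrite !inE => /or3P[/eqP->|/eqP->|/deg_A//]; apply: deg_l => //.
  by rewrite modn_small.
by rewrite modnDr modn_small.
Qed.

End DoublyPair.
End SixCycle.

Lemma link_upath K v n n' i j : outer K -> colour_link K v n n' i j -> upath K n n' 2.
Proof.
move=> oK [ij vK vC _ vn vn' nK n'K ni n'j]; rewrite eC in vn.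
by apply: upath_sub (upath2 eI vn vn' (colours_neq ij (outer_off oK nK) ni n'j)) _; subset_by_mem.
Qed.

Lemma link_size K v n n' i j : outer K -> colour_link K v n n' i j -> ell = 6.
Proof.
move=> oK lk; case: (colour_link_shape oK lk) => _ di dj.
exact: doubly_sees_pair_size (outer_off oK) (link_upath oK lk) di dj (cl_neq lk).
Qed.

Lemma link_end_deg K v n n' i j : outer K -> colour_link K v n n' i j -> deg n <= 3.
Proof.
move=> oK lk; case: (colour_link_shape oK lk) => KE _ _; have ell6 := link_size oK lk.
case: lk => ij vK vC _ vn vn' nK n'K ni n'j.
apply: leq_trans (deg_le _) (cards3_le v (c i) (c (i + 3))) => t nt; rewrite !inE.
case: (boolP (t \in K)) => tK.
  move: tK; rewrite KE !inE -orbA => /or3P[]/eqP tE; subst t; rewrite ?eqxx //.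
    by rewrite eI in nt.
  by have := two_colour_link (outer_off oK) (upath1 eI nt nK n'K) ni n'j ij.
have ts := outer_closed oK nK nt tK.
have E := sees_inj (outer_off oK nK) (sees_colour ts nt) ni.
case: (@colour_class6 ell6 i t); first by rewrite -E mem_colour_class.
by move=> _ [->|->]; rewrite eqxx ?orbT.
Qed.

Lemma no_colour_link K v n n' i j : outer K -> colour_link K v n n' i j -> False.
Proof.
move=> oK lk; have ell6 := link_size oK lk; case: (colour_link_shape oK lk) => KE di dj.
have deg_n := link_end_deg oK lk; have deg_n' := link_end_deg oK (colour_link_sym lk).
case: (lk) => ij vK vC dv vn vn' nK n'K ni n'j.
have nn' := colours_neq ij (outer_off oK nK) ni n'j.
apply: (doubly_pair_contra ell6 (M := K) (A := [set v]) ij di dj nK n'K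
          (outer_off oK) (outer_sub oK) (outer_closed oK)).
- move=> t; rewrite KE !inE -orbA => /or3P[]/eqP-> tC; [by left|by rewrite tC in vC|by right].
- by move=> t; rewrite KE !inE -orbA => /or3P[]/eqP->; rewrite ?dv.
- by move=> t /set1P->.
- by move=> t /set1P->; rewrite dv.
left; rewrite cards1 KE -setUA cardsU1 cards2 !inE negb_or nn' eq_sym.
by rewrite (edge_neq eI vn) (edge_neq eI vn').
Qed.

Lemma outer_monochromatic K u : outer K -> u \in K -> exists2 i, i < 3 & monochromatic i K.
Proof.
move=> oK uK; case: (outer_cases oK uK) => [//|[v [n [n' [i [j lk]]]]]|[z [leaf tp]]].
  by case: (no_colour_link oK lk).
by case: (no_tripod6 (tripod_size oK tp) oK tp).
Qed.

(** * Crossing components *)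

Section ZeroLengths.
Variables (K X Y : {set T}) (i : nat).
Hypotheses (B : branch K X Y) (offK : off K).
Hypotheses (Xi : {subset X <= colour_class i}) (Yi : {subset Y <= colour_class i}).
Hypothesis length0 : forall u v k, adj X u -> adj Y v -> upath K u v k -> k %% 3 = 0.
Local Notation N := (contact K (colour_class i)).

Lemma sees_adj_sides t : t \in K -> sees i t -> adj X t \/ adj Y t.
Proof.
move=> tK /adjP[x /colour_class_in xs tx].
have xK : x \notin K by apply/negP => /offK; rewrite xs.
by case: (branch_closed B tK tx xK) => xX; [left|right]; apply/adjP; exists x.
Qed.

Lemma sides_independent u v : u \in N -> v \in N -> e u v -> False.
Proof.
rewrite !contactE => /andP[uK ui] /andP[vK vi] uv.
case: (sees_adj_sides uK ui) (sees_adj_sides vK vi) => hu [hv|hv].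
- exact: (branch_independent crit B uK vK hu hv uv).
- by have := length0 hu hv (upath1 eI uv uK vK).
- by rewrite eC in uv; have := length0 hv hu (upath1 eI uv vK uK).
exact: (branch_independent crit (branch_sym crit B) uK vK hu hv uv).
Qed.

Lemma sides_hubfree : hubfree e (K :\: N) N.
Proof.
apply: (contact_hubfree crit) => n u m u' n' sub U ni n'i ui u'i du du' nu um mu' u'n'.
have [nK n'K] : n \in K /\ n' \in K by split; apply: sub; rewrite !inE eqxx ?orbT.
have P : upath K n n' 4.
  by apply: upath_sub (upath4 nu um mu' u'n' U) _ => w; rewrite inE; apply: sub.
have smaller (Z : {set T}) (_ : #|Z| < #|K|) := @dead_end_pair i Z.
have sides' t : t \in K -> sees i t -> adj Y t \/ adj X t.
  by move=> tK /(sees_adj_sides tK)[]; [right|left].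
case: (sees_adj_sides nK ni) (sees_adj_sides n'K n'i) => hn [hn'|hn'].
- exact: (hub_arms_contra B offK Xi sees_adj_sides smaller sub U hn hn' ui u'i du du').
- by have := length0 hn hn' P.
- by have := length0 hn' hn (upath_rev eC P).
exact: (hub_arms_contra (branch_sym crit B) offK Yi sides' smaller sub U hn hn' ui u'i du du').
Qed.

Let tameN : tame (K :\: N) N.
Proof. by split; [apply: colour_contact_unique_nb|apply: sides_hubfree]. Qed.

Section SecondLayer.
Variable q : T.
Hypotheses (qK : q \in K) (qN : q \notin N).
Local Notation Q := (component (K :\: N) q).

Let QK : {subset Q <= K}.
Proof. exact: componentD_sub. Qed.

Let Q_unseen w : w \in Q -> ~~ sees i w.
Proof. by move=> wQ; have := componentD_notin wQ; rewrite contactE (QK wQ). Qed.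

Let Q_closed a w : a \in Q -> e a w -> w \notin Q -> w \in N.
Proof.
move=> aQ aw wQ; case: (boolP (w \in K)) => wK.
  by apply: contraR wQ => wN; apply: component_closed aQ _ aw; rewrite in_setD wN.
case/negP: (Q_unseen aQ); apply/adjP; exists w => //.
by case: (branch_closed B (QK aQ) aw wK) => [/Xi|/Yi].
Qed.

Let Q_single X' Y' : branch Q X' Y' -> tame Q X' -> tame Q Y' -> single Q.
Proof. exact: branch_single. Qed.

Let dead_side (X' Y' : {set T}) : branch K X' Y' -> {subset Y' <= colour_class i} ->
  (forall n, n \in contact N Q -> adj X' n) -> False.
Proof.
move=> B' Y'i attX.
apply: (dead_layer_contra crit _ tameN (branch_sub B) qK qN Q_single Q_closed B' attX).
  exact: contact_sub.
by move=> w /Q_unseen; apply: contra; apply: adjS.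
Qed.

Lemma second_layer_contra : False.
Proof.
pose PX := [set w in contact N Q | adj X w]; pose PY := [set w in contact N Q | ~~ adj X w].
case: (boolP [exists w in contact N Q, ~~ adj X w]) => [/existsP[y /andP[yC yX]]|allX]; last first.
  apply: (dead_side B Yi) => w wC.
  by apply: contraR allX => wX; apply/existsP; exists w; rewrite wC.
case: (boolP [exists w in contact N Q, adj X w]) => [/existsP[x /andP[xC xX]]|noX]; last first.
  apply: (dead_side (branch_sym crit B) Xi) => w wC; have wN := contact_sub wC.
  case: (sees_adj_sides (contact_sub wN) (contact_adj wN)) => // wX.
  by case/existsP: noX; exists w; rewrite wC.
have PXN : {subset PX <= N} by move=> w; rewrite inE => /andP[/contact_sub].
have PYN : {subset PY <= N} by move=> w; rewrite inE => /andP[/contact_sub].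
apply: (layer_split crit tameN (branch_sub B) Q_single PXN PYN (n1 := x) (n2 := y)).
- move=> a w aQ aw wQ; have wC : w \in contact N Q.
    by rewrite contactE (Q_closed aQ aw wQ); apply/adjP; exists a; rewrite // eC.
  by rewrite !inE wC /=; case: (adj X w); [left|right].
- by rewrite inE xC.
- by rewrite inE yC.
- exact: contact_adj xC.
- exact: contact_adj yC.
- by apply: contraNneq yX => <-.
apply: (mod3_constI (r := 1)) => a b k /adjP[n nP an] /adjP[n' n'P bn'] P.
have nN := PXN _ nP; have n'N := PYN _ n'P.
move: nP n'P; rewrite !inE => /andP[_ nX] /andP[_ n'X].
have nn' : n != n' by apply: contraNneq n'X => <-.
have n'Y : adj Y n'.
  case: (sees_adj_sides (contact_sub n'N) (contact_adj n'N)) => // E.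
  by rewrite E in n'X.
have nK := contact_sub nN; have n'K := contact_sub n'N.
have R : upath K n n' k.+2.
  by apply: upath_sub (upath_through_layer crit nN n'N nn' an bn' P) _; subset_by_mem.
by have := length0 nX n'Y R; clear; lia.
Qed.

End SecondLayer.

Lemma zero_length_single : single K.
Proof.
apply: (@connected_independent_single _ _ eC K (branch_connected B)) => u v uK vK.
have inN q : q \in K -> q \in N.
  by move=> qK; apply: contraT => qN; case: (second_layer_contra qK qN).
by apply: sides_independent; apply: inN.
Qed.

End ZeroLengths.

Definition linked x y := exists K n n', [/\ outer K, n \in K, n' \in K, e n x & e n' y].

Lemma outer_feet_mod3 K n n' p q : outer K -> n \in K -> n' \in K ->
  e n (c p) -> e n' (c q) -> p < ell -> q < ell -> p %% 3 = q %% 3.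
Proof.
move=> oK nK n'K np n'q pl ql; case: (outer_monochromatic oK nK) => i _ mono.
have foot t a : t \in K -> e t (c a) -> a < ell -> a %% 3 = i.
  move=> tK ta al; have tC := attachedI (cyc_in al) ta.
  have := sees_inj (outer_off oK tK) (sees_colour (cyc_in al) ta) (mono t tK tC).
  by rewrite /colour index_cyc.
by rewrite (foot n p) // (foot n' q).
Qed.

Lemma linked_mod3 p q : linked (c p) (c q) -> p < ell -> q < ell -> p %% 3 = q %% 3.
Proof. by move=> [K [n [n' [oK nK n'K np n'q]]]]; apply: outer_feet_mod3 oK nK n'K np n'q. Qed.

Lemma distinct_feet_length K n n' p q k : off K -> upath K n n' k -> e n (c p) -> e n' (c q) ->
  p < ell -> q < ell -> p != q -> p %% 3 = q %% 3 -> k %% 3 <> 2.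
Proof.
move=> oK P np n'q pl ql pq pq3.
case: (link_colour oK P (cyc_in pl) (cyc_in ql) np n'q) => _ distinct _; apply: distinct.
  by rewrite /colour !index_cyc.
by apply: contra pq => /eqP /(cyc_inj pl ql)->.
Qed.

Lemma crossing_length0 K K' u v m m' k k' x y p q : off K -> off K' ->
  (forall w, w \in K -> w \in K' -> False) -> upath K u v k -> upath K' m m' k' ->
  e m (c x) -> e m' (c y) -> e u (c p) -> e v (c q) -> x < p < y -> y < ell ->
  (q < x) || (y < q) -> q < ell -> x %% 3 = y %% 3 -> p %% 3 = q %% 3 -> x %% 3 != p %% 3 ->
  k %% 3 = 0.
Proof.
move=> oK oK' KK' P P' mx m'y up vq /andP[xp py] yl qo ql xy pq xp3.
have xl : x < ell by apply: ltn_trans xp (ltn_trans py yl).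
have pl : p < ell by apply: ltn_trans py yl.
have nk : k %% 3 <> 2.
  by apply: distinct_feet_length oK P up vq pl ql _ pq; move: xp py qo; clear; lia.
have nk' : k' %% 3 <> 2.
  by apply: distinct_feet_length oK' P' mx m'y xl yl _ xy; move: xp py; clear; lia.
case/orP: qo => qo.
  have Pr := upath_rev eC P.
  case: (crossing_lengths oK oK' KK' Pr P' vq mx up m'y qo xp py yl) => -[o1 _] [o2 _].
  by move: o1 o2 nk nk' s0 xy pq xp3 qo xp py yl; clear; lia.
have K'K w : w \in K' -> w \in K -> False by move=> wK' wK; apply: KK' wK wK'.
case: (crossing_lengths oK' oK K'K P' P mx up m'y vq xp py qo ql) => -[o1 _] [o2 _].
by move: o1 o2 nk nk' s0 xy pq xp3 qo xp py ql; clear; lia.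
Qed.

Lemma crossing_single K K' n n' m m' x y p q : outer K -> outer K' ->
  (forall w, w \in K -> w \in K' -> False) -> m \in K' -> m' \in K' -> n \in K -> n' \in K ->
  e m (c x) -> e m' (c y) -> e n (c p) -> e n' (c q) -> x < p < y -> y < ell ->
  (q < x) || (y < q) -> q < ell -> x %% 3 != p %% 3 -> single K.
Proof.
move=> oK oK' KK' mK' m'K' nK n'K mx m'y np n'q xpy yl qo ql xp.
have xl : x < ell by move: xpy yl; clear; lia.
have pl : p < ell by move: xpy yl; clear; lia.
have xy := outer_feet_mod3 oK' mK' m'K' mx m'y xl yl.
case: (outer_connected oK' mK' m'K') => k' P'.
pose X := [set t in colour_class (p %% 3) | x < index t s < y].
pose Y := [set t in colour_class (p %% 3) | ~~ (x < index t s < y)].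
have foot t z : t \in K -> e t z -> z \in s -> z \in colour_class (p %% 3).
  move=> tK tz /cycP[a al E]; subst z.
  by rewrite -(outer_feet_mod3 oK tK nK tz np al pl) cyc_colour_class.
have length0 u v k : adj X u -> adj Y v -> upath K u v k -> k %% 3 = 0.
  case/adjP => t; rewrite inE => /andP[/colour_class_cyc[a [al ap ->]] ti] ut.
  case/adjP => r; rewrite inE => /andP[/colour_class_cyc[b [bl bp ->]] ri] vr P.
  rewrite !index_cyc // in ti ri.
  apply: (crossing_length0 (outer_off oK) (outer_off oK') KK' P P' mx m'y ut vr ti yl _ bl xy).
  - by move: ri bp xp xy; clear; lia.
  - by rewrite ap bp.
  by rewrite ap.
apply: (@zero_length_single K X Y (p %% 3) _ _ _ _ length0).
- split.
  + exact: outer_connected oK.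
  + exact: outer_sub oK.
  + by move=> w /(outer_off oK) ws; rewrite !inE (negbTE ws).
  + by move=> w /(outer_off oK) ws; rewrite !inE (negbTE ws).
  + move=> t z tK tz zK; have zp := foot t z tK tz (outer_closed oK tK tz zK).
    by rewrite !in_set in zp *; rewrite zp; case: (x < _ < _); [left|right].
  + by exists n => //; apply/adjP; exists (c p); rewrite // inE cyc_colour_class // index_cyc.
  + exists n' => //; apply/adjP; exists (c q); rewrite // inE index_cyc //.
    by rewrite (foot n' (c q) n'K n'q (cyc_in ql)); move: qo; clear; lia.
  exact: mod3_constI length0.
- exact: outer_off oK.
- by move=> w; rewrite inE => /andP[].
by move=> w; rewrite inE => /andP[].
Qed.

(** * A shortest arc spanned by a component *)

Section MinimalArc.
Variable j : nat.
Hypotheses (j0 : 0 < j) (jl : j < ell) (linked0j : linked (c 0) (c j)).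
Hypothesis j_min : forall p q, p < q -> q < ell -> linked (c p) (c q) ->
  j <= q - p /\ j <= ell - (q - p).

Lemma arc_size : [/\ j %% 3 = 0, 3 <= j & j + j <= ell].
Proof.
have l0 : 0 < ell by apply: ltn_trans jl.
have j3 := linked_mod3 linked0j l0 jl; case: (j_min j0 jl linked0j) => _ jj.
by split; move: j0 jl j3 jj; clear; lia.
Qed.

(* The only place where a component attached to [c p], for [p = 1] or [2], can have another foot. *)
Definition far_foot p := if p == 1 then ell - 2 else j + 2.

Lemma far_foot_lt p : far_foot p < ell.
Proof. by case: arc_size; rewrite /far_foot; case: ifP => _; move: jl; clear; lia. Qed.

Lemma cyc_inner_neighbours p t : 0 < p < 3 -> e (c p) t -> t \in s ->
  t = c p.-1 \/ t = c p.+1.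
Proof.
case: arc_size => j3 j3' jj /andP[p0 p3] pt ts; have pl : p < ell by move: p3 jj j3'; clear; lia.
case: (cyc_adj pl pt ts) => b [bl -> adj_pb].
have : (b == p.-1) || (b == p.+1).
  by move: adj_pb p0 p3 jj j3' bl; rewrite /consecutive; clear; lia.
by case/orP => /eqP->; [left|right].
Qed.

Section InnerFoot.
Variables (p : nat) (u n n' : T) (K K' : {set T}).
Hypotheses (p03 : 0 < p < 3) (pu : e (c p) u).
Hypotheses (oK : outer K) (nK : n \in K) (n'K : n' \in K) (n0 : e n (c 0)) (n'j : e n' (c j)).
Hypotheses (oK' : outer K') (uK' : u \in K').

Let p0 : 0 < p.
Proof. by case/andP: p03. Qed.

Let p3 : p < 3.
Proof. by case/andP: p03. Qed.

Let pj : p < j.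
Proof. by case: arc_size => _ j3 _; apply: leq_trans j3. Qed.

Let pl : p < ell.
Proof. exact: ltn_trans jl. Qed.

Let up : e u (c p).
Proof. by rewrite eC. Qed.

Lemma inner_foot_disjoint w : w \in K -> w \in K' -> False.
Proof.
move=> wK wK'; have E := outer_eq oK oK' wK wK'.
have uK : u \in K by rewrite E.
have := outer_feet_mod3 oK nK uK n0 up (leq_ltn_trans (leq0n p) pl) pl.
by move: p0 p3; clear; lia.
Qed.

Lemma inner_foot_target t r : t \in K' -> r < ell -> e t (c r) -> r != p ->
  [/\ r = far_foot p, p = 1 -> j = 3, single K' & single K].
Proof.
move=> tK' rl tr rp; case: arc_size => j3 j3' jj.
have Lpr : linked (c p) (c r) by exists K', u, t.
have pr3 := linked_mod3 Lpr pl rl.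
have pr : p < r by move: rp pr3 p3; clear; lia.
have [jr _] := j_min pr rl Lpr.
have K'K w : w \in K' -> w \in K -> False by move=> wK' wK; apply: inner_foot_disjoint wK wK'.
have singleK' : single K'.
  apply: (crossing_single oK' oK K'K nK n'K uK' tK' n0 n'j up tr); rewrite ?p0 //.
  - by move: jr p0 pj; clear; lia.
  by move: p0 p3; clear; lia.
have tu := singleK' t u tK' uK'; subst t.
have singleK : single K.
  apply: (crossing_single oK oK' inner_foot_disjoint uK' uK' n'K nK up tr n'j n0); rewrite ?p0 //.
  - by move: jr p0 pj; clear; lia.
  - by move: rl; clear; lia.
  by move: p0 p3 j3; clear; lia.
have jr' : j < r by move: jr p0 pr; clear; lia.
have nj : e n (c j) by rewrite (singleK n n').
case: (crossing_lengths (outer_off oK) (outer_off oK') inner_foot_disjoint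
         (upath0 e nK) (upath0 e uK') n0 up nj tr p0 pj jr' rl) => [[_ o1] [_ o2]].
suff [E1 E2] : r = far_foot p /\ (p = 1 -> j = 3) by split.
rewrite /far_foot; move: o1 o2 pr3 pr jr p0 p3 j3 j3' jj s0 rl; clear.
by case: (eqVneq p 1) => p1; lia.
Qed.

Lemma inner_foot_exists : exists t r, [/\ t \in K', r < ell, e t (c r) & r != p].
Proof.
case: (outer_two_feet oK' uK') => a [b [x [y [[aK bK ax by_ xy] [/cycP[k kl E] /cycP[m ml E']]]]]].
subst x y; case: (eqVneq k p) => [E|kp]; last by exists a, k.
by exists b, m; split=> //; apply: contraNneq xy => ->; rewrite E.
Qed.

Lemma inner_foot_component : [/\ single K', single K, deg u = 2, e u (c (far_foot p))
  & p = 1 -> j = 3].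
Proof.
case: inner_foot_exists => t [r [tK' rl tr rp]].
case: (inner_foot_target tK' rl tr rp) => rq pj3 singleK' singleK.
have tu := singleK' t u tK' uK'; subst t r; split=> //.
apply: (deg_eq2 up tr) => [|x ux]; first by apply: contraNneq rp => /(cyc_inj pl rl)<-.
have xK' : x \notin K'.
  by apply/negP => /(singleK' _ _ uK') E; rewrite -E eI in ux.
have /cycP[k kl E] := outer_closed oK' uK' ux xK'; subst x.
case: (eqVneq k p) => [->|kp]; [by left|right].
by case: (inner_foot_target uK' kl ux kp) => ->.
Qed.

End InnerFoot.

Lemma inner_foot_pair p u : 0 < p < 3 -> e (c p) u -> u \notin s ->
  [/\ outer [set u], deg u = 2, e u (c (far_foot p)), p = 1 -> j = 3
    & exists v, [/\ outer [set v], e v (c 0), e v (c j) & v != u]].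
Proof.
move=> p03 pu us; have uS : u \in S by rewrite eC in pu; apply: (crit_supp crit pu).
case: (outer_component uS us) => K' [oK' uK'].
case: linked0j => K [n [n' [oK nK n'K n0 n'j]]].
have [singleK' singleK du uq pj3] := inner_foot_component p03 pu oK nK n'K n0 n'j oK' uK'.
split=> //; first by rewrite -(single_set1 singleK' uK').
exists n; split=> //; first by rewrite -(single_set1 singleK nK).
  by rewrite (singleK n n').
apply/eqP => E; apply: (inner_foot_disjoint p03 pu oK nK n0 oK' uK' nK).
by rewrite E.
Qed.

Lemma inner_vertex_deg3 p u : 0 < p < 3 -> e (c p) u -> u \notin s -> deg (c p) = 3.
Proof.
move=> p03 pu us; have /andP[p0 p3] := p03; case: arc_size => j3 j3' jj.
have pl : p < ell by move: p3 j3' jl; clear; lia.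
have pl' : p.+1 < ell by move: p3 j3' jl jj; clear; lia.
have pl'' : p.-1 < ell by move: pl; clear; lia.
have cyc_u r : r < ell -> c r != u by move=> rl; apply: contraNneq us => <-; apply: cyc_in.
have pp : c p.-1 != c p.+1 by apply/eqP => /(cyc_inj pl'' pl'); move: p0; clear; lia.
rewrite /deg; suff -> : [set y | e (c p) y] = [set c p.-1; c p.+1; u].
  by rewrite -setUA cardsU1 cards2 !inE negb_or pp !cyc_u.
apply/setP => t; rewrite !inE; apply/idP/idP; last first.
  case/orP => [/orP[]|]/eqP->//; last exact: cyc_step.
  by rewrite eC; have := @cyc_step p.-1; rewrite prednK //; apply.
move=> pt; case: (boolP (t \in s)) => ts.
  by case: (cyc_inner_neighbours p03 pt ts) => ->; rewrite eqxx ?orbT.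
case: (eqVneq t u) => [->|tu]; first by rewrite orbT.
case: (inner_foot_pair p03 pu us) => _ _ uq _ _; case: (inner_foot_pair p03 pt ts) => _ _ tq _ _.
have pq : c p != c (far_foot p).
  apply/eqP => /(cyc_inj pl (far_foot_lt p)); rewrite /far_foot.
  by move: p3 p0 j3' jj pl; case: (eqVneq p 1); clear; lia.
by case: (@cycle4F u (c p) t (c (far_foot p))); rewrite // 1?eC // eq_sym.
Qed.

Lemma inner_foot_on_arc : exists p u, [/\ 0 < p < 3, e (c p) u & u \notin s].
Proof.
case: arc_size => j3 j3' jj.
have of_deg p : 0 < p < 3 -> deg (c p) != 2 -> exists p u, [/\ 0 < p < 3, e (c p) u & u \notin s].
  move=> p03 d2; have /andP[p0 p3] := p03; have pl : p < ell by move: p3 j3' jl; clear; lia.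
  have d3 : 2 < deg (c p).
    by rewrite ltn_neqAle eq_sym d2 (crit_deg_gt1 crit) // cyc_supp // cyc_in.
  case: (deg_gt2_neq (c p.-1) (c p.+1) d3) => u [pu u1 u2]; exists p, u; split=> //.
  apply/negP => /(cyc_inner_neighbours p03 pu)[]E; [move: u1|move: u2]; by rewrite E eqxx.
have l2 : 2 < ell by move: jj j3'; clear; lia.
case: (eqVneq (deg (c 1)) 2) => [d1|]; last exact: (of_deg 1).
case: (eqVneq (deg (c 2)) 2) => [d2|]; last exact: (of_deg 2).
by case: (crit_deg2_nonadj crit (cyc_step l2) d1 d2).
Qed.

(* Fold along [c (far_foot p) - u - c p - c (3 - p)]. *)
Lemma minimal_arc_size p u : 0 < p < 3 -> e (c p) u -> u \notin s -> ell = 6 /\ j = 3.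
Proof.
move=> p03 pu us; have /andP[p0 p3] := p03; case: arc_size => j3 j3' jj.
case: (inner_foot_pair p03 pu us) => _ du uq pj _; have dp := inner_vertex_deg3 p03 pu us.
have pl : p < ell by move: p3 j3' jl; clear; lia.
have ql := far_foot_lt p; have zl : 3 - p < ell by move: p0 jj j3'; clear; lia.
have up : e u (c p) by rewrite eC.
have pz : e (c p) (c (3 - p)).
  have : (p == 1) || (p == 2) by move: p0 p3; clear; lia.
  by case/orP => /eqP->; [|rewrite eC]; apply: cyc_step; move: jj j3'; clear; lia.
have pq : c p != c (far_foot p).
  apply/eqP => /(cyc_inj pl ql); rewrite /far_foot.
  by move: p0 p3 jj j3'; clear; case: (eqVneq p 1); lia.
have zu : c (3 - p) != u by apply: contraNneq us => <-; apply: cyc_in.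
have zq : c (3 - p) != c (far_foot p).
  apply/eqP => /(cyc_inj zl ql); rewrite /far_foot.
  by move: p0 p3 jj j3'; clear; case: (eqVneq p 1); lia.
case: (crit_fold crit du up uq pq dp pz zu zq) => y [qy zy yu yp].
case: (boolP (y \in s)) => ys; last first.
  have yz : sees ((3 - p) %% 3) y.
    by apply/adjP; exists (c (3 - p)); rewrite ?cyc_colour_class // eC.
  have yq : sees (far_foot p %% 3) y.
    by apply/adjP; exists (c (far_foot p)); rewrite ?cyc_colour_class // eC.
  have := sees_inj ys yz yq; rewrite /far_foot.
  by move: p0 p3 j3 s0 jj j3'; clear; case: (eqVneq p 1); lia.
case: (cyc_adj ql qy ys) => b [bl yb adj_qb]; case: (cyc_adj zl zy ys) => b' [b'l yb' adj_zb].
have E : b = b' by apply: cyc_inj => //; rewrite -yb -yb'.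
subst b'; have bp : b != p by apply: contraNneq yp => E; rewrite yb E.
move: adj_qb adj_zb bp pj bl jj j3' p0 p3 s0; rewrite /consecutive /far_foot; clear.
by case: (eqVneq p 1); lia.
Qed.

Lemma opposite_foot_deg2 v : ell = 6 -> outer [set v] -> e v (c 0) -> e v (c 3) -> deg v = 2.
Proof.
move=> ell6 ov v0 v3; have vK : v \in [set v] by rewrite inE.
have l0 : 0 < ell by rewrite ell6.
apply: (deg_eq2 v0 v3); first by apply: cyc6_neq.
move=> x vx; have /cycP[b bl E] : x \in s.
  by apply: (outer_closed ov vK vx); rewrite inE eq_sym (edge_neq eI vx).
subst x; have := outer_feet_mod3 ov vK vK v0 vx l0 bl; rewrite ell6 in bl.
by case: b bl {vx} => [|[|[|[|[|[|//]]]]]] //; [left|right].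
Qed.

Lemma minimal_arc_contra : False.
Proof.
have [p [u [p03 pu us]]] := inner_foot_on_arc; have /andP[p0 p3] := p03.
have [ell6 j3] := minimal_arc_size p03 pu us.
case: (inner_foot_pair p03 pu us) => ou du uq _ [v [ov v0 vj vu]]; rewrite j3 in vj.
have qE : far_foot p = p + 3.
  by rewrite /far_foot ell6 j3; move: p0 p3; clear; case: (eqVneq p 1); lia.
rewrite qE in uq; rewrite eC in pu.
have dv := opposite_foot_deg2 ell6 ov v0 vj.
have np : 0 != p by move: p0; clear; lia.
have uK : u \in [set u] by rewrite inE.
have vK : v \in [set v] by rewrite inE.
have d0 : doubly_sees 0 v by apply: doubly_sees6I.
have dp : doubly_sees p u by apply: doubly_sees6I.
apply: (doubly_pair_contra ell6 (M := [set v; u]) (A := [set v; u]) np d0 dp).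
- by rewrite !inE eqxx.
- by rewrite !inE eqxx orbT.
- by move=> w /set2P[]->; [apply: (outer_off ov)|apply: (outer_off ou)].
- by move=> w /set2P[]->; [apply: (outer_sub ov)|apply: (outer_sub ou)].
- move=> a w /set2P[]-> aw; rewrite !inE negb_or => /andP[wv wu].
    by apply: (outer_closed ov vK aw); rewrite inE.
  by apply: (outer_closed ou uK aw); rewrite inE.
- by move=> t /set2P.
- by move=> t /set2P[]->; rewrite ?dv ?du.
- by [].
- by move=> t /set2P[]->; rewrite ?dv ?du.
by right; rewrite cards2 vu.
Qed.

End MinimalArc.

Lemma cyc_deg2 p : p < ell -> (forall u, e (c p) u -> u \in s) -> deg (c p) = 2.
Proof.
move=> pl onC; apply/eqP; rewrite eqn_leq (crit_deg_gt1 crit) ?cyc_supp ?cyc_in // andbT.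
apply: leq_trans (deg_le (A := [set c ((p + 1) %% ell); c ((p + ell.-1) %% ell)]) _) _; last first.
  by rewrite cards2; case: (_ != _).
move=> u pu; rewrite !inE; case: (cyc_adj pl pu (onC _ pu)) => b [bl -> adj_pb].
suff : (b == (p + 1) %% ell) || (b == (p + ell.-1) %% ell).
  by case/orP => /eqP->; rewrite eqxx ?orbT.
case/or4P: adj_pb => [/eqP E|/eqP E|/andP[/eqP-> /eqP->]|/andP[/eqP-> /eqP->]].
- by rewrite E modn_small // eqxx.
- have -> : p + ell.-1 = b + ell by move: E s3; clear; lia.
  by rewrite modnDr (modn_small bl) eqxx orbT.
- by rewrite add0n (modn_small (m := ell.-1)) ?eqxx ?orbT //; move: s3; clear; lia.
have -> : ell.-1 + 1 = ell by move: s3; clear; lia.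
by rewrite modnn.
Qed.

Lemma exists_linked : exists p q, [/\ p < q, q < ell & linked (c p) (c q)].
Proof.
have l0 : 0 < ell by apply: ltn_trans s3.
have l1 : 1 < ell by apply: ltn_trans s3.
have [p [u [pl pu us]]] : exists p u, [/\ p < ell, e (c p) u & u \notin s].
  case: (boolP [exists p : 'I_ell, exists u, e (c p) u && (u \notin s)]) => [|none].
    by case/existsP => p /existsP[u /andP[pu us]]; exists p, u.
  have d2 p : p < ell -> deg (c p) = 2.
    move=> pl; apply: cyc_deg2 => // u pu; apply: contraR none => us.
    by apply/existsP; exists (Ordinal pl); apply/existsP; exists u; rewrite pu.
  by case: (crit_deg2_nonadj crit (cyc_step l1) (d2 0 l0) (d2 1 l1)).
have uS : u \in S by rewrite eC in pu; apply: (crit_supp crit pu).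
case: (outer_component uS us) => K [oK uK].
case: (outer_two_feet oK uK) => n [n' [x [x' [[nK n'K nx n'x' xx'] [xs x's]]]]].
case/cycP: xs x's => a al E /cycP[b bl E']; subst x x'; case: (ltngtP a b) => [lt|gt|E].
- by exists a, b; split=> //; exists K, n, n'.
- by exists b, a; split=> //; exists K, n', n.
by rewrite E eqxx in xx'.
Qed.

End ShortestCycle.

(** * Nonexistence of critical graphs *)

Lemma nth_rot (T : Type) (x0 : T) (s : seq T) k i : k < size s -> i < size s ->
  nth x0 (rot k s) i = nth x0 s ((k + i) %% size s).
Proof.
move=> kl il; rewrite /rot nth_cat size_drop nth_drop.
case: ltnP => h; first by rewrite modn_small // -ltn_subRL.
rewrite nth_take; last by rewrite ltn_subLR // subnK // ltnW.
congr nth; have -> : k + i = i - (size s - k) + size s by move: h kl; clear; lia.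
by rewrite modnDr modn_small //; apply: leq_ltn_trans (leq_subr _ _) il.
Qed.

Section NoCritical.
Variables (T : finType) (e : rel T) (S : {set T}).
Hypothesis crit : critical e S.
Let eC : symmetric e := crit_sym crit.
Let eI : irreflexive e := crit_irr crit.

Lemma shortest_cycle0_rot k s : shortest_cycle0 e s -> shortest_cycle0 e (rot k s).
Proof. by case=> us s3 cs s0 smin; split; rewrite ?rot_uniq ?size_rot ?rot_cycle. Qed.

Lemma linked_rot k s x y : linked e S s x y -> linked e S (rot k s) x y.
Proof.
case=> K [n [n' [[cK KS offK clK] nK n'K nx n'y]]]; exists K, n, n'; split=> //; split=> //.
  by move=> w wK; rewrite mem_rot; apply: offK.
by move=> u w uK uw wK; rewrite mem_rot; apply: (clK u).
Qed.

Lemma linked_sym s x y : linked e S s x y -> linked e S s y x.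
Proof. by case=> K [n [n' [oK nK n'K nx n'y]]]; exists K, n', n. Qed.

Lemma not_linked x0 d s : shortest_cycle0 e s -> 0 < d < size s ->
  linked e S s (cyc s x0 0) (cyc s x0 d) -> False.
Proof.
elim/ltn_ind: d s => d IH s short /andP[d0 ds] linked0d.
have l0 : 0 < size s by apply: ltn_trans ds.
have closer p r : p < size s -> 0 < r < size s -> r < d ->
    linked e S s (cyc s x0 p) (cyc s x0 ((p + r) %% size s)) -> False.
  move=> pl /andP[r0 rl] rd Lpr; apply: (IH r rd (rot p s)).
  - exact: shortest_cycle0_rot.
  - by rewrite size_rot r0.
  by rewrite /cyc !nth_rot // addn0 modn_small //; apply: linked_rot.
apply: (minimal_arc_contra crit short d0 ds linked0d) => p q pq ql Lpq.
have pl := ltn_trans pq ql; split; rewrite leqNgt; apply/negP => lt.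
  apply: (closer p (q - p) pl _ lt); first by move: pq ql; clear; lia.
  by rewrite subnKC ?modn_small // ltnW.
apply: (closer q (size s - (q - p)) ql _ lt); first by move: pq ql; clear; lia.
have -> : q + (size s - (q - p)) = p + size s by move: pq ql; clear; lia.
by rewrite modnDr modn_small //; apply: linked_sym.
Qed.

Lemma no_shortest_cycle0 s : shortest_cycle0 e s -> False.
Proof.
move=> short; have x0 : T by case: (s) (sc0_size short) => // x0.
case: (exists_linked crit short x0) => p [q [pq ql Lpq]]; have pl := ltn_trans pq ql.
have l0 : 0 < size s by apply: leq_ltn_trans ql.
apply: (@not_linked x0 (q - p) (rot p s)).
- exact: shortest_cycle0_rot.
- by rewrite size_rot; move: pq ql; clear; lia.
have qpl : q - p < size s by apply: leq_ltn_trans (leq_subr _ _) ql.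
rewrite /cyc !nth_rot // addn0 subnKC ?(ltnW pq) // !modn_small //.
exact: linked_rot.
Qed.

Lemma no_cycle0 s : uniq s -> 2 < size s -> cycle e s -> size s %% 3 <> 0.
Proof.
move: {2}(size s) (leqnn (size s)) => n; elim: n s => [|n IH] s sn us s3 cs s0.
  by move: s3 sn; clear; lia.
apply: (@no_shortest_cycle0 s); split=> // t ut t3 ct t0; rewrite leqNgt; apply/negP => lt.
by apply: (IH t) => //; rewrite -ltnS; apply: leq_trans lt sn.
Qed.

Lemma critical_empty x : x \in S -> False.
Proof.
move=> xS; have [a xa _] := deg_gt1_neq x (crit_deg_gt1 crit xS).
have ax : e a x by rewrite eC.
have aS := crit_supp crit ax.
pose K := component e (S :\ x) a.
have aK : a \in K by apply: component_id; rewrite !inE (edge_neq eI ax).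
have xK : x \notin K by apply: componentD1_notin.
have K_closed u w : u \in K -> e u w -> w \notin K -> w = x.
  move=> uK uw wK; have wS : w \in S by move: uw; rewrite eC; apply: (crit_supp crit).
  by apply/eqP; apply: contraR wK => wx; apply: component_closed uK _ uw; rewrite !inE wx.
have length0 u v k : adj e [set x] u -> adj e [set x] v -> upath e K u v k -> k %% 3 = 0.
  rewrite !adj1 eC; case: k => [//|k] xu vx P.
  case: (upath_cycle (upath_cons xu xK P) vx isT) => s [us ss cs].
  have s3 : 2 < size s by rewrite ss.
  by have := crit_free crit us s3 cs; have := no_cycle0 us s3 cs; rewrite ss; clear; lia.
have singleK : single K.
  apply: (branch_single crit (X := [set x]) (Y := [set x])); [|exact: tame1|exact: tame1].
  split.
  - exact: component_connected.
  - exact: componentD_sub.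
  - by move=> w wK /set1P E; rewrite -E wK in xK.
  - by move=> w wK /set1P E; rewrite -E wK in xK.
  - by move=> u w uK uw /(K_closed _ _ uK uw)->; left; rewrite inE.
  - by exists a; rewrite // adj1.
  - by exists a; rewrite // adj1.
  exact: mod3_constI length0.
have [b ab bx] := deg_gt1_neq x (crit_deg_gt1 crit aS).
case: (boolP (b \in K)) => [bK|/(K_closed _ _ aK ab) E]; last by rewrite E eqxx in bx.
by rewrite (singleK _ _ bK aK) eI in ab.
Qed.

End NoCritical.

(** * Counting degrees *)

Section Total.
Variable T : finType.
Implicit Types (e : rel T) (A S : {set T}).

Definition total e := \sum_x deg e x.

Lemma degE e x : deg e x = \sum_y (e x y : nat).
Proof. by rewrite /deg -sum1dep_card big_mkcond. Qed.

Lemma total_supp e S : (forall x y, e x y -> x \in S) -> \sum_(x in S) deg e x = total e.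
Proof.
move=> supp; rewrite /total [RHS](bigID (mem S)) /= [X in _ + X]big1 ?addn0 // => x xS.
by rewrite degE big1 // => y _; case: (boolP (e x y)) => // /supp; rewrite (negbTE xS).
Qed.

Lemma total_add e e1 e2 : (forall x y, (e x y : nat) = e1 x y + e2 x y) ->
  total e = total e1 + total e2.
Proof.
move=> e12; rewrite /total -big_split; apply: eq_bigr => x _.
by rewrite !degE -big_split; apply: eq_bigr.
Qed.

Lemma total_arcs e : total e = #|[set p : T * T | e p.1 p.2]|.
Proof.
rewrite /total -sum1dep_card; under eq_bigr do rewrite degE.
by rewrite pair_bigA [RHS]big_mkcond; apply: eq_bigr => p _ /=; case: (e _ _).
Qed.

Lemma double_edges_le_total e : symmetric e -> irreflexive e -> 2 * num_edges e <= total e.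
Proof.
move=> eC eI; rewrite total_arcs mulnC /num_edges -sum_nat_const -sum1_card.
rewrite (partition_big (fun p : T * T => [set p.1; p.2]) (mem (edges e))) /=; last first.
  by case=> x y; rewrite inE /= => xy; apply/imset2P; exists x y; rewrite ?inE.
apply: leq_sum => E /imset2P[x y _]; rewrite inE => /andP[_ xy] ->.
rewrite sum1dep_card; apply: leq_trans (subset_leq_card (_ : [set (x, y); (y, x)] \subset _)).
  by rewrite cards2; case: eqP => // -[E' _]; rewrite E' eI in xy.
apply/subsetP => p; rewrite !inE => /orP[]/eqP-> /=; rewrite ?xy ?eqxx //.
by rewrite eC xy setUC eqxx.
Qed.

Definition induced e A : rel T := fun x y => [&& x \in A, y \in A & e x y].

Lemma total_delete e A : symmetric e ->
  total e + \sum_(x in A) #|[set y in A | e x y]| =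
  total (induced e (~: A)) + 2 * \sum_(x in A) deg e x.
Proof.
move=> eC; pose out x y := (x \in A) && e x y; pose ins x y := (y \in A) && e x y.
have outE : total out = \sum_(x in A) deg e x.
  rewrite /total [RHS]big_mkcond; apply: eq_bigr => x _; rewrite !degE.
  by rewrite /out; case: (x \in A) => //=; apply: big1.
have insE : total ins = \sum_(x in A) deg e x.
  rewrite -outE /total; under eq_bigr do rewrite degE; rewrite exchange_big /=.
  by apply: eq_bigr => x _; rewrite degE; apply: eq_bigr => y _; rewrite /ins /out eC.
have insideE : total (induced e A) = \sum_(x in A) #|[set y in A | e x y]|.
  rewrite /total [RHS]big_mkcond; apply: eq_bigr => x _.
  rewrite /deg /induced; case: (x \in A) => /=; first by apply: eq_card => y; rewrite !inE.
  by apply: eq_card0 => y; rewrite inE.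
rewrite mul2n -addnn -{1}outE -insE -insideE /total addnA -!big_split; apply: eq_bigr => x _ /=.
rewrite !degE -!big_split; apply: eq_bigr => y _ /=.
by rewrite /induced /out /ins !inE; case: (x \in A); case: (y \in A); case: (e x y).
Qed.

Lemma cycle1_free_sub e e' : subrel e' e -> cycle1_free e -> cycle1_free e'.
Proof. by move=> sub free s us s3 cs; apply: free => //; apply: sub_cycle cs. Qed.

Lemma degree_bound_add a b d :
  a + b <= d -> degree_bound a + degree_bound b <= degree_bound d.
Proof. by rewrite /degree_bound; lia. Qed.

Record free_graph e S : Prop := FreeGraph {
  fg_sym : symmetric e;
  fg_irr : irreflexive e;
  fg_supp : forall x y, e x y -> x \in S;
  fg_free : cycle1_free e }.

Lemma free_graph_induced e S A : free_graph e S -> free_graph (induced e A) (S :&: A).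
Proof.
case=> eC eI supp free; split.
- by move=> x y; rewrite /induced eC andbCA.
- by move=> x; rewrite /induced eI !andbF.
- by move=> x y /and3P[xA _ /supp xS]; rewrite inE xS.
by apply: cycle1_free_sub free => x y /and3P[].
Qed.

End Total.

(** * Folding a path *)

Section Fold.
Variables (T : finType) (e : rel T) (S : {set T}) (v a b z : T).
Hypothesis fg : free_graph e S.
Hypotheses (va : e v a) (vb : e v b) (ab : a != b) (az : e a z) (zv : z != v) (zb : z != b).
Let eC : symmetric e := fg_sym fg.
Let eI : irreflexive e := fg_irr fg.
Let free : cycle1_free e := fg_free fg.

(* Delete [v] and [a], and identify [z] with [b]. *)
Definition folded : rel T := fun x y =>
  [&& x \notin [set v; a; z], y \notin [set v; a; z]
    & [|| e x y, (x == b) && e z y | (y == b) && e x z]].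

Lemma folded_nonadj : ~~ e b z.
Proof.
apply/negP => bz; rewrite eC in bz; have bv : e b v by rewrite eC.
by apply: (cycle4_free free eI va az bz bv _ ab); rewrite eq_sym.
Qed.

Lemma folded_sym : symmetric folded.
Proof.
move=> x y; rewrite /folded andbCA; congr [&& _, _ & _].
by rewrite [e y x]eC [e z y]eC [e y z]eC; congr (_ || _); rewrite orbC; congr (_ || _); rewrite eC.
Qed.

Lemma folded_irr : irreflexive folded.
Proof.
move=> x; rewrite /folded eI /=; case: (eqVneq x b) => [->|_]; last by rewrite !andbF.
by rewrite [e z b]eC (negbTE folded_nonadj) !andbF.
Qed.

Lemma folded_edge x y : folded x y -> x != b -> y != b -> e x y.
Proof. by case/and3P => _ _ /or3P[//|/andP[/eqP-> _]|/andP[/eqP-> _]]; rewrite eqxx. Qed.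

(* A closed walk using one old edge at [b] and one at [z] is completed by [b - v - a - z],
   which lengthens it by 3. *)
Lemma folded_cycle_length (L : {set T}) p q k : upath e L p q k -> 0 < k ->
  b \notin L -> v \notin L -> a \notin L -> z \notin L ->
  e b p \/ e z p -> e q b \/ e q z -> k.+2 %% 3 <> 1.
Proof.
move=> P k0 bL vL aL zL bzp bzq.
have bv : e b v by rewrite eC.
have av : e a v by rewrite eC.
have za : e z a by rewrite eC.
have v_a := edge_neq eI va; have v_b := edge_neq eI vb; have a_z := edge_neq eI az.
case: bzp bzq => [bp|zp] [qb|qz].
- exact: (upath_cycle1_free free (upath_cons bp bL P) qb).
- have Q1 := fun h => upath_rcons eC (upath_rcons eC (upath_cons bp bL P) qz h) za.
  have Q2 := fun h h' => upath_rcons eC (Q1 h h') av.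
  have : k.+4.+1 %% 3 <> 1.
    by apply: (upath_cycle1_free free (Q2 _ _ _) vb); mem_simpl.
  by clear; lia.
- have Q1 := fun h => upath_rcons eC (upath_rcons eC (upath_cons zp zL P) qb h) bv.
  have Q2 := fun h h' => upath_rcons eC (Q1 h h') va.
  have : k.+4.+1 %% 3 <> 1.
    by apply: (upath_cycle1_free free (Q2 _ _ _) az); mem_simpl.
  by clear; lia.
exact: (upath_cycle1_free free (upath_cons zp zL P) qz).
Qed.

Lemma folded_free : cycle1_free folded.
Proof.
move=> s us s3 cs; case: (boolP (b \in s)) => bs; last first.
  apply: free => //; apply: (sub_in_cycle (P := [pred x in s])) cs; last by apply/allP.
  move=> x y; rewrite !inE => xs ys /folded_edge; apply.
    by apply: contraNneq bs => <-.
  by apply: contraNneq bs => <-.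
have out w : w \in s -> w \notin [set v; a; z] by move/(next_cycle cs) => /andP[].
case: (rot_to bs) => r [|p t] E; first by move: s3; rewrite -(size_rot r) E.
rewrite -(size_rot r) E.
have {}out w : w \in b :: p :: t -> w \notin [set v; a; z] by rewrite -E mem_rot => /out.
have : uniq (b :: p :: t) by rewrite -E rot_uniq.
have : cycle folded (b :: p :: t) by rewrite -E rot_cycle.
rewrite /= rcons_path => /and3P[fbp fpt fqb] /andP[bpt upt].
have tL w : w \in p :: t -> w != b by move=> wt; apply: contraNneq bpt => <-.
pose L := [set x in p :: t].
have P : upath e L p (last p t) (size t).
  exists t; split=> // [|w wt]; last by rewrite inE.
  apply: (sub_in_path (P := [pred x in p :: t])) fpt; last by apply/allP.
  by move=> x y xs ys /folded_edge; apply; apply: tL.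
have notL w : w \in [set v; a; z] -> w \notin L.
  by rewrite [w \in L]inE; apply: contraL => wt; apply: out; rewrite in_cons wt orbT.
have pL := upath_head P; have qL := upath_last P; rewrite !inE in pL qL.
have bL : b \notin L by rewrite inE.
apply: (folded_cycle_length P _ bL); rewrite ?notL ?inE ?eqxx ?orbT //.
- by move: s3; rewrite -(size_rot r) E /=; case: (size t).
- case/and3P: fbp => _ _ /or3P[|/andP[_]|/andP[/eqP F _]]; [by left|by right|].
  by have := tL _ pL; rewrite F eqxx.
case/and3P: fqb => _ _ /or3P[|/andP[/eqP F _]|/andP[_]]; [by left| |by right].
by have := tL _ qL; rewrite F eqxx.
Qed.

Hypothesis no_common : forall y, e b y -> e z y -> y != v -> y != a -> False.

Let image x := if x == z then b else x.

Let image_inj_at x x' y : e x y -> e x' y -> y \notin [set v; a] -> image x = image x' -> x = x'.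
Proof.
move=> xy x'y; rewrite !inE negb_or => /andP[yv ya]; rewrite /image.
case: eqP => [xz|_]; case: eqP => [x'z|_] E; subst => //.
  by case: (no_common x'y xy).
by case: (no_common xy x'y).
Qed.

Lemma folded_total : total (induced e (~: [set v; a])) <= total folded.
Proof.
rewrite !total_arcs; pose g (p : T * T) := (image p.1, image p.2).
have imageE x : image x = x \/ x = z /\ image x = b.
  by rewrite /image; case: eqP; [right|left].
have image_out x : x \notin [set v; a] -> image x \notin [set v; a; z].
  rewrite /image; case: (eqVneq x z) => [_ _|xz]; last by rewrite !inE (negbTE xz) orbF.
  by rewrite !inE !negb_or eq_sym (edge_neq eI vb) eq_sym ab eq_sym zb.
rewrite -(card_in_imset (f := g)).
  apply/subset_leq_card/subsetP => q /imsetP[[x y]]; rewrite inE /= /induced !in_setC.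
  case/and3P => xA yA xy ->; rewrite inE /folded /= !image_out //=.
  case: (imageE x) => [->|[xz ->]]; case: (imageE y) => [->|[yz ->]]; rewrite ?eqxx.
  - by rewrite xy.
  - by rewrite -yz xy !orbT.
  - by rewrite -xz xy !orbT.
  by rewrite xz yz eI in xy.
move=> [x y] [x' y']; rewrite !in_set /= /induced !in_setC.
move=> /and3P[xA yA xy] /and3P[x'A y'A x'y'] [fx fy].
case: (eqVneq y y') => [E|yy'].
  by subst y'; rewrite (image_inj_at xy x'y' yA fx).
case: (eqVneq x x') => [E|xx'].
  subst x'; rewrite eC in xy; rewrite eC in x'y'.
  by rewrite (image_inj_at xy x'y' xA fy).
have bz := folded_nonadj; have zb' : ~~ e z b by rewrite eC.
exfalso; move: fx fy xx' yy'; rewrite /image.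
case: (eqVneq x z) => xz; case: (eqVneq x' z) => x'z fx; subst; rewrite ?eqxx // => fy _;
  move: fy; case: (eqVneq y z) => yz; case: (eqVneq y' z) => y'z fy; subst; rewrite ?eqxx //;
  by rewrite ?eI ?(negbTE bz) ?(negbTE zb') in xy x'y'.
Qed.

End Fold.

(** * A minimal counterexample is critical *)

Section MinimalCounterexample.
Variables (T : finType) (e : rel T) (S : {set T}).
Hypotheses (fg : free_graph e S) (S0 : 0 < #|S|).
Hypothesis IH : forall S' : {set T}, #|S'| < #|S| -> forall e' : rel T,
  free_graph e' S' -> 0 < #|S'| -> total e' <= degree_bound (#|S'| - 1).
Hypothesis dense : degree_bound (#|S| - 1) < total e.
Implicit Types (A K : {set T}).
Let eC : symmetric e := fg_sym fg.
Let eI : irreflexive e := fg_irr fg.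

Let supp x y : e x y -> x \in S.
Proof. exact: (fg_supp fg). Qed.

Let supp' x y : e x y -> y \in S.
Proof. by rewrite eC; apply: supp. Qed.

Lemma total_deleted_le A : {subset A <= S} -> 0 < #|A| < #|S| ->
  total (induced e (~: A)) <= degree_bound (#|S| - #|A| - 1).
Proof.
move=> AS /andP[A0 AS'].
have cardD : #|S :\: A| = #|S| - #|A| by rewrite cardsD (setIidPr _) //; apply/subsetP.
rewrite -cardD; apply: IH.
- by rewrite cardD; move: A0 S0; clear; lia.
- by rewrite setDE; apply: free_graph_induced.
by rewrite cardD subn_gt0.
Qed.

Lemma edge_inner_degrees x y : e x y ->
  2 <= \sum_(t in [set x; y]) #|[set r in [set x; y] | e t r]|.
Proof.
move=> xy; apply: leq_trans (_ : \sum_(t in [set x; y]) 1 <= _).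
  by rewrite sum1_card cards2 (edge_neq eI xy).
apply: leq_sum => t; rewrite !inE => /orP[]/eqP->; apply/card_gt0P.
  by exists y; rewrite !inE eqxx orbT.
by exists x; rewrite !inE eqxx eC.
Qed.

Lemma sum_deg_edge x y : e x y -> \sum_(t in [set x; y]) deg e t = deg e x + deg e y.
Proof. by move=> xy; rewrite big_setU1 ?inE ?(edge_neq eI xy) // big_set1. Qed.

Lemma minimal_deg_gt1 x : x \in S -> 1 < deg e x.
Proof.
move=> xS; rewrite ltnNge; apply/negP => d1.
have xS' : {subset [set x] <= S} by move=> w /set1P->.
have := total_delete [set x] eC; have := total_deleted_le xS'; rewrite cards1 /= big_set1.
case: (ltnP 1 #|S|) => [S1 /(_ isT)|S1 _].
  by rewrite big_set1; move: dense d1 S1; rewrite /degree_bound; clear; lia.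
move=> _; have SE : S = [set x].
  by apply/esym/eqP; rewrite eqEcard cards1 S1 andbT; apply/subsetP.
have d0 : deg e x = 0.
  apply: eq_card0 => y; rewrite inE; apply/negP => xy.
  by have := supp' xy; rewrite SE inE => /eqP E; rewrite E eI in xy.
by move: dense; rewrite -(total_supp (fg_supp fg)) SE big_set1 d0 cards1.
Qed.

Lemma minimal_deg2_nonadj x y : e x y -> deg e x = 2 -> deg e y = 2 -> False.
Proof.
move=> xy dx dy; have x_y := edge_neq eI xy.
have AS : {subset [set x; y] <= S}.
  by move=> w /set2P[]->; [apply: supp xy|apply: supp' xy].
have card2 : #|[set x; y]| = 2 by rewrite cards2 x_y.
have S2 : 2 < #|S|.
  have [r xr ry] := deg_gt1_neq y (minimal_deg_gt1 (supp xy)).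
  have : #|[set r; x; y]| <= #|S|.
    apply/subset_leq_card/subsetP => w; rewrite -setUA in_setU1 => /orP[/eqP->|/AS//].
    exact: supp' xr.
  by rewrite -setUA cardsU1 card2 !inE negb_or eq_sym (edge_neq eI xr) ry.
have := total_delete [set x; y] eC; rewrite sum_deg_edge // dx dy.
have := edge_inner_degrees xy; have := total_deleted_le AS; rewrite card2 S2 => /(_ isT).
by move: dense S2; rewrite /degree_bound; clear; lia.
Qed.

Lemma total_cut K z : (forall u w, u \in K -> e u w -> w \notin K -> w = z) ->
  total e = total (induced e (z |: K)) + total (induced e (~: K)).
Proof.
move=> cl; apply: total_add => x y; rewrite /induced !in_setU1 !in_setC.
case: (boolP (e x y)) => xy; last by rewrite !andbF.
rewrite !andbT; case: (boolP (x \in K)) => xK; case: (boolP (y \in K)) => yK;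
  rewrite ?orbT ?orbF //=.
- by rewrite (cl x y) ?eqxx.
- by rewrite andbT (cl y x) ?eqxx // eC.
case: (eqVneq x z) => [xz|_] //=; case: (eqVneq y z) => [yz|//].
by rewrite xz yz eI in xy.
Qed.

Lemma minimal_no_cut K z u : u \in K -> {subset K <= S} -> z \notin K ->
  (forall u w, u \in K -> e u w -> w \notin K -> w = z) -> {subset S <= z |: K}.
Proof.
move=> uK KS zK cl w wS; apply: contraT; rewrite in_setU1 negb_or => /andP[wz wK]; exfalso.
pose S1 := S :&: (z |: K).
have S1K : #|S1| <= #|K|.+1.
  by apply: leq_trans (subset_leq_card (subsetIr _ _)) _; rewrite cardsU1 zK.
have S1S : #|S1| < #|S|.
  apply: (card_lt_notin _ wS); first by move=> t /setIP[].
  by rewrite !inE wS (negbTE wz) (negbTE wK).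
have S1_gt0 : 0 < #|S1| by apply/card_gt0P; exists u; rewrite !inE uK orbT KS.
have K0 : 0 < #|K| by apply/card_gt0P; exists u.
have KS' : #|K| < #|S| := card_lt_notin KS wS wK.
have le_K : total (induced e (~: K)) <= degree_bound (#|S| - #|K| - 1).
  by apply: total_deleted_le; rewrite // K0.
have le_S1 : total (induced e (z |: K)) <= degree_bound (#|S1| - 1).
  by apply: IH => //; apply: free_graph_induced.
have : degree_bound (#|S1| - 1) + degree_bound (#|S| - #|K| - 1) <= degree_bound (#|S| - 1).
  by apply: degree_bound_add; move: S1K S1_gt0 K0 KS'; clear; lia.
by move: dense le_K le_S1; rewrite (total_cut cl); clear; lia.
Qed.

Lemma minimal_no_claw z : deg e z = 3 -> (forall u, e z u -> deg e u = 2) -> False.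
Proof.
move=> dz du; pose A := z |: [set y | e z y].
have zA : z \notin [set y | e z y] by rewrite inE eI.
have card4 : #|A| = 4 by rewrite cardsU1 zA -/(deg e z) dz.
have AS : {subset A <= S}.
  have /card_gt0P[y] : 0 < deg e z by rewrite dz.
  rewrite inE => zy w; rewrite !inE => /orP[/eqP->|]; [exact: supp zy|exact: supp'].
have sumA : \sum_(x in A) deg e x = 9.
  rewrite big_setU1 //= dz (eq_bigr (fun=> 2)); last by move=> x; rewrite inE; apply: du.
  by rewrite sum_nat_const -/(deg e z) dz.
have innerA : 6 <= \sum_(x in A) #|[set y in A | e x y]|.
  rewrite big_setU1 //=; apply: (@leq_add 3 3).
    by rewrite -dz; apply/subset_leq_card/subsetP => y; rewrite !inE => ->; rewrite orbT.
  apply: leq_trans (_ : \sum_(x in [set y | e z y]) 1 <= _); first by rewrite sum1_card -dz.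
  apply: leq_sum => y; rewrite inE => zy; apply/card_gt0P; exists z.
  by rewrite !inE eqxx eC.
have := total_delete A eC; rewrite sumA; have := total_deleted_le AS; rewrite card4 /=.
case: (ltnP 4 #|S|) => [S4 /(_ isT)|S4 _ _].
  by move: dense innerA S4; rewrite /degree_bound; clear; lia.
have SA : S = A by apply/esym/eqP; rewrite eqEcard card4 S4 andbT; apply/subsetP.
by move: dense; rewrite -(total_supp (fg_supp fg)) SA sumA card4.
Qed.

Lemma free_graph_folded v a b z : e v a -> e v b -> a != b -> e a z -> z != v -> z != b ->
  free_graph (folded e v a b z) (S :\: [set v; a; z]).
Proof.
move=> va vb ab az zv zb; split.
- exact: folded_sym fg.
- exact: (folded_irr fg va vb ab az zv).
- move=> x y /and3P[xD _ xy]; rewrite in_setD xD /=.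
  by case/or3P: xy => [/supp//|/andP[/eqP-> _]|/andP[_ /supp//]]; apply: supp' vb.
exact: (folded_free fg va vb ab az zv zb).
Qed.

Lemma minimal_fold v a b z : deg e v = 2 -> e v a -> e v b -> a != b -> deg e a = 3 ->
  e a z -> z != v -> z != b -> exists y, [/\ e b y, e z y, y != v & y != a].
Proof.
move=> dv va vb ab da az zv zb.
case: (boolP [exists y, [&& e b y, e z y, y != v & y != a]]) => [/existsP[y /and4P[]]|none].
  by exists y.
exfalso; have no_common y : e b y -> e z y -> y != v -> y != a -> False.
  by move=> by_ zy yv ya; case/existsP: none; exists y; rewrite by_ zy yv.
have AS : {subset [set v; a; z] <= S}.
  move=> w; rewrite !inE -orbA.
  by case/or3P => /eqP->; [apply: supp va|apply: supp' va|apply: supp' az].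
have card3 : #|[set v; a; z]| = 3.
  by rewrite -setUA cardsU1 cards2 !inE negb_or (edge_neq eI va) (edge_neq eI az) eq_sym zv.
have cardD : #|S :\: [set v; a; z]| = #|S| - 3.
  by rewrite cardsD (setIidPr _) ?card3 //; apply/subsetP.
have D0 : 0 < #|S :\: [set v; a; z]|.
  apply/card_gt0P; exists b; rewrite !inE !negb_or eq_sym (edge_neq eI vb).
  by rewrite eq_sym ab eq_sym zb (supp' vb).
have le_folded : total (folded e v a b z) <= degree_bound (#|S| - 3 - 1).
  rewrite -cardD; apply: (IH _ (free_graph_folded va vb ab az zv zb)) => //.
  by rewrite cardD; move: S0; clear; lia.
have := folded_total fg va vb ab az zv zb no_common; have := total_delete [set v; a] eC.
rewrite sum_deg_edge // dv da; have := edge_inner_degrees va.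
by move: dense le_folded D0; rewrite cardD /degree_bound; clear; lia.
Qed.

Lemma minimal_critical : critical e S.
Proof.
split.
- exact: eC.
- exact: eI.
- exact: fg_supp fg.
- exact: fg_free fg.
- exact: minimal_deg_gt1.
- exact: minimal_deg2_nonadj.
- exact: minimal_no_cut.
- exact: minimal_no_claw.
- exact: minimal_fold.
by rewrite (total_supp (fg_supp fg)).
Qed.

End MinimalCounterexample.

Lemma free_graph_total_le (T : finType) (e : rel T) (S : {set T}) :
  free_graph e S -> 0 < #|S| -> total e <= degree_bound (#|S| - 1).
Proof.
elim/card_set_ind: S e => S IH e fg S0; rewrite leqNgt; apply/negP => dense.
have /card_gt0P[x xS] := S0.
exact: (critical_empty (minimal_critical fg S0 IH dense) xS).
Qed.

Lemma cycle1_free_or_cycle (T : finType) (e : rel T) :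
  cycle1_free e \/ exists k : nat, k %% 3 = 1 /\ has_cycle_of_length e k.
Proof.
case: (boolP [exists k : 'I_#|T|.+1, exists t : k.-tuple T,
    [&& uniq t, 2 < k, cycle e t & k %% 3 == 1]]) => [|none].
  case/existsP => k /existsP[t /and4P[ut k3 ct /eqP k1]].
  by right; exists k; split=> //; exists t; rewrite size_tuple.
left=> s us s3 cs s1; case/negP: none.
have sT : size s < #|T|.+1 by rewrite ltnS -(card_uniqP us) max_card.
apply/existsP; exists (Ordinal sT); apply/existsP; exists (in_tuple s).
by rewrite /= us s3 cs s1.
Qed.

Theorem theorem1p2 (T : finType) (e : rel T) (n q r : nat) :
  symmetric e -> irreflexive e ->
  #|T| = n -> 1 <= n ->
  n - 1 = 9 * q + r -> r <= 8 ->
  15 * q + (3 * r) %/ 2 < num_edges e ->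
  exists k : nat, k %% 3 = 1 /\ has_cycle_of_length e k.
Proof.
move=> eC eI Tn n1 nqr r8 many; case: (cycle1_free_or_cycle e) => // free; exfalso.
have fg : free_graph e [set: T] by split=> // x y _; apply: in_setT.
have := free_graph_total_le fg; rewrite cardsT Tn => /(_ n1).
have := double_edges_le_total eC eI.
by move: many r8; rewrite nqr /degree_bound; clear; lia.
Qed.
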